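(* Let $\boldsymbol\alpha$ be a sequence compactly included in $\mathbb D$ (i.e. $\sup_n|\alpha_n|<1$), $\mu$ a measure on $\mathbb T$, $(\phi_n)_{n\ge0}$ the corresponding ORF and $(\chi_n)_{n\ge0}$ the ORF associated with $(\alpha_1,\hat\alpha_2,\alpha_3,\hat\alpha_4,\dots)$. Let $$\mathcal U=\tilde\zeta_{\mathcal A}(\mathcal C),\qquad \mathcal A=\mathcal A(\boldsymbol\alpha),\quad \mathcal C=\mathcal C(\boldsymbol a),\quad \boldsymbol a=\mathcal S_{\boldsymbol\alpha}(\mu),$$ and let $\mathcal E$ be the spectral measure of (the unitary operator on $\ell^2$ given by) $\mathcal U$. Then $\mu=\mathcal E_{1,1}$, where $\mathcal E_{1,1}(\Delta)$ denotes the $(1,1)$ (first diagonal) entry of the matrix $\mathcal E(\Delta)$. Besides, $\operatorname{supp}\mu=\sigma(\mathcal U)$ and the mass points of $\mu$ are the eigenvalues of $\mathcal U$, which have geometric multiplicity 1. A complex number $\lambda$ (not a pole of any $\chi_n$) is a mass point of $\mu$ if and only if $(\chi_n(\lambda))_{n\ge0}\in\ell^2$. Given a mass point $\lambda$, the corresponding eigenvectors of $\mathcal U$ are spanned by $\begin{pmatrix}\chi_0(\lambda)&\chi_1(\lambda)&\cdots\end{pmatrix}^\dag$, and $$\mu(\{\lambda\})=\Big(\sum_{n=0}^\infty|\chi_n(\lambda)|^2\Big)^{-1}=\Big(\sum_{n=0}^\infty|\phi_n(\lambda)|^2\Big)^{-1}.$$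
   Context: $\mathbb T$ is the unit circle, $\mathbb D$ the open unit disk. A measure on $\mathbb T$ is a probability Borel measure $\mu$ on $\mathbb T$ with infinite support $\operatorname{supp}\mu$. $L^2_\mu$ carries the inner product $\langle f,g\rangle_\mu=\int\overline{f}\,g\,d\mu$. ORF. Let $\boldsymbol\alpha=(\alpha_n)_{n\ge1}$ be a sequence in $\mathbb D$ and set $\alpha_0=0$. For $n\ge0$ let $\varpi_n(z)=1-\overline{\alpha_n}z$, $\varpi_n^*(z)=z-\alpha_n$, $\zeta_n=\varpi_n^*/\varpi_n$. Let $B_0=1$, $B_n=\zeta_1\cdots\zeta_n$, $f_*(z)=\overline{f(1/\overline z)}$ and $\hat z=1/\overline z$ (with $\hat 0=\infty$). The orthogonal rational functions (ORF) $(\phi_n)_{n\ge0}$ of $\mu$ associated with $\boldsymbol\alpha$ are the result of orthonormalizing $(B_n)_{n\ge0}$ in $L^2_\mu$ (so $\phi_0,\dots,\phi_n$ is an orthonormal basis of $\operatorname{span}\{B_0,\dots,B_n\}$ for every $n$), with unimodular factors chosen so that $\phi_0=1$ and, with $\phi_n^*=B_n\phi_{n*}$, $$\begin{pmatrix}\phi_n\\ \phi_n^*\end{pmatrix}=e_n\frac{\varpi_{n-1}}{\varpi_n}\begin{pmatrix}1&a_n\\ \overline{a_n}&1\end{pmatrix}\begin{pmatrix}\zeta_{n-1}\phi_{n-1}\\ \phi_{n-1}^*\end{pmatrix},\quad e_n=\sqrt{\frac{\varpi_n(\alpha_n)}{\varpi_{n-1}(\alpha_{n-1})}\frac1{1-|a_n|^2}},\quad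 n\ge1,$$ for some $a_n\in\mathbb D$. This normalization exists and both $(\phi_n)$ and $\boldsymbol a=(a_n)_{n\ge1}$ are then uniquely determined; one writes $\boldsymbol a=\mathcal S_{\boldsymbol\alpha}(\mu)$. Put $B_0^e=1$ and $B_n^e=\zeta_2\zeta_4\cdots\zeta_{2n}$. The ORF $(\chi_n)_{n\ge0}$ associated with $(\alpha_1,\hat\alpha_2,\alpha_3,\hat\alpha_4,\dots)$ are $\chi_{2n}=B^e_{n*}\phi_{2n}^*$, $\chi_{2n+1}=B^e_{n*}\phi_{2n+1}$, $n\ge0$; they form an orthonormal sequence in $L^2_\mu$. Matrices. Infinite bounded matrices are identified with operators on $\ell^2$ acting on column vectors. $\mathcal A(\boldsymbol\alpha)=\operatorname{diag}(\alpha_0,\alpha_1,\alpha_2,\dots)$. With $\rho_n=\sqrt{1-|a_n|^2}$ and $\Theta_n=\begin{pmatrix}-a_n&\rho_n\\ \rho_n&\overline{a_n}\end{pmatrix}$, $\mathcal C(\boldsymbol a)=\mathcal C_o\mathcal C_e$ is the five-diagonal unitary matrix with $\mathcal C_o=\Theta_1\oplus\Theta_3\oplus\Theta_5\oplus\cdots$ and $\mathcal C_e=1\oplus\Theta_2\oplus\Theta_4\oplus\cdots$ (here $1$ is a $1\times1$ block). Operator Möbius transformation. For bounded operators $A,T$ on a Hilbert space with $\|A\|<1$, $\|T\|\le1$, set $\eta_A=\sqrt{1-AA^\dag}$ and $\tilde\zeta_A(T)=\eta_A^{-1}(T+A)(1+A^\dag T)^{-1}\eta_{A^\dag}$; it maps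 unitary operators to unitary operators. The superscript $\dag$ denotes adjoint (conjugate transpose). *)

(* Defs.v *)
From HB Require Import structures.
From mathcomp Require Import all_boot all_order all_algebra fraction.
From mathcomp Require Import generic_quotient.
From mathcomp Require Import complex ring.
From mathcomp Require Import all_classical all_reals all_analysis.

Set Implicit Arguments.
Unset Strict Implicit.
Unset Printing Implicit Defensive.

Import Order.TTheory GRing.Theory Num.Theory.
Import numFieldNormedType.Exports.

Local Open Scope classical_set_scope.
Local Open Scope ring_scope.

(* This puts the topology of the norm on R[i]. *)
HB.instance Definition _ (R : realType) := NormedModule.copy R[i] R[i]^o.

Definition cabs (R : realType) (z : R[i]) : R := Normc.normc z.

Definition borelC (R : realType) := g_sigma_algebraType (@open R[i]).

Definition circle (R : realType) : set R[i] := [set z | `|z| = 1].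

Definition msupport (R : realType) (mu : set (borelC R) -> \bar R) : set R[i] :=
  [set z | forall V : set R[i], open V -> V z -> (0 < mu V)%E].

(* A probability Borel measure on the circle is encoded as a probability Borel
   measure on the plane which is concentrated on the circle. *)
Definition measure_on_circle (R : realType) (mu : probability (borelC R) R) :
  Prop := mu (@circle R) = 1%E /\ infinite_set (msupport mu).

Definition mass_point (R : realType) (mu : set (borelC R) -> \bar R)
  (z : R[i]) : Prop := (0 < mu [set z])%E.

Definition cintegral (R : realType) (m : set (borelC R) -> \bar R)
    (D : set (borelC R)) (f : R[i] -> R[i]) : R[i] :=
  Complex (fine (\int[m]_(z in D) (complex.Re (f z))%:E))
          (fine (\int[m]_(z in D) (complex.Im (f z))%:E)).

Local Notation "x %:F" := (tofrac x).

Notation ratfun R := {fraction {poly R[i]}}.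

Section RationalFunctions.
Variable R : realType.
Implicit Types (f : ratfun R) (z : R[i]).

Definition rconst (c : R[i]) : ratfun R := (c%:P)%:F.

(* [repr f] is an arbitrary numerator/denominator pair of f; the two following
   polynomials are its reduced form. *)
Definition rnum f : {poly R[i]} :=
  (repr f).1 %/ gcdp (repr f).1 (repr f).2.
Definition rden f : {poly R[i]} :=
  (repr f).2 %/ gcdp (repr f).1 (repr f).2.

Definition is_pole f z : Prop := root (rden f) z.

(* The value of f at z, meaningful when z is not a pole. *)
Definition reval f z : R[i] := (rnum f).[z] / (rden f).[z].

(* f_*(z) = conj (f (1 / conj z)); for a polynomial, this is the polynomial
   with conjugate coefficients evaluated at 1/z. *)
Definition psub (p : {poly R[i]}) : ratfun R :=
  (map_poly (fun c : R[i] => rconst c^*) p).[('X%:F)^-1].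

Definition rsub f : ratfun R := psub (repr f).1 / psub (repr f).2.

Definition rspan (F : nat -> ratfun R) (n : nat) : set (ratfun R) :=
  [set f | exists c : nat -> R[i], f = \sum_(k < n.+1) rconst (c k) * F k].

Definition L2inner (mu : set (borelC R) -> \bar R) f g : R[i] :=
  cintegral mu (@circle R) (fun z => (reval f z)^* * reval g z).

End RationalFunctions.

Section ORF.
Variables (R : realType) (alpha : nat -> R[i]).

Definition varpi (n : nat) : {poly R[i]} := 1 - (alpha n)^* *: 'X.
Definition varpistar (n : nat) : {poly R[i]} := 'X - (alpha n)%:P.
Definition zeta (n : nat) : ratfun R := (varpistar n)%:F / (varpi n)%:F.
Definition Blaschke (n : nat) : ratfun R := \prod_(1 <= k < n.+1) zeta k.
Definition Blaschke_e (n : nat) : ratfun R := \prod_(1 <= k < n.+1) zeta k.*2.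

Definition superstar (phi : nat -> ratfun R) (n : nat) : ratfun R :=
  Blaschke n * rsub (phi n).

Definition ecoef (a : nat -> R[i]) (n : nat) : R[i] :=
  sqrtC ((varpi n).[alpha n] / (varpi n.-1).[alpha n.-1]
         * (1 - `|a n| ^+ 2)^-1).

(* [phi] is the sequence of ORF of [mu] associated with [alpha], with the
   normalization given by the recurrence, and a = S_alpha(mu) is the sequence
   of recurrence coefficients; a is indexed from 1, and a 0 is irrelevant. *)
Record is_ORF (mu : set (borelC R) -> \bar R) (phi : nat -> ratfun R)
    (a : nat -> R[i]) : Prop := IsORF {
  orf_orthonormal : forall m n, L2inner mu (phi m) (phi n) = (m == n)%:R;
  orf_span : forall n, rspan phi n = rspan Blaschke n;
  orf_0 : phi 0%N = 1;
  orf_disk : forall n, (0 < n)%N -> cabs (a n) < 1;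
  orf_rec : forall n, (0 < n)%N ->
    phi n = rconst (ecoef a n) * ((varpi n.-1)%:F / (varpi n)%:F)
      * (zeta n.-1 * phi n.-1 + rconst (a n) * superstar phi n.-1);
  orf_rec_star : forall n, (0 < n)%N ->
    superstar phi n = rconst (ecoef a n) * ((varpi n.-1)%:F / (varpi n)%:F)
      * (rconst (a n)^* * (zeta n.-1 * phi n.-1) + superstar phi n.-1)
}.

(* The ORF associated with (alpha_1, 1/conj alpha_2, alpha_3, ...). *)
Definition chi_of (phi : nat -> ratfun R) (n : nat) : ratfun R :=
  rsub (Blaschke_e n./2) * (if odd n then phi n else superstar phi n).

End ORF.

Section L2.
Variable R : realType.
Implicit Types x y : nat -> R[i].

Definition sqsum x : \bar R := (\sum_(0 <= n <oo) ((cabs (x n)) ^+ 2)%:E)%E.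
Definition in_l2 x : Prop := (sqsum x < +oo)%E.
Definition l2pred : {pred (nat -> R[i])} := [pred x | `[< in_l2 x >]].

Lemma cabsE (z : R[i]) : `|z| = (cabs z)%:C%C. Proof. by []. Qed.

Lemma cabs_ge0 (z : R[i]) : 0 <= cabs z.
Proof. by rewrite -lecR -cabsE normr_ge0. Qed.

Lemma cabsM (z w : R[i]) : cabs (z * w) = cabs z * cabs w.
Proof. exact: Normc.normcM. Qed.

Lemma cabsD (z w : R[i]) : cabs (z + w) <= cabs z + cabs w.
Proof. by rewrite -lecR rmorphD /= -!cabsE ler_normD. Qed.

Lemma sqsum_ge0 x n : (0 <= ((cabs (x n)) ^+ 2)%:E)%E.
Proof. by rewrite lee_fin sqr_ge0. Qed.

Lemma l2pred_submod_closed : submod_closed l2pred.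
Proof.
split.
  apply/asboolP; rewrite /in_l2 /sqsum eseries0 ?ltry// => i _ _.
  by rewrite /cabs Normc.normc0 expr0n.
move=> c x y /asboolP xl2 /asboolP yl2; apply/asboolP; rewrite /in_l2 /sqsum.
pose u n := ((2 * cabs c ^+ 2)%:E * ((cabs (x n)) ^+ 2)%:E)%E.
pose v n := (2%:E * ((cabs (y n)) ^+ 2)%:E)%E.
have u0 n : (0 <= u n)%E.
  by rewrite /u mule_ge0 ?sqsum_ge0// lee_fin mulr_ge0 ?sqr_ge0.
have v0 n : (0 <= v n)%E by rewrite /v mule_ge0 ?sqsum_ge0// lee_fin.
apply: (@le_lt_trans _ _ (\sum_(0 <= n <oo) (u n + v n))%E).
  apply: lee_nneseries => [i _ _|n _]; first exact: sqsum_ge0.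
  rewrite /u /v -!EFinM -EFinD lee_fin.
  have le1 : cabs ((c *: x + y) n) <= cabs c * cabs (x n) + cabs (y n).
    by rewrite (le_trans (cabsD _ _))// cabsM.
  apply: (@le_trans _ _ ((cabs c * cabs (x n) + cabs (y n)) ^+ 2)).
    by rewrite lerXn2r ?nnegrE ?addr_ge0 ?mulr_ge0 ?cabs_ge0.
  rewrite -subr_ge0.
  set p := cabs c; set q := cabs (x n); set r := cabs (y n).
  rewrite (_ : _ - _ = (p * q - r) ^+ 2) ?sqr_ge0//; ring.
rewrite nneseriesD// /u /v.
rewrite !nneseriesZl//; last 2 first.
- by move=> n _; exact: sqsum_ge0.
- by move=> n _; exact: sqsum_ge0.
rewrite lte_add_pinfty//; apply: lte_mul_pinfty => //; rewrite lee_fin//.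
by rewrite mulr_ge0 ?sqr_ge0.
Qed.

HB.instance Definition _ := GRing.isSubmodClosed.Build R[i] (nat -> R[i])
  l2pred l2pred_submod_closed.

Record l2 := L2 { l2val :> nat -> R[i]; l2valP : l2val \in l2pred }.

HB.instance Definition _ := [isSub for l2val].
HB.instance Definition _ := [Choice of l2 by <:].
HB.instance Definition _ := [SubChoice_isSubLmodule of l2 by <:].

Lemma delta_l2 (j : nat) : (fun i => (i == j)%:R : R[i]) \in l2pred.
Proof.
apply/asboolP; rewrite /in_l2 /sqsum (nneseries_split 0 j.+1)//; last first.
  by move=> k _; exact: sqsum_ge0.
rewrite eseries0 ?adde0 ?sumEFin ?ltry// => i ji _.
by rewrite gtn_eqF// /cabs Normc.normc0 expr0n.
Qed.

Definition l2e (j : nat) : l2 := L2 (delta_l2 j).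

Definition l2norm (x : l2) : R := Num.sqrt (fine (sqsum x)).
Definition l2inner (x y : l2) : R[i] :=
  limn (series (fun n => (x n)^* * y n)).

End L2.

Section Operators.
Variable R : realType.
Local Notation op := (l2 R -> l2 R).
Implicit Types (T S A U : op) (x y : l2 R) (z : R[i]).

Definition bounded_op T : Prop :=
  linear T /\ exists M : R, forall x, l2norm (T x) <= M * l2norm x.

Definition mxentry T (i j : nat) : R[i] := T (l2e R j) i.

(* Each operator below is characterized uniquely by the set it is chosen from;
   the zero operator is a dummy value, used when this set is empty. *)

Definition op_of_mx (M : nat -> nat -> R[i]) : op :=
  xget (fun=> 0) [set T | bounded_op T /\ forall i j, mxentry T i j = M i j].

Definition adjoint T : op :=
  xget (fun=> 0) [set S | bounded_op S /\
                          forall x y, l2inner (S x) y = l2inner x (T y)].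

Definition opsqrt T : op :=
  xget (fun=> 0) [set S | [/\ bounded_op S, forall x, 0 <= l2inner x (S x)
                           & S \o S = T]].

Definition opinv T : op :=
  xget (fun=> 0) [set S | [/\ bounded_op S, S \o T = id & T \o S = id]].

Definition opeta A : op := opsqrt (id \- (A \o adjoint A)).

Definition opmoebius A T : op :=
  opinv (opeta A) \o (T \+ A) \o opinv (id \+ (adjoint A \o T))
    \o opeta (adjoint A).

Definition spectrum T : set R[i] :=
  [set z | ~ exists S, [/\ bounded_op S, S \o (T \- *:%R z) = id
                         & (T \- *:%R z) \o S = id]].

Definition is_eigenvalue T z : Prop := exists2 x, x != 0 & T x = z *: x.

Definition geometrically_simple T z : Prop :=
  exists2 x, x != 0 & forall y, T y = z *: y <-> exists c : R[i], y = c *: x.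

(* E is the projection-valued measure on the Borel subsets of the circle (as
   above, on the Borel subsets of the plane and concentrated on the circle)
   such that U = \int z dE(z), i.e. <x, U x> = \int z d<x, E(z) x> for all x. *)
Record is_spectral_measure (U : op) (E : set (borelC R) -> op) : Prop :=
    IsSpectralMeasure {
  spm_bounded : forall D, measurable D -> bounded_op (E D);
  spm_idem : forall D, measurable D -> E D \o E D = E D;
  spm_selfadj : forall D, measurable D ->
    forall x y, l2inner (E D x) y = l2inner x (E D y);
  spm_circle : E (@circle R) = id;
  spm_sigma_additive : forall F : nat -> set (borelC R),
    (forall n, measurable (F n)) -> trivIset setT F ->
    forall x, l2norm (E (\bigcup_n F n) x - \sum_(k < n) E (F k) x)
      @[n --> \oo] --> (0 : R);
  spm_integral : forall x, l2inner x (U x) =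
    cintegral (fun D => (complex.Re (l2inner x (E D x)))%:E) (@circle R) id
}.

End Operators.

Section Matrices.
Variables (R : realType) (a : nat -> R[i]).

Definition Amx (alpha : nat -> R[i]) (i j : nat) : R[i] :=
  if i == j then alpha i else 0.

Definition rho (n : nat) : R[i] := sqrtC (1 - `|a n| ^+ 2).

(* Rows and columns of a 2 x 2 matrix are indexed by bool, false first. *)
Definition Theta (n : nat) (p q : bool) : R[i] :=
  match p, q with
  | false, false => - a n
  | true, true => (a n)^*
  | _, _ => rho n
  end.

Definition Comx (i j : nat) : R[i] :=
  if i./2 == j./2 then Theta i./2.*2.+1 (odd i) (odd j) else 0.

Definition Cemx (i j : nat) : R[i] :=
  match i, j with
  | O, O => 1
  | i'.+1, j'.+1 =>
      if i'./2 == j'./2 then Theta i'./2.*2.+2 (odd i') (odd j') else 0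
  | _, _ => 0
  end.

Definition Aop (alpha : nat -> R[i]) : l2 R -> l2 R := op_of_mx (Amx alpha).
Definition Cop : l2 R -> l2 R := op_of_mx Comx \o op_of_mx Cemx.

End Matrices.

(* Main.v *)
(** Let U = zeta_A(C). Clearing the inverse of 1 + A^dag C from the definition
    of U turns the equation U^dag x = w into a linear system between
    neighbouring entries of x and w. Its coefficients are those of the
    recurrence of the ORF, so that at every point z the vector of the
    conj(chi_n(z)) formally satisfies U^dag x = conj(z) x, and integrating the
    system against chi_i shows that U^dag has entries <chi_n, conj(z) chi_i>.
    Hence U acts as the multiplication by z on the functions for which Bessel's
    inequality for (chi_n) is an equality, and ||p(U) e_0||^2 = int |p|^2 dmu
    for every polynomial p, without knowing that (chi_n) is complete.

    The polynomials ((w + z) / 2)^N, which peak at z, then give the mass at z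
    and the inclusion of the support in the spectrum; off the support U - z is
    bounded below. If E is the spectral measure of U, then U commutes with E,
    so that <x, E(.) x> has density |z - c|^2 after replacing x by (U - c) x,
    and ||p(U) x||^2 = int |p|^2 d<x, E x>. For x = e_0 the two measures have
    the same integrals of |p|^2, which determine a measure on the circle. *)

From HB Require Import structures.
Require Import Defs.
From mathcomp Require Import all_boot all_order all_algebra fraction.
From mathcomp Require Import complex ring lra.
From mathcomp Require Import all_classical all_reals all_analysis.
From mathcomp Require Import measurable_realfun.

Set Implicit Arguments.
Unset Strict Implicit.
Unset Printing Implicit Defensive.

Import Order.TTheory GRing.Theory Num.Theory.
Import numFieldNormedType.Exports.

Local Open Scope classical_set_scope.
Local Open Scope ring_scope.

(** * Complex numbers *)

(** The inverse of 1 + A^dag C destroys the band structure of C. The factorization C = Co Ce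
    restores it, but for the adjoint: U Q = N with Q and N made of Co, Ce^dag and diagonal matrices,
    so U^dag x = w reads N^dag x = Q^dag w, whose k-th equation couples only the indices k-1, k,
    k+1. Hence V = U^dag is studied before U. Equality in Bessel's inequality propagates by itself:
    to linear combinations by polarization, and to products with z because conj(z) chi_i and U^dag
    e_i both have norm 1. Starting from 1 = chi_0, represented by e_0, this reaches every
    polynomial. A spectral measure is known only through the first moments <x, U x>, and no
    functional calculus is available. Orthogonality and commutation are extracted by polarization,
    and polynomials are treated one linear factor at a time. Only integrals of |p|^2 are obtained;
    they suffice because on the circle a real trigonometric polynomial has the modulus of a
    polynomial, and indicators of quadrants are limits of squares of such functions. *)

Section ComplexFacts.
Variable R : realType.
Implicit Types (z w : R[i]) (r : R).

Lemma cabs2E z : cabs z ^+ 2 = complex.Re z ^+ 2 + complex.Im z ^+ 2.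
Proof.
by case: z => a b; rewrite /cabs /= sqr_sqrtr // addr_ge0 ?sqr_ge0.
Qed.

Lemma cabs0 : cabs (0 : R[i]) = 0.
Proof. exact: Normc.normc0. Qed.

Lemma cabs1 : cabs (1 : R[i]) = 1.
Proof. exact: Normc.normc1. Qed.

Lemma cabs_eq0 z : (cabs z == 0) = (z == 0).
Proof.
by apply/eqP/eqP => [/Normc.eq0_normc//|->]; exact: cabs0.
Qed.

Lemma cabs_gt0 z : (0 < cabs z) = (z != 0).
Proof. by rewrite lt_def cabs_eq0 cabs_ge0 andbT. Qed.

Lemma cabsN z : cabs (- z) = cabs z.
Proof. by case: z => a b; rewrite /cabs /= !sqrrN. Qed.

Lemma cabsJ z : cabs z^* = cabs z.
Proof. by case: z => a b; rewrite /cabs /= !sqrrN. Qed.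

Lemma cabsV z : cabs z^-1 = (cabs z)^-1.
Proof. exact: Normc.normcV. Qed.

Lemma cabsX z n : cabs (z ^+ n) = cabs z ^+ n.
Proof. by elim: n => [|n IH]; rewrite ?expr0 ?cabs1// !exprS cabsM IH. Qed.

Lemma cabs_real r : cabs (r%:C)%C = `|r|.
Proof. by rewrite /cabs /= expr0n addr0 sqrtr_sqr. Qed.

Lemma cabsB z w : cabs (z - w) = cabs (w - z).
Proof. by rewrite -cabsN opprB. Qed.

Lemma conjM_cabs z : z^* * z = ((cabs z ^+ 2)%:C)%C.
Proof.
rewrite cabs2E; case: z => a b; apply/eqP; rewrite eq_complex /=.
by apply/andP; split; apply/eqP; ring.
Qed.

Lemma mulC_conj z : z * z^* = ((cabs z ^+ 2)%:C)%C.
Proof. by rewrite mulrC conjM_cabs. Qed.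

Lemma ler_Re_cabs z : `|complex.Re z| <= cabs z.
Proof.
rewrite -(@ler_pXn2r _ 2) ?nnegrE ?cabs_ge0// cabs2E real_normK ?num_real//.
by rewrite lerDl sqr_ge0.
Qed.

Lemma ler_Im_cabs z : `|complex.Im z| <= cabs z.
Proof.
rewrite -(@ler_pXn2r _ 2) ?nnegrE ?cabs_ge0// cabs2E real_normK ?num_real//.
by rewrite lerDr sqr_ge0.
Qed.

Lemma ler_cabs_ReIm z : cabs z <= `|complex.Re z| + `|complex.Im z|.
Proof.
rewrite -(@ler_pXn2r _ 2) ?nnegrE ?cabs_ge0 ?addr_ge0// cabs2E sqrrD.
rewrite !real_normK ?num_real// -addrA lerD2l lerDr.
by rewrite mulrn_wge0// mulr_ge0.
Qed.

Lemma ReD z w : complex.Re (z + w) = complex.Re z + complex.Re w.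
Proof. by case: z; case: w. Qed.
Lemma ImD z w : complex.Im (z + w) = complex.Im z + complex.Im w.
Proof. by case: z; case: w. Qed.
Lemma ReN z : complex.Re (- z) = - complex.Re z.
Proof. by case: z. Qed.
Lemma ImN z : complex.Im (- z) = - complex.Im z.
Proof. by case: z. Qed.
Lemma ReM z w : complex.Re (z * w) =
  complex.Re z * complex.Re w - complex.Im z * complex.Im w.
Proof. by case: z; case: w. Qed.
Lemma ImM z w : complex.Im (z * w) =
  complex.Re z * complex.Im w + complex.Im z * complex.Re w.
Proof. by case: z => a b; case: w => c d /=; rewrite [b * c]mulrC. Qed.
Lemma ReJ z : complex.Re z^* = complex.Re z.
Proof. by case: z. Qed.
Lemma ImJ z : complex.Im z^* = - complex.Im z.
Proof. by case: z. Qed.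

Lemma complex_ext z w :
  complex.Re z = complex.Re w -> complex.Im z = complex.Im w -> z = w.
Proof. by case: z; case: w => a b c d /= -> ->. Qed.

Lemma ReSum (I : Type) (s : seq I) (P : pred I) (F : I -> R[i]) :
  complex.Re (\sum_(i <- s | P i) F i) = \sum_(i <- s | P i) complex.Re (F i).
Proof. exact: (big_morph _ ReD erefl). Qed.

Lemma ImSum (I : Type) (s : seq I) (P : pred I) (F : I -> R[i]) :
  complex.Im (\sum_(i <- s | P i) F i) = \sum_(i <- s | P i) complex.Im (F i).
Proof. exact: (big_morph _ ImD erefl). Qed.

Lemma cvg_cabsP (u : nat -> R[i]) (l : R[i]) :
  u @ \oo --> l <-> (cabs (u n - l)) @[n --> \oo] --> (0 : R).
Proof.
split=> [/cvgrPdist_lt h|/cvgrPdist_lt h]; apply/cvgrPdist_lt => e e0.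
  have := h (e%:C)%C; rewrite ltcR => /(_ e0); apply: filterS => n.
  by rewrite cabsE ltcR sub0r normrN ger0_norm ?cabs_ge0// cabsB.
(* Radii are elements of [R[i]], where being positive includes being real. *)
move: e0; case: e => e i; rewrite ltcE /= => /andP[/eqP -> e0].
have := h _ e0; apply: filterS => n.
rewrite (_ : Complex e 0 = (e%:C)%C)// cabsE ltcR sub0r normrN.
by rewrite ger0_norm ?cabs_ge0// cabsB.
Qed.

Lemma cvg_ReImP (u : nat -> R[i]) (l : R[i]) :
  u @ \oo --> l <-> (complex.Re (u n)) @[n --> \oo] --> complex.Re l /\
     (complex.Im (u n)) @[n --> \oo] --> complex.Im l.
Proof.
rewrite cvg_cabsP; split=> [h|[h k]].
  split; apply/cvgrPdist_le => e e0.
    move/cvgrPdist_le : h => /(_ _ e0); apply: filterS => n.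
    rewrite sub0r normrN ger0_norm ?cabs_ge0// distrC.
    by apply: le_trans; rewrite -ReN -ReD; exact: ler_Re_cabs.
  move/cvgrPdist_le : h => /(_ _ e0); apply: filterS => n.
  rewrite sub0r normrN ger0_norm ?cabs_ge0// distrC.
  by apply: le_trans; rewrite -ImN -ImD; exact: ler_Im_cabs.
have h' : `|complex.Re (u n) - complex.Re l| +
    `|complex.Im (u n) - complex.Im l| @[n --> \oo] --> (0 : R).
  rewrite (_ : 0 = `|complex.Re l - complex.Re l| +
                   `|complex.Im l - complex.Im l|); last first.
    by rewrite !subrr !normr0 addr0.
  by apply: cvgD; apply: cvg_norm; apply: cvgB => //; exact: cvg_cst.
apply: (squeeze_cvgr _ (cvg_cst (0 : R)) h'); apply: nearW => n.
by rewrite cabs_ge0 (le_trans (ler_cabs_ReIm _))// ReD ReN ImD ImN.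
Qed.

Lemma cvg_cabs (u : nat -> R[i]) (l : R[i]) :
  u @ \oo --> l -> cabs (u n) @[n --> \oo] --> cabs l.
Proof.
move=> /cvg_cabsP /cvgrPdist_le h; apply/cvgrPdist_le => e e0.
have := h _ e0; apply: filterS => n.
rewrite sub0r normrN ger0_norm ?cabs_ge0// => ue.
have h1 : cabs (u n) <= cabs (u n - l) + cabs l.
  by rewrite (le_trans _ (cabsD _ _))// subrK.
have h2 : cabs l <= cabs (u n - l) + cabs (u n).
  by have := cabsD (l - u n) (u n); rewrite subrK cabsB.
by rewrite ler_norml; lra.
Qed.

Lemma cvgC_unique (u : nat -> R[i]) (a b : R[i]) :
  u @ \oo --> a -> u @ \oo --> b -> a = b.
Proof. exact: cvg_unique. Qed.

Lemma cvg_conj (u : nat -> R[i]) (l : R[i]) :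
  u @ \oo --> l -> (u n)^* @[n --> \oo] --> l^*.
Proof.
move=> /cvg_ReImP [h k]; apply/cvg_ReImP; split.
  by rewrite ReJ; under eq_fun do rewrite ReJ.
by rewrite ImJ; under eq_fun do rewrite ImJ; exact: cvgN.
Qed.

End ComplexFacts.

(** * The Hilbert space of square summable sequences *)

Section SquareSummable.
Variable R : realType.
Implicit Types (x y z : l2 R) (c : R[i]) (u v : nat -> R[i]).

Lemma ler_psum_sqsum u N : in_l2 u ->
  \sum_(k < N) cabs (u k) ^+ 2 <= fine (sqsum u).
Proof.
move=> ul2; rewrite -lee_fin fineK; last first.
  by rewrite ge0_fin_numE//; apply: nneseries_ge0 => n _ _; exact: sqsum_ge0.
rewrite -sumEFin -(big_mkord xpredT (fun k => (cabs (u k) ^+ 2)%:E)).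
by apply: nneseries_lim_ge => *; exact: sqsum_ge0.
Qed.

Lemma in_l2_bound u M : (forall N, \sum_(k < N) cabs (u k) ^+ 2 <= M) ->
  (sqsum u <= M%:E)%E.
Proof.
move=> h; apply: lime_le.
  by apply: is_cvg_nneseries => n _ _; exact: sqsum_ge0.
by apply: nearW => n; rewrite big_mkord sumEFin lee_fin.
Qed.

Lemma in_l2P u M : (forall N, \sum_(k < N) cabs (u k) ^+ 2 <= M) -> in_l2 u.
Proof. by move/in_l2_bound => h; rewrite /in_l2 (le_lt_trans h)// ltry. Qed.

Definition mkl2 u (h : in_l2 u) : l2 R := L2 (introT (asboolP _) h).

Lemma l2_in x : in_l2 x.
Proof. by have /asboolP := l2valP x. Qed.

Lemma l2P x y : (forall n, x n = y n) -> x = y.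
Proof. by move=> h; apply: val_inj; apply/funext. Qed.

Lemma l2D x y n : (x + y) n = x n + y n. Proof. by []. Qed.
Lemma l2Z c x n : (c *: x) n = c * x n. Proof. by []. Qed.
Lemma l2N x n : (- x) n = - x n. Proof. by []. Qed.
Lemma l2B x y n : (x - y) n = x n - y n. Proof. by []. Qed.
Lemma l2sum (I : Type) (s : seq I) (P : pred I) (F : I -> l2 R) n :
  (\sum_(i <- s | P i) F i) n = \sum_(i <- s | P i) F i n.
Proof. exact: (big_morph (fun x : l2 R => x n) (fun _ _ => erefl) erefl). Qed.

Lemma sqsum_fin x : sqsum x = (l2norm x ^+ 2)%:E.
Proof.
have h : (0 <= sqsum x)%E.
  by apply: nneseries_ge0 => n _ _; exact: sqsum_ge0.
rewrite /l2norm sqr_sqrtr ?fineK ?fine_ge0// ge0_fin_numE//.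
exact: l2_in.
Qed.

Lemma l2norm_ge0 x : 0 <= l2norm x.
Proof. exact: sqrtr_ge0. Qed.

Lemma ler_psum_l2norm x N :
  \sum_(k < N) cabs (x k) ^+ 2 <= l2norm x ^+ 2.
Proof.
by apply: (le_trans (ler_psum_sqsum N (l2_in x))); rewrite sqsum_fin.
Qed.

Lemma l2norm_le x M : 0 <= M ->
  (forall N, \sum_(k < N) cabs (x k) ^+ 2 <= M ^+ 2) -> l2norm x <= M.
Proof.
move=> M0 /in_l2_bound; rewrite sqsum_fin lee_fin.
by rewrite ler_pXn2r ?nnegrE ?l2norm_ge0.
Qed.

Lemma cvg_l2norm x :
  series (fun n => cabs (x n) ^+ 2) @ \oo --> l2norm x ^+ 2.
Proof.
have nd : nondecreasing_seq (series (fun n => cabs (x n) ^+ 2)).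
  by apply: nondecreasing_series => n _ _; exact: sqr_ge0.
have ub n : series (fun n => cabs (x n) ^+ 2) n <= l2norm x ^+ 2.
  by rewrite /series /= big_mkord ler_psum_l2norm.
have cv : cvgn (series (fun n => cabs (x n) ^+ 2)).
  by apply: nondecreasing_is_cvgn => //; exists (l2norm x ^+ 2) => _ [n _ <-].
rewrite (_ : l2norm x ^+ 2 = limn (series (fun n => cabs (x n) ^+ 2)))//.
apply/eqP; rewrite eq_le; apply/andP; split; last first.
  by apply: limr_le => //; exact: nearW.
rewrite -lee_fin -sqsum_fin; apply: in_l2_bound => N.
have := nondecreasing_cvgn_le nd cv N.
by rewrite /series /= big_mkord.
Qed.

End SquareSummable.

(** * Inner product, Cauchy-Schwarz inequality and truncations *)

Section InnerProduct.
Variable R : realType.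
Implicit Types (x y z : l2 R) (c : R[i]).

(** [l2inner] is a bare [limn], so it has meaning only once the series converges. The terms are
    dominated by |x_n|^2 + |y_n|^2, which is summable. *)
Lemma cvg_l2inner x y :
  series (fun n => (x n)^* * y n) @ \oo --> l2inner x y.
Proof.
pose v n := cabs (x n) ^+ 2 + cabs (y n) ^+ 2.
have cv : cvgn (series v).
  rewrite (_ : series v = series (fun n => cabs (x n) ^+ 2) +
    series (fun n => cabs (y n) ^+ 2)); last first.
    by apply/funext => n; rewrite /series /= big_split.
  by apply: is_cvgD; apply/cvg_ex; eexists; exact: cvg_l2norm.
have v0 n : 0 <= v n by rewrite addr_ge0 ?sqr_ge0.
have le n : cabs ((x n)^* * y n) <= v n.
  rewrite cabsM cabsJ /v; have := sqr_ge0 (cabs (x n) - cabs (y n)).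
  by have := cabs_ge0 (x n); have := cabs_ge0 (y n); nra.
have cv1 : cvgn (series (fun n => complex.Re ((x n)^* * y n))).
  apply: normed_cvg; apply: (series_le_cvg _ v0) cv => n//=.
  by apply: le_trans (le n); exact: ler_Re_cabs.
have cv2 : cvgn (series (fun n => complex.Im ((x n)^* * y n))).
  apply: normed_cvg; apply: (series_le_cvg _ v0) cv => n//=.
  by apply: le_trans (le n); exact: ler_Im_cabs.
suff : cvgn (series (fun n => (x n)^* * y n)) by [].
move/cvg_ex : cv1 => [a ha]; move/cvg_ex : cv2 => [b hb].
apply/cvg_ex; exists (Complex a b); apply/cvg_ReImP; split.
- by rewrite /series /=; under eq_fun do rewrite ReSum.
- by rewrite /series /=; under eq_fun do rewrite ImSum.
Qed.

Lemma l2innerDr x y z : l2inner x (y + z) = l2inner x y + l2inner x z.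
Proof.
apply: cvgC_unique; first exact: cvg_l2inner.
rewrite (_ : series _ = series (fun n => (x n)^* * y n) +
                        series (fun n => (x n)^* * z n)).
  by apply: cvgD; exact: cvg_l2inner.
apply/funext => n; rewrite /series /= -[RHS]big_split.
by apply: eq_bigr => i _; rewrite /= -mulrDr.
Qed.

Lemma l2innerZr x c y : l2inner x (c *: y) = c * l2inner x y.
Proof.
apply: cvgC_unique; first exact: cvg_l2inner.
rewrite (_ : series _ = (fun=> c) \* series (fun n => (x n)^* * y n)).
  by apply: cvgM; [exact: cvg_cst|exact: cvg_l2inner].
apply/funext => n; rewrite /series /= mulr_sumr.
by apply: eq_bigr => i _; exact: mulrCA.
Qed.

Lemma l2innerC x y : l2inner y x = (l2inner x y)^*.
Proof.
apply: cvgC_unique; first exact: cvg_l2inner.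
rewrite (_ : series _ = fun n => (series (fun n => (x n)^* * y n) n)^*).
  by apply: cvg_conj; exact: cvg_l2inner.
apply/funext => n; rewrite /series /= rmorph_sum.
by apply: eq_bigr => i _; rewrite /= rmorphM /= conjCK mulrC.
Qed.

Lemma l2inner_self x : l2inner x x = ((l2norm x ^+ 2)%:C)%C.
Proof.
apply: cvgC_unique; first exact: cvg_l2inner.
have := @cvg_l2norm R x; set s := series _ => h.
rewrite (_ : series _ = fun n => ((s n)%:C)%C).
  by apply/cvg_ReImP; split => //=; exact: cvg_cst.
apply/funext => n; rewrite /s /series /= rmorph_sum.
by apply: eq_bigr => i _; rewrite /= conjM_cabs.
Qed.

Lemma l2inner_e i x : l2inner (l2e R i) x = x i.
Proof.
apply: cvgC_unique; first exact: cvg_l2inner; apply: cvg_near_cst.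
exists i.+1 => // n /= ltin; apply/esym.
rewrite /series /= big_mkord (bigD1 (Ordinal ltin))//= eqxx conjC1 mul1r.
rewrite big1 ?addr0// => j; rewrite -val_eqE /= => /negbTE ->.
by rewrite conjC0 mul0r.
Qed.

Lemma l2inner0r x : l2inner x 0 = 0.
Proof. by rewrite -(scale0r (0 : l2 R)) l2innerZr mul0r. Qed.
Lemma l2innerNr x y : l2inner x (- y) = - l2inner x y.
Proof. by rewrite -scaleN1r l2innerZr mulN1r. Qed.
Lemma l2innerBr x y z : l2inner x (y - z) = l2inner x y - l2inner x z.
Proof. by rewrite l2innerDr l2innerNr. Qed.
Lemma l2inner0l x : l2inner 0 x = 0.
Proof. by rewrite l2innerC l2inner0r conjC0. Qed.
Lemma l2innerDl x y z : l2inner (y + z) x = l2inner y x + l2inner z x.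
Proof. by rewrite l2innerC l2innerDr rmorphD /= -!l2innerC. Qed.
Lemma l2innerZl x c y : l2inner (c *: y) x = c^* * l2inner y x.
Proof. by rewrite l2innerC l2innerZr rmorphM /= -!l2innerC. Qed.
Lemma l2innerNl x y : l2inner (- y) x = - l2inner y x.
Proof. by rewrite l2innerC l2innerNr rmorphN /= -!l2innerC. Qed.
Lemma l2innerBl x y z : l2inner (y - z) x = l2inner y x - l2inner z x.
Proof. by rewrite l2innerDl l2innerNl. Qed.
Lemma l2inner_er i x : l2inner x (l2e R i) = (x i)^*.
Proof. by rewrite l2innerC l2inner_e. Qed.

Lemma l2norm0 : l2norm (0 : l2 R) = 0.
Proof.
apply/eqP; rewrite -sqrf_eq0; apply/eqP/complexI.
by rewrite -l2inner_self l2inner0r.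
Qed.

Lemma l2norm_eq0 x : (l2norm x == 0) = (x == 0).
Proof.
apply/eqP/eqP => [x0|->]; last exact: l2norm0.
apply: l2P => n; apply/eqP; rewrite -cabs_eq0 -sqrf_eq0 eq_le sqr_ge0 andbT.
have := ler_psum_l2norm x n.+1; rewrite x0 expr0n /= big_ord_recr /=.
by apply: le_trans; rewrite lerDr sumr_ge0// => *; exact: sqr_ge0.
Qed.

Lemma l2normZ c x : l2norm (c *: x) = cabs c * l2norm x.
Proof.
apply/eqP; rewrite -(@eqrXn2 _ 2) ?l2norm_ge0 ?mulr_ge0 ?cabs_ge0 ?l2norm_ge0//.
apply/eqP/complexI; rewrite -l2inner_self l2innerZr l2innerZl mulrA mulC_conj.
by rewrite l2inner_self -rmorphM -exprMn.
Qed.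

Lemma l2normN x : l2norm (- x) = l2norm x.
Proof. by rewrite -scaleN1r l2normZ cabsN cabs1 mul1r. Qed.

Lemma l2normD_sqr x y : l2norm (x + y) ^+ 2 =
  l2norm x ^+ 2 + l2norm y ^+ 2 + 2 * complex.Re (l2inner x y).
Proof.
apply: complexI; rewrite -l2inner_self l2innerDl !l2innerDr !l2inner_self.
rewrite [l2inner y x]l2innerC; apply: complex_ext; rewrite ?(ReD, ImD) ?(ReJ, ImJ) /=;
  by ring.
Qed.

Lemma l2norm_subZ_sqr c x y : l2norm (x - c *: y) ^+ 2 =
  l2norm x ^+ 2 + cabs c ^+ 2 * l2norm y ^+ 2
    - 2 * complex.Re (c * l2inner x y).
Proof.
by rewrite l2normD_sqr l2normN l2normZ exprMn l2innerNr l2innerZr ReN mulrN.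
Qed.

Lemma cauchy_schwarz x y : cabs (l2inner x y) <= l2norm x * l2norm y.
Proof.
have [->|y0] := eqVneq y 0.
  by rewrite l2inner0r cabs0 mulr_ge0 ?l2norm_ge0.
have ny : 0 < l2norm y by rewrite lt_def l2norm_ge0 l2norm_eq0 y0.
set p := l2inner x y.
(* The multiple of y subtracted here is the orthogonal projection of x. *)
have := sqr_ge0 (l2norm (x - (p^* / ((l2norm y ^+ 2)%:C)%C) *: y)).
rewrite l2norm_subZ_sqr cabsM cabsV cabs_real cabsJ.
rewrite (ger0_norm (sqr_ge0 _)) -/p [X in 2 * complex.Re X]mulrAC conjM_cabs -fmorphV -rmorphM /=.
set a := cabs p; set b := l2norm y; set n := l2norm x => h.
have {h} h : a ^+ 2 / b ^+ 2 <= n ^+ 2.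
  suff : (a / b ^+ 2) ^+ 2 * b ^+ 2 = a ^+ 2 / b ^+ 2 by lra.
  by field; rewrite gt_eqF.
rewrite -(@ler_pXn2r _ 2) ?nnegrE ?mulr_ge0 ?cabs_ge0 ?l2norm_ge0//.
by rewrite exprMn -ler_pdivrMr ?exprn_gt0.
Qed.

Lemma ler_l2normD x y : l2norm (x + y) <= l2norm x + l2norm y.
Proof.
rewrite -(@ler_pXn2r _ 2) ?nnegrE ?addr_ge0 ?l2norm_ge0// l2normD_sqr.
have := cauchy_schwarz x y; have := ler_Re_cabs (l2inner x y).
have := ler_norm (complex.Re (l2inner x y)); nra.
Qed.

Lemma ler_coord_l2norm x n : cabs (x n) <= l2norm x.
Proof.
rewrite -(@ler_pXn2r _ 2) ?nnegrE ?cabs_ge0 ?l2norm_ge0//.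
apply: le_trans (ler_psum_l2norm x n.+1).
by rewrite big_ord_recr /= lerDr sumr_ge0// => *; exact: sqr_ge0.
Qed.

Lemma l2norm_e i : l2norm (l2e R i) = 1.
Proof.
apply/eqP; rewrite -(@eqrXn2 _ 2) ?l2norm_ge0//; apply/eqP/complexI.
by rewrite -l2inner_self l2inner_e /= eqxx expr1n.
Qed.

Definition trunc x N : l2 R := \sum_(k < N) x k *: l2e R k.

Lemma truncE x N n : trunc x N n = if (n < N)%N then x n else 0.
Proof.
rewrite /trunc l2sum; case: ifPn => [nN|].
  rewrite (bigD1 (Ordinal nN))// big1 => [|j jn]; last first.
    have nj : (n == j) = false.
      by apply/negbTE; move: jn; rewrite -val_eqE eq_sym.
    by rewrite l2Z /l2e /= nj mulr0.
  by rewrite l2Z /= eqxx mulr1 addr0.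
rewrite -leqNgt => Nn; rewrite big1// => j _; rewrite l2Z /=.
by rewrite gtn_eqF ?mulr0// (leq_trans (ltn_ord j)).
Qed.

Lemma l2norm_trunc_sqr x N :
  l2norm (trunc x N) ^+ 2 = \sum_(k < N) cabs (x k) ^+ 2.
Proof.
apply: (@cvg_unique _ _ (series (fun n => cabs (trunc x N n) ^+ 2) @ \oo)) => //.
  exact: cvg_l2norm.
apply: cvg_near_cst; exists N => // n /= Nn.
rewrite /series /= (big_cat_nat _ Nn)//= [X in _ + X]big_nat.
rewrite [X in _ + X]big1 ?addr0.
  by rewrite big_mkord; apply: eq_bigr => i _; rewrite truncE ltn_ord.
by move=> i /andP[Ni _]; rewrite truncE ltnNge Ni cabs0 expr0n.
Qed.

Lemma l2norm_sub_trunc_sqr x N :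
  l2norm (x - trunc x N) ^+ 2 = l2norm x ^+ 2 - \sum_(k < N) cabs (x k) ^+ 2.
Proof.
rewrite l2normD_sqr l2normN l2norm_trunc_sqr l2innerNr ReN.
have -> : complex.Re (l2inner x (trunc x N)) = \sum_(k < N) cabs (x k) ^+ 2.
  rewrite /trunc (big_morph (l2inner x) (l2innerDr x) (l2inner0r x)) ReSum.
  by apply: eq_bigr => i _; rewrite l2innerZr l2inner_er mulC_conj.
by lra.
Qed.

Lemma cvg_trunc x : l2norm (x - trunc x N) @[N --> \oo] --> (0 : R).
Proof.
have h : l2norm (x - trunc x N) ^+ 2 @[N --> \oo] --> (0 : R).
  rewrite (_ : (fun N => _) = (fun N => l2norm x ^+ 2 -
      series (fun k => cabs (x k) ^+ 2) N)); last first.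
    by apply/funext => N; rewrite l2norm_sub_trunc_sqr /series /= big_mkord.
  have := cvgB (cvg_cst (l2norm x ^+ 2)) (@cvg_l2norm R x).
  by rewrite subrr; exact.
have := cvg_comp _ _ h (@sqrt_continuous R 0); rewrite sqrtr0.
by apply: cvg_trans; apply: near_eq_cvg; apply: nearW => n /=;
  rewrite sqrtr_sqr ger0_norm ?l2norm_ge0.
Qed.

End InnerProduct.

(** * Bounded operators and their inverses *)

Lemma subrACA (V : zmodType) (a b c d : V) :
  a - b - (c - d) = (a - c) - (b - d).
Proof. by rewrite !opprD !opprK addrACA. Qed.

Section BoundedOperators.
Variable R : realType.
Local Notation op := (l2 R -> l2 R).
Implicit Types (x y z : l2 R) (c : R[i]) (T S A B : op).

(** By linearity f x is the value of f at the tail [x - trunc x N], whose norm tends to 0.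
    Uniqueness statements for operators are reduced to this. *)
Lemma l2norm_dense (f : l2 R -> R[i]) (M : R) :
  (forall c x y, f (c *: x + y) = c * f x + f y) ->
  (forall x, cabs (f x) <= M * l2norm x) ->
  (forall i, f (l2e R i) = 0) -> forall x, f x = 0.
Proof.
move=> flin fbd fe x.
have f0 : f 0 = 0.
  have := flin 1 0 0; rewrite scaler0 addr0 mul1r => /eqP.
  by rewrite -subr_eq0 opprD addrA subrr sub0r oppr_eq0 => /eqP.
have fD a b : f (a + b) = f a + f b.
  by have := flin 1 a b; rewrite scale1r mul1r.
have ft N : f (trunc x N) = 0.
  rewrite /trunc (big_morph f fD f0) big1// => i _.
  by have := flin (x i) (l2e R i) 0; rewrite addr0 fe f0 mulr0 addr0.
have fx N : f (x - trunc x N) = f x.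
  by rewrite addrC -scaleN1r flin ft mulr0 add0r.
apply/eqP; rewrite -cabs_eq0 eq_le cabs_ge0 andbT.
have h : M * l2norm (x - trunc x N) @[N --> \oo] --> (0 : R).
  by rewrite -(mulr0 M); apply: cvgM; [exact: cvg_cst|exact: cvg_trunc].
rewrite -(cvg_lim (@Rhausdorff R) h); apply: limr_ge.
  by apply/cvg_ex; eexists; exact: h.
by apply: nearW => N; rewrite -(fx N).
Qed.

Section Linear.
Variables (T : op) (lT : linear T).

Lemma bopP c x y : T (c *: x + y) = c *: T x + T y.
Proof. exact: lT. Qed.
Lemma bopD x y : T (x + y) = T x + T y.
Proof. by rewrite -[x in LHS]scale1r bopP scale1r. Qed.
Lemma bop0 : T 0 = 0.
Proof. by apply: (@addrI _ (T 0)); rewrite -bopD !addr0. Qed.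
Lemma bopZ c x : T (c *: x) = c *: T x.
Proof. by rewrite -[c *: x]addr0 bopP bop0 addr0. Qed.
Lemma bopN x : T (- x) = - T x.
Proof. by rewrite -scaleN1r bopZ scaleN1r. Qed.
Lemma bopB x y : T (x - y) = T x - T y.
Proof. by rewrite bopD bopN. Qed.

End Linear.

Lemma bounded_opM T : bounded_op T ->
  exists2 M : R, 0 < M & forall x, l2norm (T x) <= M * l2norm x.
Proof.
case=> _ [M h]; exists (`|M| + 1) => [|x]; first by rewrite ltr_wpDl.
apply: (le_trans (h x)); rewrite ler_wpM2r ?l2norm_ge0//.
by rewrite (le_trans (ler_norm _))// lerDl.
Qed.

Lemma bounded_id : bounded_op (id : op).
Proof. by split => //; exists 1 => x; rewrite mul1r. Qed.

Lemma bounded_comp T S : bounded_op T -> bounded_op S -> bounded_op (T \o S).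
Proof.
move=> bT bS; split; first by move=> c x y /=; rewrite (bopP bS.1) (bopP bT.1).
have [M M0 h] := bounded_opM bT; case: bS => _ [N k].
exists (M * N) => x /=; rewrite (le_trans (h _))// -mulrA.
by rewrite ler_wpM2l// ltW.
Qed.

Lemma bounded_add T S : bounded_op T -> bounded_op S -> bounded_op (T \+ S).
Proof.
move=> [lT [M h]] [lS [N k]]; split.
  by move=> c x y /=; rewrite (bopP lS) (bopP lT) scalerDr addrACA.
exists (M + N) => x /=; rewrite (le_trans (ler_l2normD _ _))// mulrDl.
exact: lerD.
Qed.

Lemma bounded_scale c : bounded_op ( *:%R c : op).
Proof.
split; last by exists (cabs c) => x; rewrite l2normZ.
by move=> a x y; rewrite scalerDr !scalerA mulrC.
Qed.

Lemma bounded_opp T : bounded_op T -> bounded_op (\- T).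
Proof.
move=> [lT [M h]]; split; last by exists M => x /=; rewrite l2normN.
by move=> c x y /=; rewrite (bopP lT) opprD scalerN.
Qed.

Lemma bounded_sub T S : bounded_op T -> bounded_op S -> bounded_op (T \- S).
Proof. by move=> bT bS; exact: (bounded_add bT (bounded_opp bS)). Qed.

Lemma bounded_op_ext T S : bounded_op T -> bounded_op S ->
  (forall i j, mxentry T i j = mxentry S i j) -> T = S.
Proof.
move=> bT bS h; have bD := bounded_sub bT bS; have [M _ k] := bounded_opM bD.
apply/funext => x; apply: l2P => n; apply/eqP; rewrite -subr_eq0; apply/eqP.
apply: (@l2norm_dense (fun x => (T x) n - (S x) n) M).
- move=> c u v; rewrite (bopP bT.1) (bopP bS.1) !l2D !l2Z.
  by rewrite opprD mulrDr mulrN addrACA.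
- by move=> u; apply: le_trans (k u); exact: (ler_coord_l2norm ((T \- S) u)).
- by move=> i; have := h n i; rewrite /mxentry => ->; rewrite subrr.
Qed.

Definition adjoints S T := forall x y, l2inner (S x) y = l2inner x (T y).

Lemma adjoints_sym S T : adjoints S T -> adjoints T S.
Proof. by move=> h x y; rewrite l2innerC -h -l2innerC. Qed.

(** Basis vectors are replaced by arbitrary ones in one variable at a time, first on the right, then
    on the left. *)
Lemma adjoints_entries S T : bounded_op S -> bounded_op T ->
  (forall i j, mxentry S i j = (mxentry T j i)^*) -> adjoints S T.
Proof.
move=> bS bT h.
have [M M0 k] := bounded_opM bS; have [N N0 l] := bounded_opM bT.
have h1 j y : l2inner (S (l2e R j)) y = T y j.
  apply/eqP; rewrite -subr_eq0; apply/eqP.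
  apply: (@l2norm_dense (fun y => l2inner (S (l2e R j)) y - T y j) (M + N)).
  - move=> c u v; rewrite (bopP bT.1) l2innerDr l2innerZr l2D l2Z.
    by rewrite opprD mulrDr mulrN addrACA.
  - move=> u; rewrite (le_trans (cabsD _ _))// cabsN mulrDl lerD//.
      rewrite (le_trans (cauchy_schwarz _ _))// ler_wpM2r ?l2norm_ge0//.
      by rewrite (le_trans (k _))// l2norm_e mulr1.
    by rewrite (le_trans (ler_coord_l2norm _ _)).
  - move=> i; rewrite l2inner_er; have := h i j.
    by rewrite /mxentry => ->; rewrite conjCK subrr.
(* The inner product is conjugate linear on the left; comparing conjugates gives a linear functional
   of x. *)
move=> x y; apply: (can_inj (@conjCK _)); rewrite -!l2innerC.
apply/eqP; rewrite -subr_eq0; apply/eqP.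
apply: (@l2norm_dense (fun x => l2inner y (S x) - l2inner (T y) x)
   (l2norm y * M + l2norm (T y))).
- move=> c u v; rewrite (bopP bS.1) !l2innerDr !l2innerZr.
  by rewrite opprD mulrDr mulrN addrACA.
- move=> u; rewrite (le_trans (cabsD _ _))// cabsN mulrDl lerD ?cauchy_schwarz//.
  rewrite (le_trans (cauchy_schwarz _ _))// -mulrA ler_wpM2l ?l2norm_ge0//.
- by move=> i; rewrite l2inner_er l2innerC h1 subrr.
Qed.

(** Testing square summability inside the definition keeps proofs out of the operator; under the
    bound of [coordopE] the default 0 never occurs. *)
Definition coordop (f : l2 R -> nat -> R[i]) : op := fun x =>
  match pselect (in_l2 (f x)) with left h => mkl2 h | right _ => 0 end.

Lemma coordopE (f : l2 R -> nat -> R[i]) (M : R) :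
  (forall x N, \sum_(k < N) cabs (f x k) ^+ 2 <= M * l2norm x ^+ 2) ->
  forall x n, coordop f x n = f x n.
Proof.
move=> h x n; rewrite /coordop; case: pselect => // -[]; exact: in_l2P (h x).
Qed.

Lemma bounded_coordop (f : l2 R -> nat -> R[i]) (M : R) :
  (forall x N, \sum_(k < N) cabs (f x k) ^+ 2 <= M * l2norm x ^+ 2) ->
  (forall c x y n, f (c *: x + y) n = c * f x n + f y n) ->
  bounded_op (coordop f).
Proof.
move=> h lf; split.
  by move=> c x y; apply: l2P => n; rewrite l2D l2Z !(coordopE h) lf.
exists (Num.sqrt `|M|) => x; apply: l2norm_le.
  by rewrite mulr_ge0 ?l2norm_ge0 ?sqrtr_ge0.
move=> N; rewrite exprMn sqr_sqrtr//; under eq_bigr do rewrite (coordopE h).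
by rewrite (le_trans (h x N))// ler_wpM2r ?sqr_ge0 ?ler_norm.
Qed.

(** Completeness for a geometric rate, as the Neumann series provides it. Each coordinate converges,
    and the bound passes to the limit on partial sums of N squares before N grows. *)
Lemma l2_complete (X : nat -> l2 R) (C q : R) : 0 <= q -> q < 1 ->
  (forall n m, (n <= m)%N -> l2norm (X m - X n) <= C * q ^+ n) ->
  exists x, forall n, l2norm (x - X n) <= C * q ^+ n.
Proof.
move=> q0 q1 h.
have C0 : 0 <= C by have := h 0%N 0%N (leqnn _); rewrite subrr l2norm0 expr0 mulr1.
have cq : C * q ^+ n @[n --> \oo] --> (0 : R).
  rewrite -[in X in _ --> X](mulr0 C); apply: cvgM; first exact: cvg_cst.
  by apply: cvg_expr; rewrite ger0_norm.
have cv k : exists l : R[i], (fun n => X n k) @ \oo --> l.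
  have ca (p : R[i] -> R) : (forall z w : R[i], p (z - w) = p z - p w) ->
      (forall z : R[i], `|p z| <= cabs z) -> cvgn (fun n => p (X n k)).
    move=> pB pc; apply: cauchy_cvg; apply/cauchy_ballP => e e0.
    move/cvgrPdist_lt : cq => /(_ _ e0)[N _ hN]; rewrite near_map2.
    exists ([set n | (N <= n)%N], [set n | (N <= n)%N]) => /=.
      by split; exists N.
    move=> [n m] /= [Nn Nm]; rewrite /ball /=.
    wlog nm : n m Nn Nm / (n <= m)%N => [wl|].
      case/orP: (leq_total n m) => nm; first exact: wl.
      by rewrite distrC; apply: wl.
    rewrite distrC -pB; apply: (le_lt_trans (pc _)).
    apply: (le_lt_trans (ler_coord_l2norm (X m - X n) k)).
    apply: (le_lt_trans (h _ _ nm)); have := hN n Nn.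
    by rewrite sub0r normrN ger0_norm// mulr_ge0// exprn_ge0.
  have /cvg_ex[a ha] : cvgn (fun n => complex.Re (X n k)).
    by apply: ca => [z w|z]; [rewrite ReD ReN|exact: ler_Re_cabs].
  have /cvg_ex[b hb] : cvgn (fun n => complex.Im (X n k)).
    by apply: ca => [z w|z]; [rewrite ImD ImN|exact: ler_Im_cabs].
  by exists (Complex a b); apply/cvg_ReImP.
have /choice [l hl] := cv.
have hb n N : \sum_(k < N) cabs (l k - X n k) ^+ 2 <= (C * q ^+ n) ^+ 2.
  have cvs : \sum_(k < N) cabs (X m k - X n k) ^+ 2 @[m --> \oo] -->
      \sum_(k < N) cabs (l k - X n k) ^+ 2.
    elim: N => [|k IH].
      by under eq_fun do rewrite big_ord0; rewrite big_ord0; exact: cvg_cst.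
    under eq_fun do rewrite big_ord_recr /= expr2.
    rewrite big_ord_recr /= expr2; apply: cvgD => //.
    by apply: cvgM; apply: cvg_cabs; apply: cvgB => //;
      exact: cvg_cst.
  rewrite -(cvg_lim (@Rhausdorff R) cvs); apply: limr_le.
    by apply/cvg_ex; eexists; exact: cvs.
  exists n => // m /= nm; apply: (le_trans (ler_psum_l2norm (X m - X n) N)).
  rewrite ler_pXn2r ?nnegrE ?l2norm_ge0 ?mulr_ge0 ?exprn_ge0//.
  exact: h.
have h0 : in_l2 (fun k => l k - X 0%N k) by apply: in_l2P (hb 0%N).
(* Only the difference of l and X_0 is known to be square summable, so X_0 is added back. *)
exists (mkl2 h0 + X 0%N) => n; apply: l2norm_le.
  by rewrite mulr_ge0 ?exprn_ge0.
move=> N; apply: le_trans (hb n N); rewrite le_eqVlt; apply/orP; left.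
apply/eqP; apply: eq_bigr => k _; congr (cabs _ ^+ 2).
by rewrite l2B l2D /= subrK.
Qed.

Lemma bounded_inverse T (d : R) : bounded_op T -> 0 < d ->
  (forall x, d * l2norm x <= l2norm (T x)) ->
  (forall y, exists x, T x = y) ->
  exists S, [/\ bounded_op S, S \o T = id & T \o S = id].
Proof.
move=> bT d0 hd /choice [S TS].
have inj x y : T x = T y -> x = y.
  move=> e; apply/eqP; rewrite -subr_eq0 -l2norm_eq0 eq_le l2norm_ge0 andbT.
  by rewrite -(pmulr_rle0 _ d0) (le_trans (hd _))// (bopB bT.1) e subrr l2norm0.
exists S; split.
- split.
    by move=> c x y; apply: inj; rewrite (bopP bT.1) !TS.
  by exists d^-1 => x; rewrite ler_pdivlMl// (le_trans (hd _))// TS.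
- by apply/funext => x; apply: inj; rewrite /= TS.
- by apply/funext => x; rewrite /= TS.
Qed.

Lemma neumann B (q : R) : bounded_op B -> 0 <= q -> q < 1 ->
  (forall x, l2norm (B x) <= q * l2norm x) ->
  exists S, [/\ bounded_op S, S \o (id \- B) = id & (id \- B) \o S = id].
Proof.
move=> bB q0 q1 hq; apply: (@bounded_inverse _ (1 - q)).
- exact: bounded_sub bounded_id bB.
- by rewrite subr_gt0.
- move=> x; have := ler_l2normD (x - B x) (B x); rewrite subrK /=.
  by have := hq x; lra.
move=> y; pose X n := \sum_(k < n) iter k B y.
have hB n x : l2norm (iter n B x) <= q ^+ n * l2norm x.
  elim: n => [|n IH]; first by rewrite mul1r.
  by rewrite iterS (le_trans (hq _))// exprS -mulrA ler_wpM2l.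
have X1 n : X n - B (X n) = y - iter n B y.
  elim: n => [|n IH]; first by rewrite /X big_ord0 (bop0 bB.1) !subrr.
  rewrite /X big_ord_recr /= -/(X n) (bopD bB.1) opprD addrACA IH.
  by rewrite addrA subrK.
have hX x : (1 - q) * l2norm x <= l2norm (x - B x).
  have := ler_l2normD (x - B x) (B x); rewrite subrK /=.
  by have := hq x; lra.
(* The constant comes from (1 - q) |X_m - X_n| <= |B^n y - B^m y| <= 2 q^n |y|. *)
have [x hx] : exists x, forall n, l2norm (x - X n) <=
    (2 * l2norm y / (1 - q)) * q ^+ n.
  apply: l2_complete => // n m nm.
  rewrite mulrAC ler_pdivlMr ?subr_gt0// mulrC (le_trans (hX _))//.
  rewrite (bopB bB.1) subrACA !X1 opprB addrC addrA subrK.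
  rewrite (le_trans (ler_l2normD _ _))// l2normN.
  have h1 : q ^+ m * l2norm y <= q ^+ n * l2norm y.
    by rewrite ler_wpM2r ?l2norm_ge0// ler_wiXn2l// ltW.
  have := hB n y; have := hB m y; lra.
exists x => /=; apply/eqP; rewrite -subr_eq0 -l2norm_eq0 eq_le l2norm_ge0 andbT.
have [M M0 hM] := bounded_opM (bounded_sub bounded_id bB).
pose K := M * (2 * l2norm y / (1 - q)) + l2norm y.
have cq : K * q ^+ n @[n --> \oo] --> (0 : R).
  rewrite -[in X in _ --> X](mulr0 K); apply: cvgM; first exact: cvg_cst.
  by apply: cvg_expr; rewrite ger0_norm.
rewrite -(cvg_lim (@Rhausdorff R) cq); apply: limr_ge.
  by apply/cvg_ex; eexists; exact: cq.
apply: nearW => n.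
have -> : x - B x - y = (id \- B) (x - X n) - iter n B y.
  by rewrite /= (bopB bB.1) subrACA X1 opprD opprK addrA addrK.
rewrite (le_trans (ler_l2normD _ _))// l2normN /K mulrDl lerD//.
  by rewrite (le_trans (hM _))// -mulrA ler_wpM2l// ltW.
by rewrite mulrC.
Qed.

(** The lower bound on T' makes T onto: T T' is self-adjoint and at least d^2, so 1 - t T T' is a
    strict contraction for small t. The Neumann series inverts t T T' by some S, and t T' (S y) is a
    preimage of y. *)
Lemma coercive_inverse T T' (d : R) : bounded_op T -> bounded_op T' ->
  adjoints T' T -> 0 < d ->
  (forall x, d * l2norm x <= l2norm (T x)) ->
  (forall x, d * l2norm x <= l2norm (T' x)) ->
  exists S, [/\ bounded_op S, S \o T = id & T \o S = id].
Proof.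
move=> bT bT' ad d0 hd hd'; apply: (@bounded_inverse _ d) => // y.
have [M0 M00 hM0] := bounded_opM bT.
(* Adding d ensures M >= d, hence 1 - d^2 / M^2 >= 0, which is the square of the contraction
   factor. *)
pose M := M0 + d.
have Mp : 0 < M by rewrite addr_gt0.
have hM x : l2norm (T x) <= M * l2norm x.
  rewrite (le_trans (hM0 x))// ler_wpM2r ?l2norm_ge0//.
  by rewrite lerDl ltW.
(* With this t, the term t^2 |T T' x|^2 is at most t |T' x|^2 and cancels half of the cross term - 2
   t |T' x|^2. *)
pose t := (M ^+ 2)^-1; have t0 : 0 < t by rewrite invr_gt0 exprn_gt0.
pose B : op := id \- ( *:%R ((t%:C)%C) \o (T \o T')).
have bB : bounded_op B.
  apply: bounded_sub; first exact: bounded_id.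
  by apply: bounded_comp; [exact: bounded_scale|exact: bounded_comp].
pose q2 := 1 - d ^+ 2 * t.
have q20 : 0 <= q2.
  rewrite subr_ge0 ler_pdivrMr ?exprn_gt0// mul1r ler_pXn2r ?nnegrE ?ltW//.
  by rewrite ltrDr.
have q21 : q2 < 1 by rewrite gtrBl mulr_gt0 ?exprn_gt0.
have hB x : l2norm (B x) <= Num.sqrt q2 * l2norm x.
  rewrite -(@ler_pXn2r _ 2) ?nnegrE ?mulr_ge0 ?sqrtr_ge0 ?l2norm_ge0//.
  have BE : B x = x - (t%:C)%C *: T (T' x) by [].
  rewrite BE l2norm_subZ_sqr cabs_real gtr0_norm// exprMn (sqr_sqrtr q20).
  rewrite -ad l2inner_self -rmorphM /=.
  have h1 : l2norm (T (T' x)) ^+ 2 <= M ^+ 2 * l2norm (T' x) ^+ 2.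
    by rewrite -exprMn ler_pXn2r ?nnegrE ?mulr_ge0 ?l2norm_ge0 ?(ltW Mp).
  have h2 : d ^+ 2 * l2norm x ^+ 2 <= l2norm (T' x) ^+ 2.
    by rewrite -exprMn ler_pXn2r ?nnegrE ?mulr_ge0 ?l2norm_ge0 ?(ltW d0).
  have h3 : t ^+ 2 * l2norm (T (T' x)) ^+ 2 <= t * l2norm (T' x) ^+ 2.
    apply: (le_trans (ler_wpM2l (sqr_ge0 t) h1)).
    by rewrite /t expr2 -mulrA [X in _ * X]mulrA mulVf ?mul1r// gt_eqF// exprn_gt0.
  have h4 := ler_wpM2l (ltW t0) h2; rewrite /q2.
  move: h3 h4; set a := l2norm (T (T' x)) ^+ 2; set b := l2norm (T' x) ^+ 2.
  by set c := l2norm x ^+ 2; set e := d ^+ 2; lra.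
have sq1 : Num.sqrt q2 < 1 by rewrite -sqrtr1 ltr_sqrt.
have [S [bS _ /(congr1 (fun f => f y)) /= hS]] := neumann bB (sqrtr_ge0 _) sq1 hB.
exists ((t%:C)%C *: T' (S y)); rewrite (bopZ bT.1) -[RHS]hS /B /= opprB addrCA.
by rewrite subrr addr0.
Qed.

End BoundedOperators.

(** * Diagonal and block diagonal operators *)

Opaque l2norm l2inner sqsum.

Section Adjoints.
Variable R : realType.
Local Notation op := (l2 R -> l2 R).
Implicit Types (x y z : l2 R) (c : R[i]) (T S A B : op).

Lemma l2inner_inj x y : (forall z, l2inner x z = l2inner y z) -> x = y.
Proof.
move=> h; apply/eqP; rewrite -subr_eq0 -l2norm_eq0 -sqrf_eq0.
by apply/eqP/complexI; rewrite -l2inner_self l2innerBl h subrr.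
Qed.

Lemma l2norm_sqr_inj x y : l2norm x ^+ 2 = l2norm y ^+ 2 -> l2norm x = l2norm y.
Proof.
by move=> h; apply/eqP; rewrite -(@eqrXn2 _ 2 _ _ isT (l2norm_ge0 x) (l2norm_ge0 y)) h.
Qed.

Lemma adjoints_comp S S' T T' : adjoints S T -> adjoints S' T' ->
  adjoints (S \o S') (T' \o T).
Proof. by move=> h h' x y /=; rewrite h h'. Qed.

Lemma adjoints_add S S' T T' : adjoints S T -> adjoints S' T' ->
  adjoints (S \+ S') (T \+ T').
Proof. by move=> h h' x y /=; rewrite l2innerDl l2innerDr h h'. Qed.

(** A choice made by [xget] is computed by exhibiting a member of its set and proving uniqueness;
    the same holds for the next two lemmas. *)
Lemma adjointE S T : bounded_op S -> adjoints S T -> adjoint T = S.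
Proof.
move=> bS h; apply: xget_unique => [|S' [bS' h']]; first by split.
by apply/funext => x; apply: l2inner_inj => z; rewrite h'// h.
Qed.

Lemma opinvE S T : bounded_op S -> S \o T = id -> T \o S = id -> opinv T = S.
Proof.
move=> bS h h'; apply: xget_unique => [|S' [bS' k k']]; first by split.
have e : S' \o (T \o S) = S by rewrite compA k.
by rewrite -e h'.
Qed.

Lemma op_of_mxE T (M : nat -> nat -> R[i]) : bounded_op T ->
  (forall i j, mxentry T i j = M i j) -> op_of_mx M = T.
Proof.
move=> bT h; apply: xget_unique => [|S [bS k]]; first by split.
by apply: bounded_op_ext => // i j; rewrite h k.
Qed.

Lemma isometry_inner T : bounded_op T -> (forall x, l2norm (T x) = l2norm x) ->
  forall x y, l2inner (T x) (T y) = l2inner x y.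
Proof.
move=> bT iT.
have hre x y : complex.Re (l2inner (T x) (T y)) = complex.Re (l2inner x y).
  have := l2normD_sqr (T x) (T y); rewrite -(bopD bT.1) !iT l2normD_sqr; lra.
move=> x y; apply: complex_ext => //.
have := hre x (('i)%C *: y); rewrite (bopZ bT.1) !l2innerZr !ReM /=; lra.
Qed.

End Adjoints.

Section DiagonalOperators.
Variable R : realType.
Local Notation op := (l2 R -> l2 R).

Definition bounded_seq (d : nat -> R[i]) := exists M : R, forall n, cabs (d n) <= M.

Definition diagop (d : nat -> R[i]) : op := coordop (fun x n => d n * x n).

Lemma diag_bound (d : nat -> R[i]) (M : R) : (forall n, cabs (d n) <= M) -> forall (x : l2 R) N,
  \sum_(k < N) cabs (d k * x k) ^+ 2 <= M ^+ 2 * l2norm x ^+ 2.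
Proof.
move=> h x N; apply: (@le_trans _ _ (\sum_(k < N) M ^+ 2 * cabs (x k) ^+ 2)).
  apply: ler_sum => k _; rewrite cabsM exprMn ler_wpM2r ?sqr_ge0//.
  by rewrite ler_pXn2r ?nnegrE ?cabs_ge0// (le_trans (cabs_ge0 _) (h k)).
by rewrite -mulr_sumr ler_wpM2l ?sqr_ge0// ler_psum_l2norm.
Qed.

Lemma diagopE d : bounded_seq d -> forall x n, diagop d x n = d n * x n.
Proof. by move=> [M h] x n; rewrite (coordopE (diag_bound h)). Qed.

Lemma bounded_diagop d : bounded_seq d -> bounded_op (diagop d).
Proof.
move=> [M h]; apply: (bounded_coordop (diag_bound h)) => c x y n.
by rewrite l2D l2Z mulrDr mulrCA.
Qed.

Lemma l2norm_diagop d (M : R) : 0 <= M -> (forall n, cabs (d n) <= M) ->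
  forall x, l2norm (diagop d x) <= M * l2norm x.
Proof.
move=> M0 h x; apply: l2norm_le; first by rewrite mulr_ge0 ?l2norm_ge0.
move=> N; rewrite exprMn; apply: le_trans (diag_bound h x N).
by under eq_bigr do rewrite (diagopE (ex_intro _ M h)).
Qed.

Lemma diagop_entry d : bounded_seq d -> forall i j,
  mxentry (diagop d) i j = if i == j then d i else 0.
Proof.
move=> h i j; rewrite /mxentry (diagopE h) /=.
by case: eqP => _; rewrite ?mulr1 ?mulr0.
Qed.

Lemma bounded_seqJ d : bounded_seq d -> bounded_seq (fun n => (d n)^*).
Proof. by move=> [M h]; exists M => n; rewrite cabsJ. Qed.

Lemma adjoints_diagop d : bounded_seq d ->
  adjoints (diagop (fun n => (d n)^*)) (diagop d).
Proof.
move=> h; apply: adjoints_entries; do ?exact: bounded_diagop.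
  exact/bounded_diagop/bounded_seqJ.
move=> i j; rewrite !diagop_entry//; last exact: bounded_seqJ.
by rewrite eq_sym; case: eqP => [->|_]//; rewrite conjC0.
Qed.

Lemma diagop_comp d d' : bounded_seq d -> bounded_seq d' ->
  diagop d \o diagop d' = diagop (fun n => d n * d' n).
Proof.
move=> h h'; have h2 : bounded_seq (fun n => d n * d' n).
  case: h => M hM; case: h' => M' hM'; exists (M * M') => n.
  by rewrite cabsM ler_pM ?cabs_ge0.
by apply/funext => x; apply: l2P => n /=; rewrite !diagopE// mulrA.
Qed.

Lemma diagop_id d : (forall n, d n = 1) -> diagop d = id.
Proof.
move=> h; have hd : bounded_seq d by exists 1 => n; rewrite h cabs1.
by apply/funext => x; apply: l2P => n; rewrite diagopE// h mul1r.
Qed.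

(* A square root S of diag (s_n ^ 2) commutes with it, so that S_ij = 0
   unless s_i = s_j: S commutes with diag s, and then
   (S + diag s)(S - diag s) = 0. *)
Lemma opsqrt_diagop (s : nat -> R) (m : R) : 0 < m -> (forall n, m <= s n) ->
  bounded_seq (fun n => ((s n)%:C)%C) ->
  opsqrt (diagop (fun n => ((s n ^+ 2)%:C)%C)) = diagop (fun n => ((s n)%:C)%C).
Proof.
move=> m0 ms bs; set D := diagop (fun n => ((s n)%:C)%C).
have bD : bounded_op D by exact: bounded_diagop.
have D2 : D \o D = diagop (fun n => ((s n ^+ 2)%:C)%C).
  rewrite diagop_comp//; congr diagop; apply/funext => n.
  by rewrite expr2 rmorphM.
have Dge x : ((m * l2norm x ^+ 2)%:C)%C <= l2inner x (D x).
  have cvD := @cvg_l2inner R x (D x).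
  have e : series (fun n => (x n)^* * (D x) n) =
      fun n => ((\sum_(0 <= k < n) s k * cabs (x k) ^+ 2)%:C)%C.
    apply/funext => n; rewrite /series /= rmorph_sum.
    apply: eq_bigr => k _ /=.
    by rewrite diagopE// mulrCA conjM_cabs -rmorphM.
  move: cvD; rewrite e => /cvg_ReImP[/= h1 h2]; rewrite lecE; apply/andP; split.
    apply/eqP; rewrite -(cvg_lim (@Rhausdorff R) h2).
    by apply: (cvg_lim (@Rhausdorff R)); exact: cvg_cst.
  have h3 : m * series (fun k => cabs (x k) ^+ 2) n @[n --> \oo] -->
     m * l2norm x ^+ 2.
    by apply: cvgM; [exact: cvg_cst|exact: cvg_l2norm].
  apply: (ler_cvg_to h3 h1); apply: nearW => n; rewrite /series /= mulr_sumr.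
  by apply: ler_sum => k _; rewrite ler_wpM2r ?sqr_ge0.
apply: xget_unique.
  split => // x; apply: le_trans (Dge x); rewrite lecR.
  by rewrite mulr_ge0 ?sqr_ge0 ?ltW.
move=> S [bS S0 S2]; rewrite -D2 in S2.
have comm : S \o D = D \o S.
  apply: bounded_op_ext; do ?exact: bounded_comp.
  have De j : D (l2e R j) = ((s j)%:C)%C *: l2e R j.
    apply: l2P => n; rewrite diagopE// l2Z /=.
    by case: eqP => [->|_]//; rewrite !mulr0.
  move=> i j; rewrite /mxentry /= De (bopZ bS.1) l2Z diagopE//.
  have := congr1 (fun f => (S (f (l2e R j)) : l2 R) i) S2.
  rewrite -[S ((S \o S) _)]/((S \o S) (S (l2e R j))) S2 /= !De.
  rewrite (bopZ bD.1) De !(bopZ bS.1) !diagopE// !l2Z => /eqP.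
  rewrite !mulrA -subr_eq0 -mulrBl mulf_eq0 => /orP[|/eqP ->]; last first.
    by rewrite !mulr0.
  rewrite -!rmorphM -rmorphB /= => /eqP /complexI /eqP.
  rewrite subr_eq0 -!expr2 eqrXn2//; first by move=> /eqP ->.
    by rewrite (le_trans (ltW m0)).
  by rewrite (le_trans (ltW m0)).
apply/funext => x; apply/eqP; rewrite -subr_eq0 -l2norm_eq0 -sqrf_eq0.
set v := S x - D x.
have hv : S v + D v = 0.
  rewrite /v (bopB bS.1) (bopB bD.1).
  rewrite -[S (S x)]/((S \o S) x) -[S (D x)]/((S \o D) x) S2 comm /=.
  by rewrite addrA subrK subrr.
(* Since S >= 0, one has m |v|^2 <= <v, D v> <= <v, (S + D) v> = 0. *)
have : ((m * l2norm v ^+ 2)%:C)%C <= 0.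
  apply: (le_trans (Dge v)); rewrite -(l2inner0r v) -hv l2innerDr.
  by rewrite lerDr.
rewrite lecR pmulr_rle0// => v0; rewrite eq_le v0 sqr_ge0//.
Qed.

End DiagonalOperators.

(** * Unitary operators made of blocks of size at most 2 *)

Section PairingOperators.
Variable R : realType.
Local Notation op := (l2 R -> l2 R).

Definition paircoord (c d : nat -> R[i]) (f : nat -> nat) (u : nat -> R[i]) n :=
  c n * u n + d n * u (f n).

(* 2 x 2 block diagonal operators, with blocks {n, f n}. *)
Definition pairop c d f : op := coordop (fun x => paircoord c d f x).

(** The last two conditions say that M^dag M has diagonal entries 1 and vanishing (n, f n) entries.
    Nearness of n and f n lets sums of |x_(f n)|^2 be compared with sums of |x_n|^2. *)
Record pairing (c d : nat -> R[i]) (f : nat -> nat) : Prop := Pairing {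
  pairing_inv : forall n, f (f n) = n;
  pairing_near : forall n, (f n <= n.+1)%N /\ (n <= (f n).+1)%N;
  pairing_real : forall n, (d n)^* = d n;
  pairing_sym : forall n, d (f n) = d n;
  pairing_unit : forall n, (c n)^* * c n + d n * d n = 1;
  pairing_orth : forall n, d n * ((c n)^* + c (f n)) = 0 }.

Lemma pairing_adj c d f : pairing c d f -> pairing (fun n => (c n)^*) d f.
Proof.
case=> h1 h2 h3 h4 h5 h6; split => // n.
  by rewrite conjCK mulrC.
apply: (can_inj (@conjCK _)).
by rewrite conjCK rmorphM rmorphD /= conjCK h3 h6 conjC0.
Qed.

Lemma pairing_bound c d f : pairing c d f ->
  forall n, cabs (c n) <= 1 /\ cabs (d n) <= 1.
Proof.
case=> _ _ h3 _ h5 _ n; have := h5 n.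
rewrite -{1}h3 !conjM_cabs -rmorphD => /complexI h.
have := cabs_ge0 (c n); have := cabs_ge0 (d n); split; nra.
Qed.

(** A crude constant suffices to define the operator; the exact norm comes from [pairop_isometry].
    Here 10 = 4 + 2 + 2 . 2, the last factor 2 because the predecessor of 0 is 0, so that the first
    square is counted twice. *)
Lemma paircoord_bound c d f : pairing c d f -> forall (x : l2 R) N,
  \sum_(k < N) cabs (paircoord c d f x k) ^+ 2 <= 10 * l2norm x ^+ 2.
Proof.
move=> h x N; pose u n := cabs (x n) ^+ 2.
have u0 n : 0 <= u n by exact: sqr_ge0.
apply: (@le_trans _ _ (\sum_(k < N) (4 * u k + 2 * u k.+1 + 2 * u k.-1))).
  apply: ler_sum => k _; rewrite /paircoord.
  have [c1 d1] := pairing_bound h k.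
  have h1 : cabs (c k * x k + d k * x (f k)) <= cabs (x k) + cabs (x (f k)).
    rewrite (le_trans (cabsD _ _))// !cabsM.
    by rewrite lerD// ler_piMl ?cabs_ge0.
  have h2 : u (f k) <= u k + u k.+1 + u k.-1.
    have [e|[e|e]] : f k = k.+1 \/ f k = k \/ f k = k.-1.
      have [a1 a2] := pairing_near h k; move: a1; rewrite leq_eqVlt.
      case/orP=> [/eqP ->|]; first by left.
      rewrite ltnS leq_eqVlt => /orP[/eqP ->|a3]; first by right; left.
      right; right; apply/eqP; rewrite eqn_leq -ltnS prednK ?a3//.
        by rewrite -ltnS prednK// (leq_trans _ a3).
      by rewrite (leq_trans _ a3).
    - by rewrite e; have := u0 k; have := u0 k.-1; lra.
    - by rewrite e; have := u0 k.+1; have := u0 k.-1; lra.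
    - by rewrite e; have := u0 k; have := u0 k.+1; lra.
  apply: (@le_trans _ _ (2 * u k + 2 * u (f k))); last by lra.
  rewrite (le_trans (lerXn2r 2 _ _ h1)) ?nnegrE ?addr_ge0 ?cabs_ge0//.
  rewrite /u; have := sqr_ge0 (cabs (x k) - cabs (x (f k))); nra.
rewrite !big_split /= -!mulr_sumr.
have b0 M : \sum_(k < M) u k <= l2norm x ^+ 2 by exact: ler_psum_l2norm.
have b1 : \sum_(k < N) u k.+1 <= l2norm x ^+ 2.
  by apply: le_trans (b0 N.+1); rewrite big_ord_recl /= lerDr.
have b2 : \sum_(k < N) u k.-1 <= 2 * l2norm x ^+ 2.
  case: (N) => [|M]; first by rewrite big_ord0 mulr_ge0 ?sqr_ge0.
  rewrite big_ord_recl /=; have := b0 M; have := b0 1%N.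
  by rewrite big_ord_recl big_ord0 addr0 /=; lra.
have := b0 N; lra.
Qed.

Lemma pairopE c d f : pairing c d f ->
  forall x n, pairop c d f x n = paircoord c d f x n.
Proof. by move=> h x n; rewrite (coordopE (paircoord_bound h)). Qed.

Lemma bounded_pairop c d f : pairing c d f -> bounded_op (pairop c d f).
Proof.
move=> h; apply: (bounded_coordop (paircoord_bound h)) => a x y n.
by rewrite /paircoord !l2D !l2Z; ring.
Qed.

Lemma pairop_entry c d f : pairing c d f -> forall i j,
  mxentry (pairop c d f) i j = c i * (i == j)%:R + d i * (f i == j)%:R.
Proof. by move=> h i j; rewrite /mxentry pairopE. Qed.

Lemma adjoints_pairop c d f : pairing c d f ->
  adjoints (pairop (fun n => (c n)^*) d f) (pairop c d f).
Proof.
move=> h; have h' := pairing_adj h.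
apply: adjoints_entries; do ?exact: bounded_pairop.
move=> i j; rewrite !pairop_entry// rmorphD !rmorphM /= !conjC_nat.
rewrite (pairing_real h) eq_sym; congr (_ + _).
  by case: eqP => [->|_]//; rewrite !mulr0.
have -> : (f j == i) = (f i == j).
  by rewrite -(inj_eq (can_inj (pairing_inv h))) (pairing_inv h) eq_sym.
by case: eqP => [<-|_]; rewrite ?(pairing_sym h)// !mulr0.
Qed.

Lemma pairop_unitary c d f : pairing c d f ->
  pairop (fun n => (c n)^*) d f \o pairop c d f = id.
Proof.
move=> h; have h' := pairing_adj h.
apply/funext => x; apply: l2P => n /=; rewrite pairopE// /paircoord !pairopE//.
rewrite /paircoord (pairing_inv h) (pairing_sym h).
transitivity (((c n)^* * c n + d n * d n) * x n +
  d n * ((c n)^* + c (f n)) * x (f n)); first by ring.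
by rewrite (pairing_unit h) (pairing_orth h) mul1r mul0r addr0.
Qed.

Lemma pairop_isometry c d f : pairing c d f ->
  forall x, l2norm (pairop c d f x) = l2norm x.
Proof.
move=> h x; apply/eqP; rewrite -(@eqrXn2 _ 2) ?l2norm_ge0//; apply/eqP.
apply: complexI; rewrite -!l2inner_self -(adjoints_pairop h).
by have /(congr1 (fun g => g x)) /= -> := pairop_unitary h.
Qed.

Lemma pairopK c d f : pairing c d f ->
  pairop c d f \o pairop (fun n => (c n)^*) d f = id.
Proof.
move=> h; have := pairop_unitary (pairing_adj h).
by rewrite (_ : (fun n => ((c n)^*)^*) = c)//; apply/funext => n; rewrite conjCK.
Qed.

End PairingOperators.

(** * The operator Moebius transform of the CMV matrix *)

Opaque diagop pairop.

Section CMV.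
Variable R : realType.

Lemma sqrtC_real (r : R) : 0 <= r -> sqrtC (r%:C)%C = ((Num.sqrt r)%:C)%C.
Proof.
move=> r0; rewrite -[in LHS](sqr_sqrtr r0) rmorphXn /= sqrCK//.
by rewrite lecR sqrtr_ge0.
Qed.

Definition flip n := if odd n then n.-1 else n.+1.

Lemma flipP n : [/\ flip (flip n) = n, (flip n)./2 = n./2 & odd (flip n) = ~~ odd n].
Proof.
rewrite /flip -[n]odd_double_half; case: (odd n) => /=.
  by rewrite odd_double /= odd_double doubleK uphalf_double.
by rewrite add0n odd_double /= odd_double /= uphalf_double doubleK.
Qed.

Section Pair.
Variable g : nat -> R[i].
Hypothesis g1 : forall n, cabs (g n) < 1.

Definition block_diag i := if odd i then (g i./2)^* else - g i./2.
Definition block_off i := sqrtC (1 - `|g i./2| ^+ 2).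

Lemma block_offE i :
  block_off i = ((Num.sqrt (1 - cabs (g i./2) ^+ 2))%:C)%C.
Proof.
rewrite /block_off cabsE -rmorphXn -(rmorph1 (real_complex R)) -rmorphB /=.
by rewrite sqrtC_real// subr_ge0 exprn_ile1 ?cabs_ge0 ?ltW.
Qed.

Lemma pairing_block : pairing block_diag block_off flip.
Proof.
split => n; have [f1 f2 f3] := flipP n => //.
- by rewrite /flip; case: ifP => _; case: n {f1 f2 f3} => [|n]//=; split;
    rewrite // ltnW// ltnW.
- by rewrite block_offE; exact: conjc_real.
- by rewrite /block_off f2.
- rewrite -{1}[block_off n](_ : (block_off n)^* = _); last first.
    by rewrite block_offE; exact: conjc_real.
  rewrite !conjM_cabs -rmorphD /= block_offE cabs_real ger0_norm ?sqrtr_ge0//.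
  rewrite sqr_sqrtr ?subr_ge0 ?exprn_ile1 ?cabs_ge0 ?ltW//.
  have -> : cabs (block_diag n) = cabs (g n./2).
    by rewrite /block_diag; case: ifP => _; rewrite ?cabsJ ?cabsN.
  by rewrite subrKC.
- rewrite /block_diag f2 f3; case: (odd n) => /=; rewrite ?conjCK ?rmorphN /=.
    by rewrite subrr mulr0.
  by rewrite addNr mulr0.
Qed.

End Pair.

(** With [shiftf], this prepends the 1 x 1 block of C_e: index 0 becomes its own partner. *)
Definition shift (c0 : R[i]) (c : nat -> R[i]) i := if i is j.+1 then c j else c0.
Definition shiftf (f : nat -> nat) i := if i is j.+1 then (f j).+1 else 0%N.

Lemma pairing_shift c d f : pairing c d f ->
  pairing (shift 1 c) (shift 0 d) (shiftf f).
Proof.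
case=> h1 h2 h3 h4 h5 h6; split; case=> [|n] //=.
- by rewrite h1.
- by have [] := h2 n.
- by rewrite conjC0.
- by rewrite conjC1 mulr1 mulr0 addr0.
- by rewrite mul0r.
Qed.

Variables (alpha a : nat -> R[i]) (r : R).
Hypothesis alpha_r : forall n, cabs (alpha n) <= r.
Hypothesis r1 : r < 1.
Hypothesis a1 : forall n, (0 < n)%N -> cabs (a n) < 1.

Definition a_odd k := a k.*2.+1.
Definition a_even k := a k.*2.+2.
Definition odiag := block_diag a_odd.
Definition ooff := block_off a_odd.
Definition ediag := shift 1 (block_diag a_even).
Definition eoff := shift 0 (block_off a_even).
Definition eflip := shiftf flip.

Lemma pairing_o : pairing odiag ooff flip.
Proof. by apply: pairing_block => n; exact: a1. Qed.

Lemma pairing_e : pairing ediag eoff eflip.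
Proof. by apply/pairing_shift/pairing_block => n; exact: a1. Qed.

Lemma block_entry g (i j : nat) :
  (if i./2 == j./2 then match odd i, odd j with
     | false, false => - g i./2 | true, true => (g i./2)^*
     | _, _ => block_off g i end else 0) =
  block_diag g i * (i == j)%:R + block_off g i * (flip i == j)%:R.
Proof.
have [f1 f2 f3] := flipP i.
have eqE k l : (k == l) = (k./2 == l./2) && (odd k == odd l).
  apply/eqP/andP => [->|[/eqP h /eqP k']]//.
  by rewrite -[k]odd_double_half -[l]odd_double_half h k'.
rewrite (eqE i j) (eqE (flip i) j) f2 f3 /block_diag; case: eqP => _ /=;
  last by rewrite !mulr0 addr0.
by case: (odd i); case: (odd j); rewrite /= ?mulr1 ?mulr0 ?addr0 ?add0r.
Qed.

Lemma Comx_entry i j : mxentry (pairop odiag ooff flip) i j = Comx a i j.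
Proof.
rewrite (pairop_entry pairing_o) /Comx /odiag -block_entry /Theta /block_off /rho.
by case: eqP => // _; case: (odd i); case: (odd j).
Qed.

Lemma Cemx_entry i j : mxentry (pairop ediag eoff eflip) i j = Cemx a i j.
Proof.
rewrite (pairop_entry pairing_e); case: i => [|i]; case: j => [|j] /=.
- by rewrite mul0r addr0 mulr1.
- by rewrite mulr0 mul0r addr0.
- by rewrite !mulr0 addr0.
rewrite !eqSS -block_entry /Theta /block_off /rho.
by case: eqP => // _; case: (odd i); case: (odd j).
Qed.

Notation Co := (pairop odiag ooff flip).
Notation Ce := (pairop ediag eoff eflip).
Notation Co' := (pairop (fun n => (odiag n)^*) ooff flip).
Notation Ce' := (pairop (fun n => (ediag n)^*) eoff eflip).

Lemma CopE : Cop a = Co \o Ce.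
Proof.
rewrite /Cop (op_of_mxE (bounded_pairop pairing_o) Comx_entry).
by rewrite (op_of_mxE (bounded_pairop pairing_e) Cemx_entry).
Qed.

(** Diagonal of both eta_A and eta_(A^dag), as A is normal. Compact inclusion of alpha keeps it away
    from 0, so that eta is boundedly invertible. *)
Definition defect n : R := Num.sqrt (1 - cabs (alpha n) ^+ 2).

Lemma r_ge0 : 0 <= r.
Proof. exact: le_trans (cabs_ge0 _) (alpha_r 0%N). Qed.

Lemma defect_ge n : Num.sqrt (1 - r ^+ 2) <= defect n.
Proof.
rewrite ler_sqrt; last by rewrite subr_ge0 exprn_ile1 ?cabs_ge0 ?(le_trans (alpha_r n)) ?ltW.
by rewrite lerB// ler_pXn2r ?nnegrE ?cabs_ge0 ?r_ge0.
Qed.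

Lemma defect_min : 0 < Num.sqrt (1 - r ^+ 2).
Proof. by rewrite sqrtr_gt0 subr_gt0 exprn_ilt1 ?r_ge0. Qed.

Lemma defect_gt0 n : 0 < defect n.
Proof. exact: lt_le_trans defect_min (defect_ge n). Qed.

Lemma defect_sqr n : defect n ^+ 2 = 1 - cabs (alpha n) ^+ 2.
Proof.
by rewrite sqr_sqrtr// subr_ge0 exprn_ile1 ?cabs_ge0 ?(le_trans (alpha_r n)) ?ltW.
Qed.

Lemma defect_le1 n : defect n <= 1.
Proof.
rewrite -(@ler_pXn2r _ 2) ?nnegrE ?(ltW (defect_gt0 n))// defect_sqr expr1n.
by rewrite lerBlDr lerDl sqr_ge0.
Qed.

Lemma bounded_alpha : bounded_seq alpha.
Proof. by exists r. Qed.

Lemma bounded_defect : bounded_seq (fun n => ((defect n)%:C)%C).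
Proof.
exists 1 => n; rewrite cabs_real ger0_norm ?defect_le1//.
exact/ltW/defect_gt0.
Qed.

Lemma bounded_defectV : bounded_seq (fun n => ((defect n)^-1%:C)%C).
Proof.
exists (Num.sqrt (1 - r ^+ 2))^-1 => n.
rewrite cabs_real ger0_norm ?invr_ge0; last exact/ltW/defect_gt0.
by rewrite lef_pV2 ?posrE ?defect_gt0 ?defect_min ?defect_ge.
Qed.

Lemma bounded_seqM (d d' : nat -> R[i]) : bounded_seq d -> bounded_seq d' ->
  bounded_seq (fun n => d n * d' n).
Proof.
move=> [M h] [M' h']; exists (M * M') => n.
by rewrite cabsM ler_pM ?cabs_ge0.
Qed.

Notation A := (diagop alpha).
Notation A' := (diagop (fun n => (alpha n)^*)).
Notation E := (diagop (fun n => ((defect n)%:C)%C)).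
Notation Ei := (diagop (fun n => ((defect n)^-1%:C)%C)).

Lemma AopE : Aop alpha = A.
Proof.
apply: (op_of_mxE (bounded_diagop bounded_alpha)) => i j.
by rewrite (diagop_entry bounded_alpha).
Qed.

Lemma adjoint_A : adjoint A = A'.
Proof.
apply: adjointE; first exact/bounded_diagop/bounded_seqJ/bounded_alpha.
exact/adjoints_diagop/bounded_alpha.
Qed.

Lemma adjoint_A' : adjoint A' = A.
Proof.
apply: adjointE; first exact/bounded_diagop/bounded_alpha.
exact/adjoints_sym/adjoints_diagop/bounded_alpha.
Qed.

Lemma id_sub_diag (d : nat -> R[i]) : bounded_seq d ->
  (forall n, d n = ((cabs (alpha n) ^+ 2)%:C)%C) ->
  opsqrt (id \- diagop d) = E.
Proof.
move=> bd hd; rewrite -(opsqrt_diagop defect_min defect_ge bounded_defect); congr opsqrt.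
have bs2 : bounded_seq (fun n => ((defect n ^+ 2)%:C)%C).
  rewrite (_ : (fun n => _) = fun n => ((defect n)%:C)%C * ((defect n)%:C)%C).
    by apply: bounded_seqM; exact: bounded_defect.
  by apply/funext => n; rewrite expr2 rmorphM.
apply/funext => x; apply: l2P => n.
rewrite -[LHS]/(x n - diagop d x n) !diagopE//.
by rewrite hd defect_sqr rmorphB rmorph1 mulrBl mul1r.
Qed.

Lemma opeta_A : opeta A = E.
Proof.
rewrite /opeta adjoint_A diagop_comp; last 2 first.
- exact: bounded_alpha.
- exact/bounded_seqJ/bounded_alpha.
apply: id_sub_diag => [|n]; last exact: mulC_conj.
by apply: bounded_seqM; [exact: bounded_alpha|exact/bounded_seqJ/bounded_alpha].
Qed.

Lemma opeta_A' : opeta A' = E.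
Proof.
rewrite /opeta adjoint_A' diagop_comp; last 2 first.
- exact/bounded_seqJ/bounded_alpha.
- exact: bounded_alpha.
apply: id_sub_diag => [|n]; last exact: conjM_cabs.
by apply: bounded_seqM; [exact/bounded_seqJ/bounded_alpha|exact: bounded_alpha].
Qed.

Lemma EEi : E \o Ei = id.
Proof.
rewrite diagop_comp; [|exact: bounded_defect|exact: bounded_defectV].
apply: diagop_id => n; rewrite -rmorphM /= mulfV// gt_eqF//; exact: defect_gt0.
Qed.

Lemma EiE : Ei \o E = id.
Proof.
rewrite diagop_comp; [|exact: bounded_defectV|exact: bounded_defect].
apply: diagop_id => n; rewrite -rmorphM /= mulVf// gt_eqF//; exact: defect_gt0.
Qed.

Lemma opinv_E : opinv E = Ei.
Proof.
by apply: opinvE; [exact/bounded_diagop/bounded_defectV|exact: EiE|exact: EEi].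
Qed.

Notation C := (Co \o Ce).
Notation C' := (Ce' \o Co').

Let bA : bounded_op A := bounded_diagop bounded_alpha.
Let bA' : bounded_op A' := bounded_diagop (bounded_seqJ bounded_alpha).
Let bE : bounded_op E := bounded_diagop bounded_defect.
Let bEi : bounded_op Ei := bounded_diagop bounded_defectV.
Let bCo : bounded_op Co := bounded_pairop pairing_o.
Let bCe : bounded_op Ce := bounded_pairop pairing_e.
Let bCo' : bounded_op Co' := bounded_pairop (pairing_adj pairing_o).
Let bCe' : bounded_op Ce' := bounded_pairop (pairing_adj pairing_e).
Let nCo : forall x, l2norm (Co x) = l2norm x := pairop_isometry pairing_o.
Let nCe : forall x, l2norm (Ce x) = l2norm x := pairop_isometry pairing_e.
Let nCo' : forall x, l2norm (Co' x) = l2norm x :=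
  pairop_isometry (pairing_adj pairing_o).
Let nCe' : forall x, l2norm (Ce' x) = l2norm x :=
  pairop_isometry (pairing_adj pairing_e).

Lemma neumann_plus (B : l2 R -> l2 R) : bounded_op B ->
  (forall x, l2norm (B x) <= r * l2norm x) ->
  exists S, [/\ bounded_op S, S \o (id \+ B) = id & (id \+ B) \o S = id].
Proof.
move=> bB hB; rewrite (_ : id \+ B = id \- (\- B)); last first.
  by apply/funext => x /=; rewrite opprK.
apply: (neumann (bounded_opp bB) r_ge0 r1) => x /=.
by rewrite l2normN.
Qed.

Definition U := opmoebius (Aop alpha) (Cop a).

Lemma U_formula : exists G,
  [/\ bounded_op G, G \o (id \+ (A' \o C)) = id, (id \+ (A' \o C)) \o G = id
    & U = Ei \o (C \+ A) \o G \o E].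
Proof.
have [|x|G [bG G1 G2]] := @neumann_plus (A' \o C).
- by apply: (bounded_comp bA'); exact: bounded_comp.
- have h n : cabs (alpha n)^* <= r by rewrite cabsJ.
  by apply: (le_trans (l2norm_diagop r_ge0 h (Co (Ce x)))); rewrite nCo nCe.
exists G; split => //.
by rewrite /U /opmoebius AopE CopE opeta_A opinv_E adjoint_A opeta_A' (opinvE bG).
Qed.

(* Right factors after conjugating away the inverse of 1 + A^dag C:
   U Q = N with Q = eta^-1 (Ce^dag + A^dag Co), N = eta^-1 (Co + A Ce^dag). *)
Definition Qop := Ei \o (Ce' \+ (A' \o Co)).
Definition Nop := Ei \o (Co \+ (A \o Ce')).

Let CeCe' x : Ce (Ce' x) = x.
Proof. by have /(congr1 (fun g => g x)) := pairopK pairing_e. Qed.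
Let Ce'Ce x : Ce' (Ce x) = x.
Proof. by have /(congr1 (fun g => g x)) := pairop_unitary pairing_e. Qed.
Let CoCo' x : Co (Co' x) = x.
Proof. by have /(congr1 (fun g => g x)) := pairopK pairing_o. Qed.

Lemma UQ : U \o Qop = Nop.
Proof.
have [G [bG G1 _ ->]] := U_formula.
apply/funext => x; rewrite /Qop /Nop /=.
have := congr1 (fun g => g (Ce' x + A' (Co x))) EEi => /= ->.
(* As C Ce^dag = Co, the vector Ce^dag x + A^dag Co x is (1 + A^dag C) applied to Ce^dag x, which G
   undoes. *)
have := congr1 (fun g => g (Ce' x)) G1; rewrite /= CeCe' => ->.
by rewrite CeCe'.
Qed.

(** Q = eta^-1 (1 + A^dag C) Ce^dag is a product of invertible operators. Being onto, Q can be
    cancelled in U Q = N. *)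
Lemma Q_surj y : exists x, Qop x = y.
Proof.
have [G [bG _ G2 _]] := U_formula.
exists (Ce (G (E y))); rewrite /Qop /= Ce'Ce.
have := congr1 (fun g => g (E y)) G2; rewrite /= => ->.
by have := congr1 (fun g => g y) EiE.
Qed.

Lemma QopE x n : Qop x n =
  ((defect n)^-1%:C)%C * (Ce' x n + (alpha n)^* * Co x n).
Proof.
rewrite -(diagopE (bounded_seqJ bounded_alpha) (Co x) n).
exact: (diagopE bounded_defectV (Ce' x + A' (Co x)) n).
Qed.

Lemma NopE x n : Nop x n = ((defect n)^-1%:C)%C * (Co x n + alpha n * Ce' x n).
Proof.
rewrite -(diagopE bounded_alpha (Ce' x) n).
exact: (diagopE bounded_defectV (Co x + A (Ce' x)) n).
Qed.

(** The map from (u, w) to (p, q) is a hyperbolic rotation, which preserves the indefinite form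
    |u|^2 - |w|^2. *)
Lemma moebius_norm (s : R) (al u w p q : R[i]) :
  s ^+ 2 = 1 - cabs al ^+ 2 -> s != 0 ->
  p = (s^-1%:C)%C * (u + al * w) -> q = (s^-1%:C)%C * (w + al^* * u) ->
  cabs u ^+ 2 - cabs w ^+ 2 = cabs p ^+ 2 - cabs q ^+ 2.
Proof.
move=> ss s0 -> ->; set t := s^-1.
rewrite !cabsM !cabs_real !exprMn real_normK ?num_real//.
have -> : cabs (u + al * w) ^+ 2 = cabs (w + al^* * u) ^+ 2 +
    s ^+ 2 * (cabs u ^+ 2 - cabs w ^+ 2).
  rewrite ss !cabs2E !ReD !ImD !ReM !ImM !ReJ !ImJ.
  by case: (u) => u1 u2; case: (w) => w1 w2; case: (al) => a1' a2 /=; ring.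
by rewrite /t; field.
Qed.

(** Summing [moebius_norm] over the coordinates gives |N x|^2 - |Q x|^2 = |Co x|^2 - |Ce^dag x|^2,
    and both terms on the right are |x|^2. *)
Lemma NQ_norm x : l2norm (Nop x) = l2norm (Qop x).
Proof.
apply: l2norm_sqr_inj.
pose d n := cabs (Co x n) ^+ 2 - cabs (Ce' x n) ^+ 2.
have dE n : d n = cabs (Nop x n) ^+ 2 - cabs (Qop x n) ^+ 2.
  apply: moebius_norm (defect_sqr n) _ (NopE x n) (QopE x n).
  by rewrite gt_eqF// defect_gt0.
have h1 : series d @ \oo --> l2norm (Co x) ^+ 2 - l2norm (Ce' x) ^+ 2.
  rewrite (_ : series d = series (fun n => cabs (Co x n) ^+ 2) -
    series (fun n => cabs (Ce' x n) ^+ 2)).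
    by apply: cvgB; exact: cvg_l2norm.
  by apply/funext => n; rewrite /series /= sumrB.
have h2 : series d @ \oo --> l2norm (Nop x) ^+ 2 - l2norm (Qop x) ^+ 2.
  rewrite (_ : series d = series (fun n => cabs (Nop x n) ^+ 2) -
    series (fun n => cabs (Qop x n) ^+ 2)).
    by apply: cvgB; exact: cvg_l2norm.
  have dF : d = fun n => cabs (Nop x n) ^+ 2 - cabs (Qop x n) ^+ 2.
    by apply/funext => n; exact: dE.
  by rewrite dF; apply/funext => n; rewrite /series /= sumrB.
have h3 : l2norm (Co x) ^+ 2 - l2norm (Ce' x) ^+ 2 =
    l2norm (Nop x) ^+ 2 - l2norm (Qop x) ^+ 2.
  exact: etrans (esym (cvg_lim (@Rhausdorff R) h1)) (cvg_lim (@Rhausdorff R) h2).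
by move: h3; rewrite nCo nCe' subrr => /esym/eqP; rewrite subr_eq0 => /eqP.
Qed.

Lemma bounded_U : bounded_op U.
Proof.
have [G [bG _ _ ->]] := U_formula.
apply: bounded_comp bE; apply: bounded_comp bG; apply: bounded_comp bEi _.
by apply: bounded_add bA; exact: bounded_comp.
Qed.

Lemma U_isometry x : l2norm (U x) = l2norm x.
Proof.
have [y <-] := Q_surj x; have /(congr1 (fun g => g y)) /= -> := UQ.
exact: NQ_norm.
Qed.

(** The other factor is invertible as well: C + A = (1 + A C^dag) C, with A C^dag of norm at most
    r. *)
Lemma U_surj y : exists x, U x = y.
Proof.
have [G [bG G1 _ ->]] := U_formula.
have bC' : bounded_op C' by exact: bounded_comp.
have [|x|H [bH _ H2]] := @neumann_plus (A \o C').
- exact: bounded_comp.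
- by apply: (le_trans (l2norm_diagop r_ge0 alpha_r (Ce' (Co' x)))); rewrite nCe' nCo'.
pose x := C' (H (E y)).
exists (Ei (x + A' (C x))) => /=.
have := congr1 (fun g => g (x + A' (C x))) EEi => /= ->.
have := congr1 (fun g => g x) G1; rewrite /= => ->.
have -> : Co (Ce x) = H (E y) by rewrite /x /= CeCe' CoCo'.
have := congr1 (fun g => g (E y)) H2; rewrite /= => ->.
by have := congr1 (fun g => g y) EiE.
Qed.

Lemma U_inverse : exists V,
  [/\ bounded_op V, V \o U = id, U \o V = id & adjoints V U].
Proof.
have [||V [bV VU UV]] := @bounded_inverse R U 1 bounded_U ltr01.
- by move=> x; rewrite mul1r U_isometry.
- exact: U_surj.
exists V; split => // x y.
by rewrite -(isometry_inner bounded_U U_isometry (V x) y) -[U (V x)]/((U \o V) x) UV.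
Qed.

Definition normalize (u : nat -> R[i]) n := ((defect n)^-1%:C)%C * u n.

(* Coordinates of N^dag u and Q^dag u, for arbitrary sequences u. *)
Definition rec0 u k :=
  paircoord (fun n => (odiag n)^*) ooff flip (normalize u) k +
  paircoord ediag eoff eflip (fun n => (alpha n)^* * normalize u n) k.
Definition rec1 u k :=
  paircoord ediag eoff eflip (normalize u) k +
  paircoord (fun n => (odiag n)^*) ooff flip (fun n => alpha n * normalize u n) k.

Definition Qadj := (Ce \+ (Co' \o A)) \o Ei.
Definition Nadj := (Co' \+ (Ce \o A')) \o Ei.

Let adjEi : adjoints Ei Ei.
Proof.
have := adjoints_diagop bounded_defectV.
rewrite (_ : (fun n => (((defect n)^-1%:C)%C)^*) = fun n => ((defect n)^-1%:C)%C)//.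
by apply/funext => n; exact: conjc_real.
Qed.

Lemma adjoints_Q : adjoints Qadj Qop.
Proof.
apply: adjoints_comp adjEi; apply: adjoints_add.
  exact/adjoints_sym/adjoints_pairop/pairing_e.
apply: adjoints_comp; first exact/adjoints_pairop/pairing_o.
exact/adjoints_sym/adjoints_diagop/bounded_alpha.
Qed.

Lemma adjoints_N : adjoints Nadj Nop.
Proof.
apply: adjoints_comp adjEi; apply: adjoints_add.
  exact/adjoints_pairop/pairing_o.
apply: adjoints_comp; last exact/adjoints_diagop/bounded_alpha.
exact/adjoints_sym/adjoints_pairop/pairing_e.
Qed.

Lemma eq_paircoord c d f (u v : nat -> R[i]) : (forall n, u n = v n) ->
  forall k, paircoord c d f u k = paircoord c d f v k.
Proof. by move=> h k; rewrite /paircoord !h. Qed.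

Lemma QadjE x k : Qadj x k = rec1 x k.
Proof.
transitivity (Ce (Ei x) k + Co' (A (Ei x)) k) => //.
rewrite (pairopE pairing_e) (pairopE (pairing_adj pairing_o)).
congr (_ + _); apply: eq_paircoord => n; first exact: (diagopE bounded_defectV).
by rewrite (diagopE bounded_alpha) (diagopE bounded_defectV).
Qed.

Lemma NadjE x k : Nadj x k = rec0 x k.
Proof.
transitivity (Co' (Ei x) k + Ce (A' (Ei x)) k) => //.
rewrite (pairopE pairing_e) (pairopE (pairing_adj pairing_o)).
congr (_ + _); apply: eq_paircoord => n; first exact: (diagopE bounded_defectV).
by rewrite (diagopE (bounded_seqJ bounded_alpha)) (diagopE bounded_defectV).
Qed.

(** Taking adjoints in U Q = N gives Q^dag V = N^dag, and Q^dag is injective because Q is onto. The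
    condition is local in the entries, and meaningful for sequences that are not square summable. *)
Lemma adjoint_U_char V x w : adjoints V U ->
  V x = w <-> forall k, rec0 x k = rec1 w k.
Proof.
move=> ad; have QV y : Qadj (V y) = Nadj y.
  apply: l2inner_inj => t.
  transitivity (l2inner y (U (Qop t))).
    by rewrite -ad; exact: adjoints_Q.
  have /(congr1 (fun g => l2inner y (g t))) := UQ.
  by move=> /= ->; rewrite adjoints_N.
have Qinj u v : Qadj u = Qadj v -> u = v.
  move=> e; apply: l2inner_inj => t; have [t' <-] := Q_surj t.
  by rewrite -(adjoints_Q u t') -(adjoints_Q v t') e.
split=> [<- k|h]; first by rewrite -QadjE QV NadjE.
by apply: Qinj; rewrite QV; apply: l2P => k;
  exact: etrans (NadjE x k) (etrans (h k) (esym (QadjE w k))).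
Qed.

Lemma block_off_neq0 g n : (forall n, cabs (g n : R[i]) < 1) -> block_off g n != 0.
Proof.
move=> h; rewrite block_offE//.
rewrite -(rmorph0 (real_complex R)) (inj_eq (@complexI R)) gt_eqF//.
by rewrite sqrtr_gt0 subr_gt0 exprn_ilt1 ?cabs_ge0.
Qed.

Lemma conjz_alpha_neq0 z n : cabs z = 1 -> 1 - z * alpha n != 0.
Proof.
move=> z1; rewrite subr_eq0; apply/eqP => e.
have := congr1 (@cabs R) e; rewrite cabs1 cabsM z1 mul1r => h.
by have := alpha_r n; rewrite -h leNgt r1.
Qed.

(** Equation k determines u_(k+1) from entries of index at most k. For odd k the new entry enters
    through [eflip], with factor conj(alpha_(k+1)) - z; for even k through [flip], with factor 1 - z
    alpha_(k+1). Neither vanishes when |z| = 1. *)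
Lemma rec_unique z u : cabs z = 1 -> u 0%N = 0 ->
  (forall k, rec0 u k = z * rec1 u k) -> forall n, u n = 0.
Proof.
move=> z1 u0 h.
have nz n : normalize u n = 0 -> u n = 0.
  rewrite /normalize => /eqP; rewrite mulf_eq0 => /orP[|/eqP//].
  rewrite -(rmorph0 (real_complex R)) (inj_eq (@complexI R)) invr_eq0.
  by rewrite gt_eqF ?defect_gt0.
have zn n : u n = 0 -> normalize u n = 0 by rewrite /normalize => ->; rewrite mulr0.
suff H n k : (k <= n)%N -> u k = 0 by move=> n; exact: (H n).
elim: n k => [|n IH] k; first by rewrite leqn0 => /eqP ->.
rewrite leq_eqVlt ltnS => /orP[/eqP ->|]; last exact: IH.
apply: nz; have := h n; rewrite /rec0 /rec1 /paircoord.
rewrite !(zn n (IH n (leqnn n))) !mulr0 !add0r.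
case: (boolP (odd n)) => on.
  have [m nm] : exists m, n = m.+1 by case: (n) on => // m _; exists m.
  have -> : eflip n = n.+1 by rewrite nm /= /flip; move: on; rewrite nm /= => /negbTE ->.
  have fn : (flip n <= n)%N by rewrite /flip on leq_pred.
  rewrite !(zn _ (IH _ fn)) !mulr0 add0r addr0 => /eqP.
  rewrite -subr_eq0 mulrCA [X in X - _]mulrCA [X in _ - X]mulrCA -mulrBr mulf_eq0 => /orP[|].
    by rewrite nm /= (negbTE (block_off_neq0 _ _))// => k'; exact: a1.
  rewrite -mulrBl mulf_eq0 => /orP[|/eqP//].
  rewrite subr_eq0 => /eqP e; have := alpha_r n.+1.
  by rewrite -cabsJ e z1 leNgt r1.
have -> : flip n = n.+1 by rewrite /flip (negbTE on).
have fn : (eflip n <= n)%N.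
  case: (n) on => [|m]//=; rewrite negbK => om.
  by rewrite /flip om; case: (m) om.
rewrite !(zn _ (IH _ fn)) !mulr0 addr0 add0r => /eqP.
rewrite -subr_eq0 [X in _ - X]mulrCA -mulrBr mulf_eq0 => /orP[|].
  by rewrite (negbTE (block_off_neq0 _ _))// => k'; exact: a1.
rewrite mulrA -[X in X - _]mul1r -mulrBl mulf_eq0 => /orP[|/eqP//].
by rewrite (negbTE (conjz_alpha_neq0 _ _)).
Qed.

End CMV.

(** * Values of rational functions *)

Local Notation "x %:F" := (tofrac x).

Section RationalValues.
Variable R : realType.
Implicit Types (f g : ratfun R) (p q : {poly R[i]}) (z w : R[i]).

Lemma ratfunE f : f = (repr f).1%:F / (repr f).2%:F.
Proof.
have h : f * (repr f).2%:F = (repr f).1%:F.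
  rewrite -{1}[f]reprK; unlock tofrac; rewrite -[LHS]FracField.pi_mul.
  apply/eqmodP; rewrite /= FracField.equivfE /FracField.mulf /=.
  rewrite !numden_Ratio ?oner_neq0 ?mulr1 ?mulf_neq0 ?oner_neq0 ?denom_ratioP//.
  by rewrite mulrC.
by rewrite -h mulfK// tofrac_eq0 denom_ratioP.
Qed.

Lemma rden_neq0 f : rden f != 0.
Proof.
have d0 := denom_ratioP (repr f).
apply/eqP => h; move: d0; have := divpK (dvdp_gcdr (repr f).1 (repr f).2).
by rewrite -/(rden f) h mul0r => <-; rewrite eqxx.
Qed.

Lemma rnum_rden f : f = (rnum f)%:F / (rden f)%:F.
Proof.
have g0 : gcdp (repr f).1 (repr f).2 != 0.
  by rewrite gcdp_eq0 negb_and denom_ratioP orbT.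
rewrite {1}[f]ratfunE -[in LHS](divpK (dvdp_gcdl (repr f).1 (repr f).2)).
rewrite -[X in _ / X%:F](divpK (dvdp_gcdr (repr f).1 (repr f).2)).
rewrite -/(rnum f) -/(rden f) !tofracM invfM mulrACA divff ?mulr1//.
by rewrite tofrac_eq0.
Qed.

Lemma coprime_rden_rnum f : coprimep (rden f) (rnum f).
Proof.
rewrite coprimep_sym /rnum /rden coprimep_div_gcd//.
by rewrite denom_ratioP orbT.
Qed.

(** [reval] goes through an arbitrary representative reduced by a gcd, which does not commute with
    the field operations. Any fraction with denominator nonzero at z serves here, so sums and
    products are immediate. *)
Definition has_value f z w := exists p q,
  [/\ q.[z] != 0, f = p%:F / q%:F & w = p.[z] / q.[z]].

Lemma poly_neq0 q z : q.[z] != 0 -> q != 0.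
Proof. by apply: contraNneq => ->; rewrite horner0. Qed.

Lemma has_valueP f z w : has_value f z w -> ~ is_pole f z /\ reval f z = w.
Proof.
case=> p [q [qz fE ->]].
have q0 := poly_neq0 qz.
have E : p * rden f = q * rnum f.
  apply/eqP; rewrite -tofrac_eq !tofracM [X in _ == X]mulrC -eqr_div ?tofrac_eq0//.
    by rewrite -rnum_rden fE.
  exact: rden_neq0.
(* By coprimality the reduced denominator divides q, hence does not vanish at z either. *)
have dq : rden f %| q.
  rewrite -(Gauss_dvdpl _ (coprime_rden_rnum f)) -E; exact: dvdp_mull.
have dz : (rden f).[z] != 0.
  apply: contraNneq qz => h; rewrite -(divpK dq) hornerM h mulr0 //.
split; first by rewrite /is_pole rootE (negbTE dz).
rewrite /reval; apply/eqP; rewrite eqr_div//.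
by have /(congr1 (fun p => p.[z])) := E; rewrite !hornerM => ->; rewrite mulrC.
Qed.

Lemma reval_has_value f z : ~ is_pole f z -> has_value f z (reval f z).
Proof.
move=> h; exists (rnum f), (rden f); split; first exact/negP.
  exact: rnum_rden.
by [].
Qed.

Lemma has_value_poly p z : has_value p%:F z p.[z].
Proof.
by exists p, 1; rewrite hornerC oner_neq0 tofrac1 !divr1.
Qed.

Lemma has_value_const c z : has_value (rconst c) z c.
Proof. by have := has_value_poly c%:P z; rewrite hornerC. Qed.

Lemma has_valueM f g z v w : has_value f z v -> has_value g z w ->
  has_value (f * g) z (v * w).
Proof.
case=> p [q [qz -> ->]] [p' [q' [qz' -> ->]]]; exists (p * p'), (q * q').
by rewrite !hornerM mulf_neq0// !tofracM !mulf_div.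
Qed.

Lemma has_valueD f g z v w : has_value f z v -> has_value g z w ->
  has_value (f + g) z (v + w).
Proof.
case=> p [q [qz -> ->]] [p' [q' [qz' -> ->]]]; exists (p * q' + p' * q), (q * q').
rewrite !(hornerM, hornerD) mulf_neq0// !(tofracM, tofracD) !addf_div//.
  by rewrite tofrac_eq0 (poly_neq0 qz).
by rewrite tofrac_eq0 (poly_neq0 qz').
Qed.

Lemma has_valueV f z v : has_value f z v -> v != 0 -> has_value f^-1 z v^-1.
Proof.
case=> p [q [qz -> ->]]; rewrite mulf_eq0 negb_or => /andP[pz _].
by exists q, p; rewrite !invf_div.
Qed.

Lemma has_value_uniq f z v w : has_value f z v -> has_value f z w -> v = w.
Proof. by move=> /has_valueP[_ <-] /has_valueP[_ <-]. Qed.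

Lemma rconstM (c d : R[i]) : rconst (c * d) = rconst c * rconst d.
Proof. by rewrite /rconst polyCM tofracM. Qed.
Lemma rconstD (c d : R[i]) : rconst (c + d) = rconst c + rconst d.
Proof. by rewrite /rconst polyCD tofracD. Qed.
Lemma rconstN (c : R[i]) : rconst (- c) = - rconst c.
Proof. by rewrite /rconst polyCN tofracN. Qed.
Lemma rconst1 : rconst (1 : R[i]) = 1.
Proof. by rewrite /rconst tofrac1. Qed.
Lemma rconst0 : rconst (0 : R[i]) = 0.
Proof. by rewrite /rconst tofrac0. Qed.
Lemma rconst_eq0 (c : R[i]) : (rconst c == 0) = (c == 0).
Proof. by rewrite /rconst tofrac_eq0 polyC_eq0. Qed.

(** Named in order to carry a ring morphism structure, from which [psub] inherits multiplicativity
    through [map_poly]. *)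
Definition rconj (c : R[i]) : ratfun R := rconst c^*.

HB.instance Definition _ := GRing.RMorphism.copy rconj
  (@tofrac {poly R[i]} \o @polyC R[i] \o @Num.conj R[i]).

Lemma psubE p : psub p = (map_poly rconj p).[('X%:F)^-1].
Proof. by []. Qed.

Lemma psubM p q : psub (p * q) = psub p * psub q.
Proof. by rewrite !psubE rmorphM hornerM. Qed.

Lemma psub_value p z : z != 0 -> has_value (psub p) z (p.[(z^-1)^*])^*.
Proof.
move=> z0; rewrite psubE; elim/poly_ind: p => [|p c IH].
  rewrite rmorph0 !horner0 conjC0 -rconst0; exact: has_value_const.
rewrite rmorphD rmorphM /= map_polyX map_polyC /= !hornerMXaddC rmorphD rmorphM /=.
rewrite conjCK; apply: has_valueD; last exact: has_value_const.
apply: has_valueM => //; apply: has_valueV => //.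
by have := has_value_poly 'X z; rewrite hornerX.
Qed.

(** Evaluating at 1/(k+1) would otherwise make every positive integer a root of p. *)
Lemma psub_neq0 p : p != 0 -> psub p != 0.
Proof.
move=> p0; apply/eqP => h.
have rt (k : nat) : root p (k.+1%:R).
  have k0 : (k.+1%:R : R[i])^-1 != 0 by rewrite invr_eq0 pnatr_eq0.
  have := psub_value p k0; rewrite h invrK conjC_nat -rconst0 => v.
  have := has_value_uniq v (has_value_const 0 _) => /(congr1 (@Num.conj _)).
  by rewrite conjCK conjC0 => /eqP.
pose rs := [seq (k.+1%:R : R[i]) | k <- iota 0 (size p)].
have := @max_poly_roots _ p rs p0; rewrite size_map size_iota ltnn.
have -> : all (root p) rs by apply/allP => _ /mapP[k _ ->].
rewrite map_inj_uniq ?iota_uniq; first by move=> /(_ isT isT).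
by move=> k l /eqP; rewrite eqr_nat => /eqP[].
Qed.

(** [rsub] is defined on the representative chosen by [repr]; cross multiplication frees it from
    that choice. *)
Lemma rsub_frac p q : q != 0 -> rsub (p%:F / q%:F) = psub p / psub q.
Proof.
move=> q0; rewrite /rsub; set f := p%:F / q%:F.
have d0 : (repr f).2 != 0 by exact: denom_ratioP.
apply/eqP; rewrite eqr_div ?psub_neq0//; apply/eqP.
rewrite -!psubM; congr psub; apply/eqP; rewrite -tofrac_eq !tofracM.
by rewrite -eqr_div ?tofrac_eq0// -ratfunE.
Qed.

Lemma rsubM f g : rsub (f * g) = rsub f * rsub g.
Proof.
rewrite [f in LHS]ratfunE [g in LHS]ratfunE mulf_div -!tofracM.
rewrite rsub_frac ?mulf_neq0 ?denom_ratioP// !psubM -mulf_div.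
by [].
Qed.

Lemma rsub1 : rsub (1 : ratfun R) = 1.
Proof.
rewrite -[X in rsub X](_ : 1%:F / 1%:F = 1); last by rewrite tofrac1 divr1.
by rewrite rsub_frac ?oner_neq0// divff// psub_neq0// oner_neq0.
Qed.

End RationalValues.

(** * Integrals on the circle *)

Section CircleIntegrals.
Variable R : realType.
Implicit Types (f g h : R[i] -> R[i]) (z : R[i]).

Lemma open_measurableC (A : set R[i]) : open A -> measurable (A : set (borelC R)).
Proof. exact: sub_sigma_algebra. Qed.

Lemma nbhs_cball z (e : R) : 0 < e -> nbhs z [set w | cabs (z - w) < e].
Proof.
move=> e0; apply/nbhs_ballP; exists (e%:C)%C; first by rewrite /= ltcR.
by move=> w; rewrite /ball /= cabsE ltcR.
Qed.

Lemma openC_P (A : set R[i]) : open A <->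
  forall z, A z -> exists2 e : R, 0 < e & forall w, cabs (z - w) < e -> A w.
Proof.
split=> [oA z Az|h].
  have /nbhs_ballP[e e0 he] : nbhs z A by exact: open_nbhs_nbhs.
  move: e e0 he => [e i]; rewrite /= ltcE /= => /andP[/eqP -> e0] he.
  by exists e => // w zw; apply: he; rewrite /ball /= cabsE ltcR.
rewrite openE => z Az; have [e e0 he] := h z Az.
by rewrite /interior; apply: filterS (nbhs_cball z e0) => w; exact: he.
Qed.

Lemma measurable_real_lipschitz (p : R[i] -> R) :
  (forall z w, `|p z - p w| <= cabs (z - w)) ->
  measurable_fun setT (p : borelC R -> R).
Proof.
move=> hp; apply: (measurability _ (RGenOpens.measurableE R)).
move=> _ [_ [a [b ->] <-]]; rewrite setTI; apply: open_measurableC.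
apply/openC_P => z /=; rewrite in_itv /= => /andP[az zb].
exists (Num.min (p z - a) (b - p z)).
  by rewrite lt_min !subr_gt0 az.
move=> w; rewrite lt_min => /andP[h1 h2]; rewrite in_itv /=.
by have := hp z w; rewrite ler_norml => /andP[h3 h4]; apply/andP; split; lra.
Qed.

Lemma measurable_Re : measurable_fun setT (@complex.Re R : borelC R -> R).
Proof.
by apply: measurable_real_lipschitz => z w; rewrite -ReN -ReD; exact: ler_Re_cabs.
Qed.

Lemma measurable_Im : measurable_fun setT (@complex.Im R : borelC R -> R).
Proof.
by apply: measurable_real_lipschitz => z w; rewrite -ImN -ImD; exact: ler_Im_cabs.
Qed.

Definition cmeasurable f :=
  measurable_fun setT (fun z : borelC R => complex.Re (f z)) /\
  measurable_fun setT (fun z : borelC R => complex.Im (f z)).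

Lemma cmeasurable_id : cmeasurable id.
Proof. by split; [exact: measurable_Re|exact: measurable_Im]. Qed.

Lemma cmeasurable_cst c : cmeasurable (fun=> c).
Proof. by split; exact: measurable_cst. Qed.

Lemma cmeasurableD f g : cmeasurable f -> cmeasurable g ->
  cmeasurable (fun z => f z + g z).
Proof.
move=> [f1 f2] [g1 g2]; split.
  by under eq_fun do rewrite ReD; exact: measurable_funD.
by under eq_fun do rewrite ImD; exact: measurable_funD.
Qed.

Lemma cmeasurableM f g : cmeasurable f -> cmeasurable g ->
  cmeasurable (fun z => f z * g z).
Proof.
move=> [f1 f2] [g1 g2]; split.
  under eq_fun do rewrite ReM.
  by apply: measurable_funB; exact: measurable_funM.
under eq_fun do rewrite ImM.
by apply: measurable_funD; exact: measurable_funM.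
Qed.

Lemma cmeasurableJ f : cmeasurable f -> cmeasurable (fun z => (f z)^*).
Proof.
move=> [f1 f2]; split; first by under eq_fun do rewrite ReJ.
under eq_fun do rewrite ImJ.
exact: (measurableT_comp (@oppr_measurable R setT) f2).
Qed.

Lemma cmeasurable_real (p : R[i] -> R) :
  measurable_fun setT (p : borelC R -> R) -> cmeasurable (fun z => ((p z)%:C)%C).
Proof. by move=> mp; split => //=; exact: measurable_cst. Qed.

Lemma measurable_cabs2 f : cmeasurable f ->
  measurable_fun setT (fun z : borelC R => cabs (f z) ^+ 2).
Proof.
move=> [f1 f2]; under eq_fun do rewrite cabs2E.
by apply: measurable_funD; exact: measurable_funX.
Qed.

Lemma invC_conj z : z^-1 = (((cabs z ^+ 2)^-1%:C)%C) * z^*.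
Proof.
have [->|z0] := eqVneq z 0; first by rewrite invr0 conjC0 mulr0.
apply: (mulfI z0); rewrite divff// mulrCA mulC_conj -rmorphM /= mulVf ?rmorph1//.
by rewrite expf_eq0 /= cabs_eq0.
Qed.

Lemma cmeasurableV f : cmeasurable f -> cmeasurable (fun z => (f z)^-1).
Proof.
move=> mf; under eq_fun do rewrite invC_conj.
apply: cmeasurableM; last exact: cmeasurableJ.
apply: cmeasurable_real.
(* The real inverse is measurable as a power with exponent -1, which agrees with it at 0 too. *)
rewrite (_ : (fun z => _) = (@powR R ^~ (-1)) \o (fun z => cabs (f z) ^+ 2)).
  by apply: measurableT_comp; [exact: measurable_powR|exact: measurable_cabs2].
by apply/funext => z /=; rewrite powR_inv1// sqr_ge0.
Qed.

Lemma cmeasurable_poly (p : {poly R[i]}) : cmeasurable (fun z => p.[z]).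
Proof.
elim/poly_ind: p => [|p c IH].
  by under eq_fun do rewrite horner0; exact: cmeasurable_cst.
under eq_fun do rewrite hornerMXaddC.
apply: cmeasurableD; last exact: cmeasurable_cst.
by apply: cmeasurableM => //; exact: cmeasurable_id.
Qed.

Lemma measurable_circle : measurable (@circle R : set (borelC R)).
Proof.
rewrite (_ : @circle R = ((fun z : borelC R => cabs (z : R[i]) ^+ 2) @^-1` [set 1])).
  rewrite -[X in measurable X]setTI; apply: measurable_cabs2 => //.
  exact: cmeasurable_id.
apply/seteqP; split => z; rewrite /circle /= cabsE.
  by move=> [->]; rewrite expr1n.
move=> h; congr ((_)%:C)%C; apply/eqP.
by rewrite -(@eqrXn2 _ 2) ?cabs_ge0// h expr1n.
Qed.

Lemma circleP z : circle z <-> cabs z = 1.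
Proof.
by rewrite /circle /= cabsE; split => [[]|->].
Qed.

(** Integrals run over the circle only, and the rational functions integrated are unbounded near
    their poles, which lie off it. *)
Definition bounded_on_circle f :=
  exists M : R, forall z, cabs z = 1 -> cabs (f z) <= M.

Definition admissible f := cmeasurable f /\ bounded_on_circle f.

Lemma bounded_circle_poly (p : {poly R[i]}) : bounded_on_circle (fun z => p.[z]).
Proof.
elim/poly_ind: p => [|p c [M IH]].
  by exists 0 => z _; rewrite horner0 cabs0.
exists (M + cabs c) => z z1; rewrite hornerMXaddC (le_trans (cabsD _ _))//.
by rewrite cabsM z1 mulr1 lerD// IH.
Qed.

Lemma admissible_poly (p : {poly R[i]}) : admissible (fun z => p.[z]).
Proof. by split; [exact: cmeasurable_poly|exact: bounded_circle_poly]. Qed.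

Lemma admissible_id : admissible id.
Proof. by split; [exact: cmeasurable_id|exists 1 => z ->]. Qed.

Lemma admissible_cst c : admissible (fun=> c).
Proof. by split; [exact: cmeasurable_cst|exists (cabs c)]. Qed.

Lemma admissibleD f g : admissible f -> admissible g ->
  admissible (fun z => f z + g z).
Proof.
move=> [mf [M bf]] [mg [N bg]]; split; first exact: cmeasurableD.
exists (M + N) => z z1; rewrite (le_trans (cabsD _ _))// lerD ?bf ?bg//.
Qed.

Lemma admissibleM f g : admissible f -> admissible g ->
  admissible (fun z => f z * g z).
Proof.
move=> [mf [M bf]] [mg [N bg]]; split; first exact: cmeasurableM.
exists (M * N) => z z1.
by rewrite cabsM ler_pM ?cabs_ge0 ?bf ?bg.
Qed.

Lemma admissibleJ f : admissible f -> admissible (fun z => (f z)^*).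
Proof.
move=> [mf [M bf]]; split; first exact: cmeasurableJ.
by exists M => z z1; rewrite cabsJ bf.
Qed.

Lemma admissibleB f g : admissible f -> admissible g ->
  admissible (fun z => f z - g z).
Proof.
move=> hf hg; under eq_fun do rewrite -mulN1r.
by apply: admissibleD => //; apply: admissibleM => //; exact: admissible_cst.
Qed.

Lemma admissible_sum (n : nat) (F : nat -> R[i] -> R[i]) :
  (forall k, admissible (F k)) -> admissible (fun z => \sum_(k < n) F k z).
Proof.
move=> h; elim: n => [|n IH].
  by under eq_fun do rewrite big_ord0; exact: admissible_cst.
by under eq_fun do rewrite big_ord_recr /=; exact: admissibleD.
Qed.

Section FiniteMeasure.
Variable m : {finite_measure set (borelC R) -> \bar R}.
Notation cint := (cintegral m (@circle R)).

Lemma eq_cint f g : (forall z, cabs z = 1 -> f z = g z) -> cint f = cint g.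
Proof.
move=> h; rewrite /cintegral; congr Complex; congr fine.
  by apply: eq_integral => z /set_mem /circleP z1; rewrite (h z z1).
by apply: eq_integral => z /set_mem /circleP z1; rewrite (h z z1).
Qed.

Lemma circle_fin : (m (@circle R) < +oo)%E.
Proof.
by rewrite ltey_eq fin_num_measure//; exact: measurable_circle.
Qed.

Lemma integrable_circle (p : R[i] -> R) (M : R) :
  measurable_fun setT (p : borelC R -> R) ->
  (forall z, cabs z = 1 -> `|p z| <= M) ->
  m.-integrable (@circle R) (EFin \o p).
Proof.
move=> mp hM; apply: measurable_bounded_integrable.
- exact: measurable_circle.
- exact: circle_fin.
- exact: measurable_funTS.
exists M; split; first exact: num_real.
by move=> N MN z /circleP z1 /=; apply: (le_trans (hM z z1)); exact: ltW.
Qed.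

Lemma admissible_Re f : admissible f ->
  m.-integrable (@circle R) (EFin \o (fun z => complex.Re (f z))).
Proof.
move=> [[f1 _] [M hM]]; apply: (integrable_circle f1 (M := M)) => z z1.
exact: le_trans (ler_Re_cabs _) (hM z z1).
Qed.

Lemma admissible_Im f : admissible f ->
  m.-integrable (@circle R) (EFin \o (fun z => complex.Im (f z))).
Proof.
move=> [[_ f2] [M hM]]; apply: (integrable_circle f2 (M := M)) => z z1.
exact: le_trans (ler_Im_cabs _) (hM z z1).
Qed.

Lemma Re_cint f : complex.Re (cint f) =
  \int[m]_(z in @circle R) complex.Re (f z).
Proof. by []. Qed.
Lemma Im_cint f : complex.Im (cint f) =
  \int[m]_(z in @circle R) complex.Im (f z).
Proof. by []. Qed.

Lemma cintD f g : admissible f -> admissible g ->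
  cint (fun z => f z + g z) = cint f + cint g.
Proof.
move=> hf hg; apply: complex_ext; rewrite ?ReD ?ImD ?Re_cint ?Im_cint.
  under eq_Rintegral do rewrite ReD.
  rewrite RintegralD//; [exact: measurable_circle|exact: admissible_Re|exact: admissible_Re].
under eq_Rintegral do rewrite ImD.
rewrite RintegralD//; [exact: measurable_circle|exact: admissible_Im|exact: admissible_Im].
Qed.

Lemma cintZ c f : admissible f -> cint (fun z => c * f z) = c * cint f.
Proof.
move=> hf; have mc := measurable_circle.
have i1 := admissible_Re hf; have i2 := admissible_Im hf.
have z1 k : m.-integrable (@circle R) (EFin \o (fun z => k * complex.Re (f z))).
  exact: (integrableZl mc k i1).
have z2 k : m.-integrable (@circle R) (EFin \o (fun z => k * complex.Im (f z))).
  exact: (integrableZl mc k i2).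
apply: complex_ext; rewrite ?ReM ?ImM ?Re_cint ?Im_cint.
  under eq_Rintegral do rewrite ReM.
  by rewrite RintegralB// !RintegralZl.
under eq_Rintegral do rewrite ImM.
by rewrite RintegralD// !RintegralZl.
Qed.

Lemma cintB f g : admissible f -> admissible g ->
  cint (fun z => f z - g z) = cint f - cint g.
Proof.
move=> hf hg; under [in LHS]eq_fun do rewrite -mulN1r.
rewrite cintD//; first by rewrite cintZ// mulN1r.
by apply: admissibleM => //; exact: admissible_cst.
Qed.

Lemma cintJ f : admissible f -> cint (fun z => (f z)^*) = (cint f)^*.
Proof.
move=> hf; apply: complex_ext; rewrite ?ReJ ?ImJ ?Re_cint ?Im_cint.
  by under eq_Rintegral do rewrite ReJ.
under eq_Rintegral do rewrite ImJ -mulN1r.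
by rewrite RintegralZl ?mulN1r//; [exact: measurable_circle|exact: admissible_Im].
Qed.

Lemma cint0 : cint (fun=> 0) = 0.
Proof.
transitivity (0 * cint (fun=> 0)); last by rewrite mul0r.
rewrite -cintZ; last exact: admissible_cst.
by apply: eq_cint => z _; rewrite mul0r.
Qed.

Lemma cint_sum (n : nat) (F : nat -> R[i] -> R[i]) :
  (forall k, admissible (F k)) ->
  cint (fun z => \sum_(k < n) F k z) = \sum_(k < n) cint (F k).
Proof.
move=> h; elim: n => [|n IH].
  under [in LHS]eq_fun do rewrite big_ord0.
  by rewrite big_ord0 cint0.
under [in LHS]eq_fun do rewrite big_ord_recr /=.
rewrite cintD ?IH ?big_ord_recr//; exact: admissible_sum.
Qed.

Lemma cint_le (f g : R[i] -> R[i]) : admissible f -> admissible g ->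
  (forall z, cabs z = 1 -> complex.Re (f z) <= complex.Re (g z)) ->
  complex.Re (cint f) <= complex.Re (cint g).
Proof.
move=> hf hg h; rewrite !Re_cint; apply: le_Rintegral.
- exact: measurable_circle.
- exact: admissible_Re.
- exact: admissible_Re.
- by move=> z /circleP; exact: h.
Qed.

Lemma cint_cst (c : R) : m (@circle R) = 1%E ->
  complex.Re (cint (fun=> (c%:C)%C)) = c.
Proof.
move=> m1; rewrite Re_cint Rintegral_cst; last exact: measurable_circle.
by rewrite (congr1 fine m1) mulr1.
Qed.

Lemma cvg_cint (F : nat -> R[i] -> R[i]) f (M : R) :
  (forall n, cmeasurable (F n)) -> cmeasurable f ->
  (forall n z, cabs z = 1 -> cabs (F n z) <= M) ->
  (forall z, cabs z = 1 -> F n z @[n --> \oo] --> f z) ->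
  cint (F n) @[n --> \oo] --> cint f.
Proof.
move=> mF mf hM hF.
have key (p : R[i] -> R) : (forall z, `|p z| <= cabs z) ->
    (forall z, cabs z = 1 -> p (F n z) @[n --> \oo] --> p (f z)) ->
    (forall n, measurable_fun setT (fun z : borelC R => p (F n z))) ->
    measurable_fun setT (fun z : borelC R => p (f z)) ->
    \int[m]_(z in @circle R) p (F n z) @[n --> \oo] -->
    \int[m]_(z in @circle R) p (f z).
  move=> pc cp mpF mpf.
  have ip n : m.-integrable (@circle R) (EFin \o (fun z => p (F n z))).
    apply: (integrable_circle (mpF n) (M := M)) => z z1.
    exact: le_trans (pc _) (hM n z z1).
  have [|||||i _ h] := @dominated_convergence _ _ _ m (@circle R) measurable_circle
    (fun n z => (p (F n z))%:E) (fun z => (p (f z))%:E) (cst M%:E).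
  - by move=> n; apply/measurable_EFinP; exact: measurable_funTS.
  - by apply/measurable_EFinP; exact: measurable_funTS.
  - apply: aeW => z /circleP z1; apply: cvg_EFin; first exact: nearW.
    exact: cp.
  - have := @integrable_circle (cst M) `|M|; apply => // z _.
  - by apply: aeW => z n /circleP z1; rewrite lee_fin (le_trans (pc _))// hM.
  apply: fine_cvg; rewrite fineK; first exact: h.
  by apply: integrable_fin_num => //; exact: measurable_circle.
apply/cvg_ReImP; split.
  apply: (key (@complex.Re R)).
  - exact: ler_Re_cabs.
  - by move=> z /hF /cvg_ReImP[].
  - by move=> n; have [] := mF n.
  - by have [] := mf.
apply: (key (@complex.Im R)).
- exact: ler_Im_cabs.
- by move=> z /hF /cvg_ReImP[].
- by move=> n; have [] := mF n.
- by have [] := mf.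
Qed.

End FiniteMeasure.
End CircleIntegrals.

(** * Functions represented by their coefficient sequences *)

Section Representation.
Variable R : realType.
Variable m : {finite_measure set (borelC R) -> \bar R}.
Notation cint := (cintegral m (@circle R)).
Implicit Types (f g h : R[i] -> R[i]) (z : R[i]) (v w x : l2 R).

Definition ip f g := cint (fun z => (f z)^* * g z).
Definition nsq f := complex.Re (ip f f).

Lemma admissible_ip f g : admissible f -> admissible g ->
  admissible (fun z => (f z)^* * g z).
Proof. by move=> hf hg; apply: admissibleM => //; exact: admissibleJ. Qed.

Lemma admissible_cabs2 f : admissible f ->
  admissible (fun z => ((cabs (f z) ^+ 2)%:C)%C).
Proof.
move=> hf; have := admissible_ip hf hf; congr admissible; apply/funext => z.
exact: conjM_cabs.
Qed.

Lemma eq_ip f f' g g' : (forall z, cabs z = 1 -> f z = f' z) ->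
  (forall z, cabs z = 1 -> g z = g' z) -> ip f g = ip f' g'.
Proof. by move=> h k; apply: eq_cint => z z1; rewrite h// k. Qed.

Lemma ip_addr f g h c : admissible f -> admissible g -> admissible h ->
  ip f (fun z => g z + c * h z) = ip f g + c * ip f h.
Proof.
move=> hf hg hh.
transitivity (cint (fun z => (f z)^* * g z + c * ((f z)^* * h z))).
  by apply: eq_cint => z _; rewrite mulrDr mulrCA.
rewrite cintD ?cintZ//; do ?exact: admissible_ip.
by apply: admissibleM; [exact: admissible_cst|exact: admissible_ip].
Qed.

Lemma ipC f g : admissible f -> admissible g -> ip g f = (ip f g)^*.
Proof.
move=> hf hg; rewrite /ip -cintJ; last exact: admissible_ip.
by apply: eq_cint => z _; rewrite [RHS]rmorphM /= conjCK mulrC.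
Qed.

Lemma nsqE f : nsq f = complex.Re (cint (fun z => ((cabs (f z) ^+ 2)%:C)%C)).
Proof. by congr complex.Re; apply: eq_cint => z _; rewrite conjM_cabs. Qed.

Lemma nsq_ge0 f : 0 <= nsq f.
Proof.
by rewrite nsqE Re_cint; apply: Rintegral_ge0 => z _; exact: sqr_ge0.
Qed.

Lemma ip_self f : ip f f = ((nsq f)%:C)%C.
Proof.
apply: complex_ext; first by [].
rewrite /ip Im_cint; under eq_Rintegral do rewrite conjM_cabs.
by rewrite Rintegral_cst ?mul0r//; exact: measurable_circle.
Qed.

Lemma admissible_add f g c : admissible f -> admissible g ->
  admissible (fun z => f z + c * g z).
Proof.
move=> hf hg; apply: admissibleD => //; apply: admissibleM => //.
exact: admissible_cst.
Qed.

Lemma quad_expand (p q : R) (c t : R[i]) :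
  ((p%:C)%C + c * t)^* + c * (t^* + c * (q%:C)%C)^* =
  ((p + cabs c ^+ 2 * q + 2 * complex.Re (c * t))%:C)%C.
Proof.
rewrite cabs2E; case: c => c1 c2; case: t => t1 t2.
by apply: complex_ext => /=; ring.
Qed.

Lemma nsq_add f g c : admissible f -> admissible g ->
  nsq (fun z => f z + c * g z) =
  nsq f + cabs c ^+ 2 * nsq g + 2 * complex.Re (c * ip f g).
Proof.
move=> hf hg; have hs := admissible_add c hf hg; apply: complexI.
rewrite -ip_self ip_addr// (ipC hf hs) ip_addr// (ipC hg hs) ip_addr//.
by rewrite (ipC hf hg) ip_self (ip_self g) quad_expand.
Qed.

Variable chi : nat -> R[i] -> R[i].
Hypothesis chi_adm : forall n, admissible (chi n).
Hypothesis chi_on : forall i j, ip (chi i) (chi j) = (i == j)%:R.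

Lemma bessel f : admissible f -> forall N,
  \sum_(k < N) cabs (ip (chi k) f) ^+ 2 <= nsq f.
Proof.
(* The induction carries the residual of f after N projections, with its norm and its remaining
   coefficients. *)
move=> hf; suff H N : exists g, [/\ admissible g,
    nsq g = nsq f - \sum_(k < N) cabs (ip (chi k) f) ^+ 2 &
    forall j, ip (chi j) g = if (j < N)%N then 0 else ip (chi j) f].
  move=> N; have [g [_ e _]] := H N; rewrite -subr_ge0 -e; exact: nsq_ge0.
elim: N => [|N [g [hg e k]]].
  by exists f; split => //; rewrite big_ord0 subr0.
pose c := - ip (chi N) f.
exists (fun z => g z + c * chi N z); split.
- exact: admissible_add.
- rewrite (nsq_add c hg (chi_adm N)) e big_ord_recr (ipC (chi_adm N) hg) k ltnn.
  have -> : nsq (chi N) = 1 by rewrite /nsq chi_on eqxx.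
  by rewrite cabsN mulr1 /c mulNr mulC_conj ReN /=; ring.
- move=> j; rewrite ip_addr// k chi_on ltnS; case: ltngtP => [jN|jN|->].
  + by rewrite mulr0 addr0.
  + by rewrite mulr0 addr0.
  + by rewrite mulr1 subrr.
Qed.

(** The graph of the coefficient map on the closed span of the chi_n: equality of norms says that g
    has no component orthogonal to all of them. *)
Definition represents g v :=
  [/\ admissible g, forall n, ip (chi n) g = v n & nsq g = l2norm v ^+ 2].

Lemma represents_chi n : represents (chi n) (l2e R n).
Proof.
split => //; by rewrite l2norm_e /nsq chi_on eqxx expr1n.
Qed.

(* Bessel's inequality for h + c g with c in {1, -1, i, -i}. *)
Lemma represents_ip g h v w : represents g v -> represents h w ->
  ip g h = l2inner v w.
Proof.
move=> [hg eg ng] [hh eh nh].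
have key c : complex.Re (c * l2inner v w) <= complex.Re (c * ip g h).
  have : l2norm (v + c *: w) ^+ 2 <= nsq (fun z => g z + c * h z).
    have hs := admissible_add c hg hh.
    rewrite -(sqr_sqrtr (nsq_ge0 _)) ler_pXn2r ?nnegrE ?l2norm_ge0 ?sqrtr_ge0//.
    apply: l2norm_le; first exact: sqrtr_ge0.
    move=> N; rewrite sqr_sqrtr ?nsq_ge0//; apply: le_trans (bessel hs N).
    by apply: ler_sum => k _; rewrite ip_addr// eg eh.
  by rewrite nsq_add// l2normD_sqr l2normZ exprMn l2innerZr ng nh; lra.
move: (ip g h) (l2inner v w) key => [t1 t2] [s1 s2] key.
have := key 1; have := key (-1); have := key ('i)%C; have := key (- ('i)%C).
by rewrite /= => h1 h2 h3 h4; apply: complex_ext => /=; lra.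
Qed.

Lemma represents_add g h v w c : represents g v -> represents h w ->
  represents (fun z => g z + c * h z) (v + c *: w).
Proof.
move=> rg rh; have e := represents_ip rg rh.
move: rg rh => [hg eg ng] [hh eh nh]; split.
- exact: admissible_add.
- by move=> n; rewrite ip_addr// eg eh.
- by rewrite nsq_add// l2normD_sqr l2normZ exprMn l2innerZr ng nh e.
Qed.

Variables (U V : l2 R -> l2 R).
Hypothesis U_iso : forall x, l2norm (U x) = l2norm x.
Hypothesis UV : forall x, U (V x) = x.
Hypothesis VU_adj : adjoints V U.
Hypothesis V_chi : forall i n, V (l2e R i) n = ip (chi n) (fun z => z^* * chi i z).

Lemma nsq_unimodular f g : (forall z, cabs z = 1 -> cabs (f z) = cabs (g z)) ->
  nsq f = nsq g.
Proof.
by move=> h; rewrite !nsqE; congr complex.Re; apply: eq_cint => z z1; rewrite h.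
Qed.

(** V e_i represents conj(z) chi_i, both having norm 1. The coefficients of z g follow by moving U
    across the inner product: <e_n, U v> = <V e_n, v>, which is the inner product of conj(z) chi_n
    with g. *)
Lemma represents_U g v : represents g v -> represents (fun z => z * g z) (U v).
Proof.
move=> rg; have [hg eg ng] := rg.
have rc i : represents (fun z => z^* * chi i z) (V (l2e R i)).
  split.
  - by apply: admissibleM => //; exact/admissibleJ/admissible_id.
  - by move=> n; rewrite V_chi.
  - rewrite (@nsq_unimodular _ (chi i)) => [|z z1].
      by rewrite -U_iso UV l2norm_e /nsq chi_on eqxx expr1n.
    by rewrite cabsM cabsJ z1 mul1r.
split.
- by apply: admissibleM => //; exact: admissible_id.
- move=> n; rewrite -l2inner_e -VU_adj -(represents_ip (rc n) rg).
  by apply: eq_cint => z _; rewrite rmorphM /= conjCK mulrA [z * _]mulrC.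
- rewrite U_iso -ng; apply: nsq_unimodular => z z1.
  by rewrite cabsM z1 mul1r.
Qed.

(** Monic polynomials in U, and in z below, are given by their lists of roots; over the complex
    numbers nothing is lost. *)
Definition opfac (s : seq R[i]) x := foldr (fun c y => U y - c *: y) x s.
Definition polyfac (s : seq R[i]) z := \prod_(c <- s) (z - c).

Lemma represents_fac s g v : represents g v ->
  represents (fun z => polyfac s z * g z) (opfac s v).
Proof.
move=> rg; elim: s => [|c s IH].
  have -> // : (fun z => polyfac [::] z * g z) = g.
  by apply/funext => z; rewrite /polyfac big_nil mul1r.
rewrite /= -scaleNr; have := represents_add (- c) (represents_U IH) IH.
congr represents; apply/funext => z.
by rewrite /polyfac big_cons mulNr -mulrBl mulrA.
Qed.

End Representation.

(** * The recurrence of orthogonal rational functions *)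

Section FieldIdentities.
Variable K : fieldType.
Implicit Types x s y v w p q c b : K.

Lemma recF_identity x s y v v' w p q c : v != 0 -> v' != 0 ->
  x * (s * v * (y * (v' / v) * (w / v' * p + c * q))) =
  x * s * y * w * p + c * (x * s * y * v' * q).
Proof. by move=> v0 v'0; field; rewrite v0 v'0. Qed.

Lemma recFs_identity x s y v v' w p q c : v != 0 -> v' != 0 ->
  x * (s * v * (y * (v' / v) * (c * (w / v' * p) + q))) =
  c * (x * s * y * w * p) + x * s * y * v' * q.
Proof. by move=> v0 v'0; field; rewrite v0 v'0. Qed.

Lemma mul_quotient s w b v p : w != 0 ->
  s * w * (b * (v / w) * p) = b * (s * v * p).
Proof. by move=> w0; field. Qed.

Lemma reflected_quotient x b c : x != 0 -> x - c != 0 ->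
  (x^-1 - b) / (1 - c * x^-1) = (1 - b * x) / (x - c).
Proof.
move=> x0 xc0.
have -> : x^-1 - b = (1 - b * x) / x by field.
have -> : 1 - c * x^-1 = (x - c) / x by field.
by rewrite invf_div mulrA divfK.
Qed.

(** With x = a_n, c = conj(a_n) and p = rho_n, the first two relations say that Theta_n maps (S, F)
    to (G, S'), the last two that Theta_n^dag maps back. The transfer form of the recurrence becomes
    a unitary one. *)
Lemma theta_relations x c p G S F S' :
  p != 0 -> p ^+ 2 = 1 - x * c -> p * F = G + x * S -> p * S' = c * G + S ->
  [/\ - x * S + p * F = G, p * S + c * F = S',
      - c * G + p * S' = S & x * S' + p * G = F].
Proof.
move=> p0 pp pF pS; split; [by rewrite pF; ring| |by rewrite pS; ring|];
  apply: (mulfI p0).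
- rewrite pS mulrDr mulrA -expr2 pp mulrCA pF; ring.
- rewrite pF mulrDr mulrCA pS mulrA -expr2 pp; ring.
Qed.

End FieldIdentities.

Section OrthogonalRationalFunctions.
Variables (R : realType) (alpha a : nat -> R[i]) (phi : nat -> ratfun R) (r : R).
Hypothesis alpha_r : forall n, cabs (alpha n) <= r.
Hypothesis r1 : r < 1.
Hypothesis a1 : forall n, (0 < n)%N -> cabs (a n) < 1.
Hypothesis phi_0 : phi 0%N = 1.
Hypothesis phi_rec : forall n, (0 < n)%N ->
  phi n = rconst (ecoef alpha a n) * ((varpi alpha n.-1)%:F / (varpi alpha n)%:F)
    * (zeta alpha n.-1 * phi n.-1 + rconst (a n) * superstar alpha phi n.-1).
Hypothesis phi_rec_star : forall n, (0 < n)%N ->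
  superstar alpha phi n =
    rconst (ecoef alpha a n) * ((varpi alpha n.-1)%:F / (varpi alpha n)%:F)
    * (rconst (a n)^* * (zeta alpha n.-1 * phi n.-1) + superstar alpha phi n.-1).

Notation sst := (superstar alpha phi).
Notation chi := (chi_of alpha phi).
Notation sd := (defect alpha).
Notation vp n := (varpi alpha n).
Notation ws n := (varpistar alpha n).

Lemma horner_varpi n z : (vp n).[z] = 1 - (alpha n)^* * z.
Proof. by rewrite /varpi hornerD hornerN hornerZ hornerX hornerC. Qed.

Lemma horner_varpistar n z : (ws n).[z] = z - alpha n.
Proof. by rewrite /varpistar hornerXsubC. Qed.

Lemma varpi_neq0 n : (vp n)%:F != 0.
Proof.
rewrite tofrac_eq0; apply: (@poly_neq0 _ _ 0).
by rewrite horner_varpi mulr0 subr0 oner_neq0.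
Qed.

Lemma varpistar_neq0 n : (ws n)%:F != 0.
Proof. by rewrite tofrac_eq0 polyXsubC_eq0. Qed.

Lemma sst_0 : sst 0%N = 1.
Proof. by rewrite /superstar /Blaschke big_geq// mul1r phi_0 rsub1. Qed.

Definition rhoR n := Num.sqrt (1 - cabs (a n) ^+ 2).

Lemma rhoR_sqr n : (0 < n)%N -> rhoR n ^+ 2 = 1 - cabs (a n) ^+ 2.
Proof.
by move=> n0; rewrite sqr_sqrtr// subr_ge0 exprn_ile1 ?cabs_ge0// ltW// a1.
Qed.

Lemma rhoR_gt0 n : (0 < n)%N -> 0 < rhoR n.
Proof. by move=> n0; rewrite sqrtr_gt0 subr_gt0 exprn_ilt1 ?cabs_ge0 ?a1. Qed.

Lemma rhoE n : (0 < n)%N -> rho a n = ((rhoR n)%:C)%C.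
Proof.
move=> n0; rewrite /rho cabsE -rmorphXn -(rmorph1 (real_complex R)) -rmorphB /=.
by rewrite sqrtC_real// -rhoR_sqr// sqr_ge0.
Qed.

Lemma ecoefE n : (0 < n)%N ->
  ecoef alpha a n = ((sd n / sd n.-1 / rhoR n)%:C)%C.
Proof.
move=> n0; have sE k : (vp k).[alpha k] = ((sd k ^+ 2)%:C)%C.
  by rewrite horner_varpi conjM_cabs (defect_sqr alpha_r r1) rmorphB rmorph1.
rewrite /ecoef !sE cabsE -rmorphXn -(rmorph1 (real_complex R)) -rmorphB /=.
rewrite -rhoR_sqr// -!fmorphV -!rmorphM /= -!exprVn -!exprMn rmorphXn /=.
rewrite sqrCK// lecR !mulr_ge0 ?invr_ge0//; try exact/ltW/(defect_gt0 alpha_r r1).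
exact/ltW/rhoR_gt0.
Qed.

(** Scaling phi_n and its superstar by varpi_n / eta_n, or by varpistar_n / eta_n, absorbs e_n and
    the quotients of varpi in the recurrence, so that only a_n and rho_n remain. *)
Definition si n : ratfun R := rconst (((sd n)^-1%:C)%C).
Definition orfF n := si n * (vp n)%:F * phi n.
Definition orfFs n := si n * (vp n)%:F * sst n.
Definition orfG n := si n * (ws n)%:F * phi n.

Lemma rec_coef n : (0 < n)%N ->
  rconst (rho a n) * si n * rconst (ecoef alpha a n) = si n.-1.
Proof.
move=> n0; rewrite rhoE// ecoefE// /si -!rconstM -!rmorphM /=; congr rconst.
congr ((_)%:C)%C; have s1 := defect_gt0 alpha_r r1 n.
have s2 := defect_gt0 alpha_r r1 n.-1; have r0 := rhoR_gt0 n0.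
by field; rewrite !gt_eqF.
Qed.

Lemma zetaE n : zeta alpha n = (ws n)%:F / (vp n)%:F.
Proof. by []. Qed.

Lemma orf_recF n : (0 < n)%N ->
  rconst (rho a n) * orfF n = orfG n.-1 + rconst (a n) * orfFs n.-1.
Proof.
move=> n0; rewrite /orfF /orfG /orfFs phi_rec// zetaE.
rewrite -(rec_coef n0); set x := rconst (rho a n); set y := rconst (ecoef _ _ _).
exact: recF_identity (varpi_neq0 n) (varpi_neq0 n.-1).
Qed.

Lemma orf_recFs n : (0 < n)%N ->
  rconst (rho a n) * orfFs n = rconst (a n)^* * orfG n.-1 + orfFs n.-1.
Proof.
move=> n0; rewrite /orfG /orfFs phi_rec_star// zetaE.
rewrite -(rec_coef n0); set x := rconst (rho a n); set y := rconst (ecoef _ _ _).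
exact: recFs_identity (varpi_neq0 n) (varpi_neq0 n.-1).
Qed.

Lemma rho_sqr n : (0 < n)%N ->
  rconst (rho a n) ^+ 2 = 1 - rconst (a n) * rconst (a n)^*.
Proof.
move=> n0; rewrite expr2 -!rconstM -rconst1 -rconstN -rconstD; congr rconst.
by rewrite rhoE// -rmorphM mulC_conj -expr2 rhoR_sqr// rmorphB rmorph1.
Qed.

Lemma rho_neq0 n : (0 < n)%N -> rconst (rho a n) != 0.
Proof.
move=> n0; rewrite rconst_eq0 rhoE// -(rmorph0 (real_complex R)).
by rewrite (inj_eq (@complexI R)) gt_eqF// rhoR_gt0.
Qed.

Definition Be n := rsub (Blaschke_e alpha n).

Lemma rsub_zeta n : rsub (zeta alpha n) = (vp n)%:F / (ws n)%:F.
Proof.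
have X0 : ('X%:F : ratfun R) != 0 by rewrite tofrac_eq0 polyX_eq0.
have wE : (ws n)%:F = 'X%:F - rconst (alpha n) by rewrite /varpistar tofracB.
have vE : (vp n)%:F = 1 - rconst (alpha n)^* * 'X%:F.
  by rewrite /varpi -mul_polyC tofracB tofrac1 tofracM.
have v0 : vp n != 0 by have := varpi_neq0 n; rewrite tofrac_eq0.
have w0 : 'X%:F - rconst (alpha n) != 0 by rewrite -wE varpistar_neq0.
rewrite zetaE (rsub_frac _ v0) wE vE -(reflected_quotient _ X0 w0); congr (_ / _).
  rewrite psubE /varpistar rmorphB /= map_polyX map_polyC /=.
  by rewrite hornerXsubC.
rewrite psubE /varpi rmorphB /= rmorph1 map_polyZ /= map_polyX.
by rewrite hornerD hornerN hornerZ hornerX hornerC /rconj conjCK.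
Qed.

Lemma Be_S n : Be n.+1 = Be n * ((vp n.+1.*2)%:F / (ws n.+1.*2)%:F).
Proof. by rewrite /Be /Blaschke_e big_nat_recr//= rsubM rsub_zeta. Qed.

Lemma Be_0 : Be 0 = 1.
Proof. by rewrite /Be /Blaschke_e big_geq// rsub1. Qed.

Lemma chi_even n : chi n.*2 = Be n * sst n.*2.
Proof. by rewrite /chi_of odd_double doubleK. Qed.

Lemma chi_odd n : chi n.*2.+1 = Be n * phi n.*2.+1.
Proof. by rewrite /chi_of /= odd_double /= uphalf_double. Qed.

Definition pcol n := si n * (vp n)%:F * chi n.
Definition qcol n := si n * (ws n)%:F * chi n.

Lemma pcol_even n : pcol n.*2 = Be n * orfFs n.*2.
Proof. by rewrite /pcol chi_even mulrCA. Qed.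
Lemma pcol_odd n : pcol n.*2.+1 = Be n * orfF n.*2.+1.
Proof. by rewrite /pcol chi_odd mulrCA. Qed.
Lemma qcol_odd n : qcol n.*2.+1 = Be n * orfG n.*2.+1.
Proof. by rewrite /qcol chi_odd mulrCA. Qed.
(** The last factor of [Be n.+1] is varpi / varpistar of index 2n+2, and it turns varpistar into
    varpi. This cancellation is the purpose of reflecting the even parameters. *)
Lemma qcol_even n : qcol n.+1.*2 = Be n * orfFs n.+1.*2.
Proof.
by rewrite /qcol chi_even Be_S /orfFs (mul_quotient _ _ _ _ (varpistar_neq0 _)).
Qed.

Lemma pencil_even n :
  rconst (- a n.*2.+1) * pcol n.*2 + rconst (rho a n.*2.+1) * pcol n.*2.+1 =
  Be n * orfG n.*2.
Proof.
have [h _ _ _] := theta_relations (rho_neq0 (ltn0Sn n.*2)) (rho_sqr (ltn0Sn _))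
  (orf_recF (ltn0Sn _)) (orf_recFs (ltn0Sn _)).
by rewrite pcol_even pcol_odd -[RHS]/(_ * orfG n.*2.+1.-1) -h rconstN /=; ring.
Qed.

Lemma pencil_odd n :
  rconst (a n.*2.+1)^* * pcol n.*2.+1 + rconst (rho a n.*2.+1) * pcol n.*2 =
  Be n * orfFs n.*2.+1.
Proof.
have [_ h _ _] := theta_relations (rho_neq0 (ltn0Sn n.*2)) (rho_sqr (ltn0Sn _))
  (orf_recF (ltn0Sn _)) (orf_recFs (ltn0Sn _)).
by rewrite pcol_even pcol_odd -h /=; ring.
Qed.

Lemma pencil_q_odd n :
  rconst (- a n.*2.+2)^* * qcol n.*2.+1 + rconst (rho a n.*2.+2) * qcol n.*2.+2 =
  Be n * orfFs n.*2.+1.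
Proof.
have [_ _ h _] := theta_relations (rho_neq0 (ltn0Sn n.*2.+1)) (rho_sqr (ltn0Sn _))
  (orf_recF (ltn0Sn _)) (orf_recFs (ltn0Sn _)).
rewrite -[n.*2.+2]/(n.+1.*2) qcol_even qcol_odd doubleS -[in RHS]/(orfFs n.*2.+2.-1).
by rewrite -h rmorphN rconstN /=; ring.
Qed.

Lemma pencil_q_even n :
  rconst (a n.*2.+2) * qcol n.*2.+2 + rconst (rho a n.*2.+2) * qcol n.*2.+1 =
  Be n.+1 * orfG n.+1.*2.
Proof.
have [_ _ _ h] := theta_relations (rho_neq0 (ltn0Sn n.*2.+1)) (rho_sqr (ltn0Sn _))
  (orf_recF (ltn0Sn _)) (orf_recFs (ltn0Sn _)).
transitivity (Be n * orfF n.+1.*2).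
  rewrite -[n.*2.+2]/(n.+1.*2) qcol_even qcol_odd doubleS -h /=; ring.
rewrite Be_S /orfF /orfG.
by rewrite -(mul_quotient _ _ _ _ (varpistar_neq0 n.+1.*2)); ring.
Qed.

Lemma block_even (g : nat -> R[i]) n :
  [/\ block_diag g n.*2 = - g n, block_off g n.*2 = sqrtC (1 - `|g n| ^+ 2)
    & flip n.*2 = n.*2.+1].
Proof. by rewrite /block_diag /block_off /flip odd_double doubleK. Qed.

Lemma block_odd (g : nat -> R[i]) n :
  [/\ block_diag g n.*2.+1 = (g n)^*,
      block_off g n.*2.+1 = sqrtC (1 - `|g n| ^+ 2)
    & flip n.*2.+1 = n.*2].
Proof.
by rewrite /block_diag /block_off /flip oddS odd_double -[n.*2.+1./2]/(uphalf n.*2)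
  uphalf_double.
Qed.

(** Row k of Co (varpi chi / eta) = Ce^dag (varpistar chi / eta). The odd rows of both sides meet in
    [orfFs], the even ones in [orfG]. *)
Lemma pencil k :
  rconst (odiag a k) * pcol k + rconst (ooff a k) * pcol (flip k) =
  rconst (ediag a k)^* * qcol k + rconst (eoff a k) * qcol (eflip k).
Proof.
rewrite -[k]odd_double_half; set n := k./2.
have [e1 e2 e3] := block_even (a_odd a) n.
have [w1 w2 w3] := block_odd (a_odd a) n.
have [e1' e2' e3'] := block_even (a_even a) n.
case: (odd k); rewrite ?add1n ?add0n.
  rewrite /odiag /ooff w1 w2 w3 /ediag /eoff /eflip /= e1' e2' e3'.
  by rewrite -!/(rho _ _) pencil_odd -pencil_q_odd.
rewrite /odiag /ooff e1 e2 e3 -!/(rho _ _) pencil_even.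
(* Row 0 belongs to the 1 x 1 block of C_e and holds because phi_0 and its superstar are both 1. *)
case: (n) => [|l] /=.
  rewrite conjC1 rconst1 rconst0 mul0r addr0 mul1r Be_0 mul1r.
  by rewrite /orfG /qcol chi_even Be_0 mul1r /= sst_0 phi_0.
have [d1 d2 d3] := block_odd (a_even a) l.
rewrite d1 d2 d3 conjCK; exact: esym (pencil_q_even l).
Qed.

Lemma chi_recurrence z : (forall n, ~ is_pole (chi n) z) ->
  forall k, rec0 alpha a (fun n => (reval (chi n) z)^*) k =
    z^* * rec1 alpha a (fun n => (reval (chi n) z)^*) k.
Proof.
move=> np k; pose v n := reval (chi n) z.
have hv n : has_value (chi n) z (v n) by exact: reval_has_value.
change (rec0 alpha a (fun n => (v n)^* ) k =
  z^* * rec1 alpha a (fun n => (v n)^* ) k).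
move: v hv => v hv.
have vs n : has_value (si n) z (((sd n)^-1%:C)%C) by exact: has_value_const.
have hp n : has_value (pcol n) z (((sd n)^-1%:C)%C * (1 - (alpha n)^* * z) * v n).
  apply: has_valueM => //; apply: has_valueM => //.
  by rewrite -horner_varpi; exact: has_value_poly.
have hq n : has_value (qcol n) z (((sd n)^-1%:C)%C * (z - alpha n) * v n).
  apply: has_valueM => //; apply: has_valueM => //.
  by rewrite -horner_varpistar; exact: has_value_poly.
have hc c := has_value_const c z.
have h1 := has_valueD (has_valueM (hc (odiag a k)) (hp k))
  (has_valueM (hc (ooff a k)) (hp (flip k))).
have h2 := has_valueD (has_valueM (hc (ediag a k)^* ) (hq k))
  (has_valueM (hc (eoff a k)) (hq (eflip k))).
rewrite pencil in h1.
(* varpi and varpistar are affine in z; after conjugation, the terms with conj(z) make up [rec1] and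
   the others [rec0]. *)
have := has_value_uniq h1 h2 => /(congr1 (@Num.conj _)).
rewrite !(rmorphD, rmorphM, rmorphN, rmorphB, rmorph1) /= !conjCK.
rewrite (pairing_real (pairing_o a1)) (pairing_real (pairing_e a1)).
have sJ n : ((((sd n)^-1)%:C)%C)^* = (((sd n)^-1)%:C)%C by exact: conjc_real.
rewrite !sJ /rec0 /rec1 /paircoord /normalize => e.
apply/eqP; rewrite -subr_eq0; apply/eqP; move/eqP: e; rewrite -subr_eq0 => /eqP <-.
by ring.
Qed.

End OrthogonalRationalFunctions.

(** * Orthonormality of the chi_n and the entries of U^dag *)

Lemma orf_step_identity (K : fieldType) (v v' d w p q y c : K) :
  v != 0 -> v' != 0 -> d != 0 ->
  y * (v / v') * (w / v * (p / d) + c * (q / d)) = y * (w * p + c * (v * q)) / (d * v').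
Proof. by move=> v0 v'0 d0; field; rewrite v0 v'0 d0. Qed.

Lemma orf_step_identity_star (K : fieldType) (v v' d w p q y c : K) :
  v != 0 -> v' != 0 -> d != 0 ->
  y * (v / v') * (c * (w / v * (p / d)) + q / d) = y * (c * (w * p) + v * q) / (d * v').
Proof. by move=> v0 v'0 d0; field; rewrite v0 v'0 d0. Qed.

Lemma reversal_identity (K : fieldType) (z w v' d' d p q zn : K) :
  v' != 0 -> d' != 0 -> d != 0 -> z != 0 -> w != 0 ->
  w * v'^-1 * (p * d'^-1) * (z * zn * q / (d * (z * w))) =
  q / (d' * v') * (zn * p / d).
Proof. by move=> v0 d0' d0 z0 w0; field; rewrite v0 d0' d0 z0 w0. Qed.

Section Orthonormality.
Variables (R : realType) (alpha a : nat -> R[i]) (phi : nat -> ratfun R) (r : R).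
Variable m : {finite_measure set (borelC R) -> \bar R}.
Hypothesis alpha_r : forall n, cabs (alpha n) <= r.
Hypothesis r1 : r < 1.
Hypothesis a1 : forall n, (0 < n)%N -> cabs (a n) < 1.
Hypothesis phi_0 : phi 0%N = 1.
Hypothesis phi_rec : forall n, (0 < n)%N ->
  phi n = rconst (ecoef alpha a n) * ((varpi alpha n.-1)%:F / (varpi alpha n)%:F)
    * (zeta alpha n.-1 * phi n.-1 + rconst (a n) * superstar alpha phi n.-1).
Hypothesis phi_rec_star : forall n, (0 < n)%N ->
  superstar alpha phi n =
    rconst (ecoef alpha a n) * ((varpi alpha n.-1)%:F / (varpi alpha n)%:F)
    * (rconst (a n)^* * (zeta alpha n.-1 * phi n.-1) + superstar alpha phi n.-1).
Hypothesis phi_on : forall i j, ip m (reval (phi i)) (reval (phi j)) = (i == j)%:R.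

Notation sst := (superstar alpha phi).
Notation chi := (chi_of alpha phi).
Notation vp n := (varpi alpha n).
Notation ws n := (varpistar alpha n).

(** Numerators of phi_n and its superstar over the common denominator [prodV n]. Membership in the
    span of B_0, ..., B_n then becomes a bound on the degree of a numerator. *)
Fixpoint orf_num n : {poly R[i]} * {poly R[i]} :=
  if n is k.+1 then
    let e := ecoef alpha a n in
    (e *: (ws k * (orf_num k).1 + a n *: (vp k * (orf_num k).2)),
     e *: ((a n)^* *: (ws k * (orf_num k).1) + vp k * (orf_num k).2))
  else (1, 1).
Notation P n := (orf_num n).1.
Notation Q n := (orf_num n).2.

Lemma orf_num_S n :
  P n.+1 = ecoef alpha a n.+1 *: (ws n * P n + a n.+1 *: (vp n * Q n)) /\
  Q n.+1 = ecoef alpha a n.+1 *: ((a n.+1)^* *: (ws n * P n) + vp n * Q n).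
Proof. by []. Qed.

Definition prodV n : {poly R[i]} := \prod_(1 <= k < n.+1) vp k.

Lemma prodV_S n : prodV n.+1 = prodV n * vp n.+1.
Proof. by rewrite /prodV big_nat_recr. Qed.

Lemma prodV_0 : prodV 0 = 1.
Proof. by rewrite /prodV big_geq. Qed.

Lemma varpi_circle z n : cabs z = 1 -> 1 - r <= cabs (vp n).[z].
Proof.
move=> z1; rewrite horner_varpi.
have := cabsD (1 - (alpha n)^* * z) ((alpha n)^* * z).
rewrite subrK cabs1 cabsM cabsJ z1 mulr1; have := alpha_r n; lra.
Qed.

Lemma varpi_circle_neq0 z n : cabs z = 1 -> (vp n).[z] != 0.
Proof.
move=> z1; rewrite -cabs_gt0 (lt_le_trans _ (varpi_circle n z1))// subr_gt0//.
Qed.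

Lemma conj_circle (z : R[i]) : cabs z = 1 -> z * z^* = 1.
Proof. by move=> z1; rewrite mulC_conj z1 expr1n. Qed.

Lemma varpistar_circle z n : cabs z = 1 -> z * ((ws n).[z])^* = (vp n).[z].
Proof.
move=> z1; rewrite horner_varpi horner_varpistar rmorphB /= mulrBr conj_circle//.
by rewrite mulrC [_ * z]mulrC.
Qed.

Lemma varpi_conj_circle z n : cabs z = 1 -> z * ((vp n).[z])^* = (ws n).[z].
Proof.
move=> z1; rewrite -(varpistar_circle n z1) rmorphM /= conjCK mulrA.
by rewrite conj_circle// mul1r.
Qed.

Lemma varpistar_circle_neq0 z n : cabs z = 1 -> (ws n).[z] != 0.
Proof.
move=> z1; have := varpi_circle_neq0 n z1; rewrite -(varpistar_circle n z1).
by rewrite mulf_eq0 negb_or conjC_eq0 => /andP[].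
Qed.

Lemma prodV_circle z n : cabs z = 1 -> (prodV n).[z] != 0.
Proof.
move=> z1; elim: n => [|n IH]; first by rewrite prodV_0 hornerC oner_neq0.
by rewrite prodV_S hornerM mulf_neq0// varpi_circle_neq0.
Qed.

Lemma prodV_neq0 n : (prodV n)%:F != 0.
Proof. by rewrite tofrac_eq0 (poly_neq0 (prodV_circle n (cabs1 R))). Qed.

Lemma orf_numE n : phi n = (P n)%:F / (prodV n)%:F /\ sst n = (Q n)%:F / (prodV n)%:F.
Proof.
elim: n => [|n [IH1 IH2]].
  by rewrite phi_0 (sst_0 alpha phi_0) prodV_0 tofrac1 divr1.
have v1 := varpi_neq0 alpha n; have v2 := varpi_neq0 alpha n.+1.
have d0 := prodV_neq0 n.
rewrite (phi_rec (ltn0Sn n)) (phi_rec_star (ltn0Sn n)) -[n.+1.-1]/n.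
rewrite prodV_S tofracM !zetaE IH1 IH2.
rewrite (orf_step_identity _ _ _ _ _ v1 v2 d0).
rewrite (orf_step_identity_star _ _ _ _ _ v1 v2 d0).
have [-> ->] := orf_num_S n.
by rewrite -!mul_polyC !(tofracM, tofracD).
Qed.

Lemma size_varpi_le n : (size (vp n) <= 2)%N.
Proof.
rewrite (leq_trans (size_polyD _ _))// geq_max size_poly1 size_polyN.
by rewrite (leq_trans (size_scale_leq _ _))// size_polyX.
Qed.

Lemma size_mul_varpi n k (p : {poly R[i]}) :
  (size p <= k)%N -> (0 < k)%N -> (size (p * vp n)%R <= k.+1)%N.
Proof.
move=> sp k0; rewrite (leq_trans (size_polyMleq _ _))//.
have := size_varpi_le n; move: sp; case: (size p) => [|s]; last first.
  by rewrite addSn /= => sk; case: (size (vp n)) => [|[|[|l]]]// _;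
    rewrite ?addn0 ?addn1 ?addn2 ?ltnS ?(ltnW sk)// (leq_trans (ltnW sk)).
by rewrite add0n => _; case: (size (vp n)) => [|[|[|l]]]//= _; rewrite ltnW.
Qed.

Lemma size_orf_num n : (size (P n) <= n.+1)%N /\ (size (Q n) <= n.+1)%N.
Proof.
elim: n => [|n [IH1 IH2]]; first by rewrite size_poly1.
have [-> ->] := orf_num_S n.
have sw (p : {poly R[i]}) : (size p <= n.+1)%N -> (size (ws n * p)%R <= n.+2)%N.
  move=> sp; rewrite (leq_trans (size_polyMleq _ _))// size_XsubC.
  by rewrite add2n.
have sv (p : {poly R[i]}) : (size p <= n.+1)%N -> (size (vp n * p)%R <= n.+2)%N.
  by move=> sp; rewrite mulrC size_mul_varpi.
split; rewrite (leq_trans (size_scale_leq _ _))//;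
  rewrite (leq_trans (size_polyD _ _))// geq_max;
  rewrite ?(leq_trans (size_scale_leq _ _))// ?sw ?sv//.
Qed.

(** Q_n is P_n reversed. The recurrence preserves this, since reversal on the circle exchanges
    varpi_n and varpistar_n. *)
Lemma orf_num_circle z n : cabs z = 1 -> (Q n).[z] = z ^+ n * ((P n).[z])^*.
Proof.
move=> z1; elim: n => [|n IH]; first by rewrite hornerC conjC1 mulr1.
have IH' : z ^+ n * ((Q n).[z])^* = (P n).[z].
  rewrite IH rmorphM rmorphXn /= conjCK mulrA -exprMn conj_circle// expr1n.
  by rewrite mul1r.
have eJ : (ecoef alpha a n.+1)^* = ecoef alpha a n.+1.
  by rewrite (ecoefE alpha_r r1 a1)//; exact: conjc_real.
have [-> ->] := orf_num_S n.
move: (varpistar_circle n z1) (varpi_conj_circle n z1).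
move: (vp n) (ws n) => v w hw hv.
rewrite !(hornerZ, hornerD, hornerM) !(rmorphM, rmorphD) /= eJ exprS.
move: (w.[z]^* ) (v.[z]^* ) ((P n).[z]^* ) ((Q n).[z]^* ) hw hv IH IH'.
by move=> w' v' p' q' <- <- -> <-; ring.
Qed.

Definition phiv n z := (P n).[z] / (prodV n).[z].
Definition sstv n z := (Q n).[z] / (prodV n).[z].

Lemma has_value_phi n z : cabs z = 1 -> has_value (phi n) z (phiv n z).
Proof.
move=> z1; have [-> _] := orf_numE n; exists (P n), (prodV n).
by rewrite prodV_circle.
Qed.

Lemma has_value_sst n z : cabs z = 1 -> has_value (sst n) z (sstv n z).
Proof.
move=> z1; have [_ ->] := orf_numE n; exists (Q n), (prodV n).
by rewrite prodV_circle.
Qed.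

Fixpoint bev n z :=
  if n is k.+1 then bev k z * ((vp n.*2).[z] / (ws n.*2).[z]) else 1.

Lemma has_value_Be n z : cabs z = 1 -> has_value (Be alpha n) z (bev n z).
Proof.
move=> z1; elim: n => [|n IH]; first by rewrite Be_0 -rconst1; exact: has_value_const.
rewrite Be_S; apply: has_valueM => //; exists (vp n.+1.*2), (ws n.+1.*2).
by rewrite varpistar_circle_neq0.
Qed.

Lemma cabs_varpi_circle n z : cabs z = 1 -> cabs (ws n).[z] = cabs (vp n).[z].
Proof. by move=> z1; rewrite -(varpistar_circle n z1) cabsM z1 mul1r cabsJ. Qed.

Lemma cabs_bev n z : cabs z = 1 -> cabs (bev n z) = 1.
Proof.
move=> z1; elim: n => [|n IH]; first exact: cabs1.
rewrite -[bev n.+1 z]/(bev n z * ((vp n.+1.*2).[z] / (ws n.+1.*2).[z])).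
rewrite cabsM IH mul1r cabsM cabsV cabs_varpi_circle// divff//.
by rewrite cabs_eq0 varpi_circle_neq0.
Qed.

Definition chiv n z := bev n./2 z * (if odd n then phiv n z else sstv n z).

Lemma has_value_chi n z : cabs z = 1 -> has_value (chi n) z (chiv n z).
Proof.
move=> z1; rewrite /chi_of /chiv; apply: has_valueM; first exact: has_value_Be.
by case: (odd n); [exact: has_value_phi|exact: has_value_sst].
Qed.

Lemma reval_phi n z : cabs z = 1 -> reval (phi n) z = phiv n z.
Proof. by move=> z1; have [] := has_valueP (has_value_phi n z1). Qed.

Lemma reval_chi n z : cabs z = 1 -> reval (chi n) z = chiv n z.
Proof. by move=> z1; have [] := has_valueP (has_value_chi n z1). Qed.

Lemma chi_no_pole n z : cabs z = 1 -> ~ is_pole (chi n) z.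
Proof. by move=> z1; have [] := has_valueP (has_value_chi n z1). Qed.

Lemma cabs_sstv n z : cabs z = 1 -> cabs (sstv n z) = cabs (phiv n z).
Proof.
by move=> z1; rewrite /sstv /phiv orf_num_circle// !cabsM cabsX z1 expr1n mul1r cabsJ.
Qed.

Lemma cabs_chiv n z : cabs z = 1 -> cabs (chiv n z) = cabs (phiv n z).
Proof.
move=> z1; rewrite /chiv cabsM cabs_bev// mul1r.
by case: (odd n) => //; exact: cabs_sstv.
Qed.

Lemma bounded_prodVV n : bounded_on_circle (fun z => (prodV n).[z]^-1).
Proof.
elim: n => [|n [M IH]].
  by exists 1 => z _; rewrite prodV_0 hornerC invr1 cabs1.
exists (M * (1 - r)^-1) => z z1; rewrite prodV_S hornerM invfM cabsM.
rewrite ler_pM ?cabs_ge0 ?IH// cabsV lef_pV2 ?posrE ?varpi_circle ?subr_gt0//.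
by rewrite cabs_gt0 varpi_circle_neq0.
Qed.

Lemma admissible_phiv n : admissible (phiv n).
Proof.
apply: admissibleM; first exact: admissible_poly.
split; first exact/cmeasurableV/cmeasurable_poly.
exact: bounded_prodVV.
Qed.

Lemma cmeasurable_reval (f : ratfun R) : cmeasurable (reval f).
Proof.
apply: cmeasurableM; first exact: cmeasurable_poly.
exact/cmeasurableV/cmeasurable_poly.
Qed.

Lemma admissible_reval_chi n : admissible (reval (chi n)).
Proof.
split; first exact: cmeasurable_reval.
have [_ [M hM]] := admissible_phiv n; exists M => z z1.
by rewrite reval_chi// cabs_chiv// hM.
Qed.

Lemma ip_phiv i j : ip m (phiv i) (phiv j) = (i == j)%:R.
Proof.
rewrite -phi_on; apply: eq_ip => z z1; by rewrite reval_phi.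
Qed.

Lemma ip_sum f (c : nat -> R[i]) (g : nat -> R[i] -> R[i]) n :
  admissible f -> (forall k, admissible (g k)) ->
  ip m f (fun z => \sum_(k < n) c k * g k z) = \sum_(k < n) c k * ip m f (g k).
Proof.
move=> hf hg; have hk k : admissible (fun z => c k * ((f z)^* * g k z)).
  by apply: admissibleM; [exact: admissible_cst|exact: admissible_ip].
transitivity (cintegral m (@circle R) (fun z => \sum_(k < n) c k * ((f z)^* * g k z))).
  apply: eq_cint => z _; rewrite mulr_sumr.
  by apply: eq_bigr => k _; rewrite mulrCA.
rewrite (cint_sum m n hk); apply: eq_bigr => k _; rewrite cintZ//.
exact: admissible_ip.
Qed.

Definition numer n k : {poly R[i]} := P k * \prod_(k.+1 <= j < n.+1) vp j.

Lemma size_numer n k : (k <= n)%N -> (size (numer n k) <= n.+1)%N.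
Proof.
rewrite /numer; elim: n => [|n IH]; rewrite leq_eqVlt => /orP[/eqP ->|].
- by rewrite big_geq// mulr1; have [] := size_orf_num 0.
- by [].
- by rewrite big_geq// mulr1; have [] := size_orf_num n.+1.
rewrite ltnS => kn; rewrite big_nat_recr ?ltnS//= mulrA.
by apply: size_mul_varpi => //; exact: IH.
Qed.

Lemma numer_circle n k z : (k <= n)%N -> cabs z = 1 ->
  (numer n k).[z] / (prodV n).[z] = phiv k z.
Proof.
move=> kn z1; have E : numer n k * prodV k = P k * prodV n.
  rewrite /numer /prodV -mulrA; congr (_ * _).
  by rewrite mulrC (@big_cat_nat _ _ _ k.+1 1 n.+1).
apply/eqP; rewrite /phiv eqr_div ?prodV_circle// -!hornerM E.
by rewrite mulrC.
Qed.

Lemma span_phiv n (p : {poly R[i]}) : (size p <= n.+1)%N ->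
  exists c : nat -> R[i], forall z, cabs z = 1 ->
    p.[z] / (prodV n).[z] = \sum_(k < n.+1) c k * phiv k z.
Proof.
move=> sp; pose M : 'M[R[i]]_n.+1 := \matrix_(k < n.+1) poly_rV (numer n k).
have rM (u : 'rV_n.+1) : rVpoly (u *m M) = \sum_(k < n.+1) u 0 k *: numer n k.
  rewrite mulmx_sum_row linear_sum; apply: eq_bigr => k _.
  by rewrite linearZ /= rowK poly_rV_K// size_numer// -ltnS.
have uz (u : 'rV_n.+1) z : cabs z = 1 ->
    (rVpoly (u *m M)).[z] / (prodV n).[z] = \sum_(k < n.+1) u 0 k * phiv k z.
  move=> z1; rewrite rM horner_sum mulr_suml; apply: eq_bigr => k _.
  by rewrite hornerZ -mulrA numer_circle// -ltnS.
have fM : row_free M.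
  apply: inj_row_free => u uM; apply/rowP => j; rewrite mxE.
  have e z : cabs z = 1 -> \sum_(k < n.+1) u 0 (inord k) * phiv k z = 0.
    move=> z1; have := uz u z z1; rewrite uM raddf0 horner0 mul0r => h.
    by rewrite [RHS]h; apply: eq_bigr => k _; rewrite inord_val.
  have := @ip_sum _ (fun k => u 0 (inord k)) _ n.+1 (admissible_phiv j) admissible_phiv.
  rewrite (@eq_ip _ _ _ (phiv j) _ (fun z => 0 * phiv j z))//; last first.
    by move=> z z1; rewrite e// mul0r.
  rewrite (bigD1 j)//= ip_phiv eqxx mulr1 inord_val big1 ?addr0 => [h|k kj].
    rewrite -h /ip; transitivity (0 * ip m (phiv j) (phiv j)); last by rewrite mul0r.
    rewrite -cintZ; last by apply: admissible_ip; exact: admissible_phiv.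
    by apply: eq_cint => z _; rewrite mulrCA.
  by rewrite ip_phiv eq_sym (inj_eq val_inj) (negbTE kj) mulr0.
have uM : M \in unitmx by rewrite -row_free_unit.
exists (fun k => (poly_rV p *m invmx M) 0 (inord k)) => z z1.
have := uz (poly_rV p *m invmx M) z z1; rewrite mulmxKV// poly_rV_K// => ->.
by apply: eq_bigr => k _; rewrite inord_val.
Qed.

Definition orf_space n (f : R[i] -> R[i]) := exists2 p : {poly R[i]}, (size p <= n.+1)%N
  & forall z, cabs z = 1 -> f z = p.[z] / (prodV n).[z].

Lemma ip_phiv_orf_space n f : orf_space n f -> ip m (phiv n.+1) f = 0.
Proof.
move=> [p sp pf]; have [c hc] := span_phiv sp.
rewrite (@eq_ip _ _ _ (phiv n.+1) _ (fun z => \sum_(k < n.+1) c k * phiv k z))//.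
  rewrite ip_sum; [|exact: admissible_phiv|exact: admissible_phiv].
  by rewrite big1// => k _; rewrite ip_phiv gtn_eqF ?mulr0.
by move=> z z1; rewrite pf// hc.
Qed.

Lemma orf_space_admissible n f : orf_space n f -> cmeasurable f -> admissible f.
Proof.
move=> [p _ pf] mf; split => //.
have [_ [M hM]] : admissible (fun z => p.[z] / (prodV n).[z]).
  apply: admissibleM; first exact: admissible_poly.
  split; first exact/cmeasurableV/cmeasurable_poly.
  exact: bounded_prodVV.
by exists M => z z1; rewrite pf// hM.
Qed.

(** Reversal turns this inner product into that of phi_(n+1) with another element of the space,
    whose numerator q satisfies q(z) = z^n conj(p(z)) on the circle. *)
Lemma ip_sstv_orf_space n f : orf_space n f ->
  ip m (fun z => (ws n.+1).[z] / (vp n.+1).[z] * f z) (sstv n.+1) = 0.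
Proof.
move=> [p sp pf].
pose q : {poly R[i]} := \poly_(i < n.+1) (p`_(n - i))^*.
have qz z : cabs z = 1 -> q.[z] = z ^+ n * (p.[z])^*.
  move=> z1; rewrite horner_poly (horner_coef_wide z sp) rmorph_sum mulr_sumr.
  rewrite (reindex_inj rev_ord_inj) /=; apply: eq_bigr => k _.
  have kn : (k <= n)%N by rewrite -ltnS.
  rewrite subSS (subKn kn) rmorphM /= rmorphXn /= mulrCA; congr (_ * _).
  have -> : z ^+ n = z ^+ (n - k) * z ^+ k by rewrite -exprD subnK.
  rewrite -mulrA -exprMn.
  by rewrite conj_circle// expr1n mulr1.
rewrite -(@ip_phiv_orf_space n (fun z => q.[z] / (prodV n).[z])); last first.
  by exists q => //; exact: size_poly.
apply: eq_cint => z z1; rewrite pf// /sstv /phiv orf_num_circle// qz//.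
have z0 : z != 0 by rewrite -cabs_eq0 z1 oner_neq0.
have w0 : ((ws n.+1).[z])^* != 0 by rewrite conjC_eq0 varpistar_circle_neq0.
have v0 : ((vp n.+1).[z])^* != 0 by rewrite conjC_eq0 varpi_circle_neq0.
have d0 := prodV_circle n z1.
have d0' : ((prodV n).[z])^* != 0 by rewrite conjC_eq0.
set pz := (P n.+1).[z]; set dz := (prodV n).[z].
rewrite prodV_S hornerM !rmorphM /= !fmorphV /= rmorphM /= exprS.
move: (((vp n.+1).[z])^* ) v0 => v' v0; rewrite -(varpistar_circle n.+1 z1).
exact: reversal_identity.
Qed.

(** All of chi_0, ..., chi_n lie in one reflected Blaschke factor times the space of order n. From n
    to n+1 the numerator gains varpistar_(n+1) if n+1 is even, when the Blaschke product grows, and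
    varpi_(n+1) otherwise. *)
Lemma orf_space_chi n i : (i <= n)%N -> orf_space n (fun z => (bev n./2 z)^-1 * chiv i z).
Proof.
elim: n => [|n IH]; rewrite leq_eqVlt => /orP[/eqP ->|].
- by exists 1; rewrite ?size_poly1// => z z1;
    rewrite /chiv /= /sstv /= prodV_0 !hornerC !divr1 invr1 !mul1r.
- by [].
- exists (if odd n.+1 then P n.+1 else Q n.+1).
    by case: ifP => _; have [] := size_orf_num n.+1.
  move=> z z1; rewrite /chiv mulrA mulVf ?mul1r.
    by case: ifP.
  by rewrite -cabs_eq0 cabs_bev// oner_neq0.
rewrite ltnS => /IH[p sp pf]; case: (boolP (odd n)) => on.
  have hn : n.+1./2 = n./2.+1 by rewrite -[n.+1./2]/(uphalf n) uphalf_half on.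
  have nE : n./2.+1.*2 = n.+1.
    by rewrite doubleS -[in RHS](odd_double_half n) on.
  exists (p * ws n.+1).
    rewrite (leq_trans (size_polyMleq _ _))// size_XsubC addn2 /=.
    by rewrite ltnS.
  move=> z z1; rewrite hn.
  rewrite -[bev _ z]/(bev n./2 z * ((vp n./2.+1.*2).[z] / (ws n./2.+1.*2).[z])).
  rewrite nE invfM invf_div mulrAC pf// prodV_S !hornerM mulf_div.
  by congr (_ / _); rewrite mulrC.
have hn : n.+1./2 = n./2.
  by rewrite -[n.+1./2]/(uphalf n) uphalf_half (negbTE on).
exists (p * vp n.+1); first exact: size_mul_varpi.
move=> z z1; rewrite hn pf// prodV_S !hornerM -mulf_div divff ?mulr1//.
exact: varpi_circle_neq0.
Qed.

Lemma bev_conj n z : cabs z = 1 -> ((bev n z)^-1)^* = bev n z.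
Proof.
move=> z1; have := conj_circle (cabs_bev n z1).
have b0 : bev n z != 0 by rewrite -cabs_eq0 cabs_bev// oner_neq0.
by move=> h; rewrite fmorphV /=; apply: (mulIf (_ : (bev n z)^* != 0));
  rewrite ?conjC_eq0// mulVf ?conjC_eq0// h.
Qed.

Lemma cmeasurable_bev n : cmeasurable (bev n).
Proof.
elim: n => [|n IH]; first exact: cmeasurable_cst.
apply: (@cmeasurableM _ (bev n)) => //; apply: cmeasurableM.
  exact: cmeasurable_poly.
exact/cmeasurableV/cmeasurable_poly.
Qed.

Lemma cmeasurable_chiv n : cmeasurable (chiv n).
Proof.
apply: cmeasurableM; first exact: cmeasurable_bev.
case: (odd n); apply: cmeasurableM; do ?exact: cmeasurable_poly;
  exact/cmeasurableV/cmeasurable_poly.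
Qed.

(** The common Blaschke factor is unimodular and cancels. What remains is that phi_(n+1) is
    orthogonal to the space of order n when n+1 is odd, and its superstar to zeta_(n+1) times that
    space when n+1 is even. *)
Lemma chi_orthogonal i n : (i <= n)%N ->
  ip m (reval (chi i)) (reval (chi n.+1)) = 0.
Proof.
move=> le_in; have L := orf_space_chi le_in.
case: (boolP (odd n)) => on.
  have hn : n.+1./2 = n./2.+1 by rewrite -[n.+1./2]/(uphalf n) uphalf_half on.
  have nE : n./2.+1.*2 = n.+1.
    by rewrite doubleS -[in RHS](odd_double_half n) on.
  rewrite -(ip_sstv_orf_space L); apply: eq_cint => z z1.
  rewrite !reval_chi// /(chiv n.+1) /= on /= -[uphalf n]/(n.+1./2) hn.
  rewrite -[bev _.+1 z]/(bev n./2 z * ((vp n./2.+1.*2).[z] / (ws n./2.+1.*2).[z])).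
  rewrite nE.
  have w0 := varpistar_circle_neq0 n.+1 z1; have v0 := varpi_circle_neq0 n.+1 z1.
  have h : (vp n.+1).[z] / (ws n.+1).[z] =
      ((ws n.+1).[z])^* * (((vp n.+1).[z])^-1)^*.
    rewrite fmorphV /=; apply/eqP; rewrite eqr_div ?conjC_eq0//.
    by rewrite mulC_conj conjM_cabs cabs_varpi_circle.
  by rewrite !rmorphM /= bev_conj// -h; ring.
have hn : n.+1./2 = n./2.
  by rewrite -[n.+1./2]/(uphalf n) uphalf_half (negbTE on).
rewrite -(conjC0 R[i]) -(ip_phiv_orf_space L) /ip -cintJ; last first.
  apply: admissible_ip; first exact: admissible_phiv.
  apply: orf_space_admissible L _; apply: cmeasurableM; last exact: cmeasurable_chiv.
  exact/cmeasurableV/cmeasurable_bev.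
apply: eq_cint => z z1; rewrite !reval_chi// /(chiv n.+1) /= on -[uphalf n]/(n.+1./2).
rewrite hn -[in LHS](bev_conj n./2 z1).
move: (chiv i z) (phiv n.+1 z) ((bev n./2 z)^-1) => x y b.
by rewrite !rmorphM /= conjCK; ring.
Qed.

Lemma chi_orthonormal i j : ip m (reval (chi i)) (reval (chi j)) = (i == j)%:R.
Proof.
have adm := admissible_reval_chi.
case: (ltngtP i j) => [|ji|->].
- by case: j => // j; rewrite ltnS; exact: chi_orthogonal.
- case: i ji => // i; rewrite ltnS => ji.
  by rewrite (ipC m (adm j) (adm i.+1)) chi_orthogonal// conjC0.
- rewrite ip_self -(@nsq_unimodular _ m (phiv j)).
    by rewrite -ip_self ip_phiv eqxx.
  by move=> z z1; rewrite reval_chi// cabs_chiv.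
Qed.

Lemma cabs_reval_chi n z : cabs z = 1 ->
  cabs (reval (chi n) z) = cabs (reval (phi n) z).
Proof. by move=> z1; rewrite reval_chi// reval_phi// cabs_chiv. Qed.

Lemma reval_chi0 z : reval (chi 0%N) z = 1.
Proof.
have -> : chi 0%N = 1 by rewrite -[chi 0%N]/(Be alpha 0 * sst 0%N) Be_0 sst_0// mul1r.
by have [_ ->] := has_valueP (has_value_const 1 z).
Qed.

(* The coefficients of conj(z) chi_i solve the linear system that determines
   U^dag e_i: integrate the recurrence of chi against chi_i. *)
Lemma V_entries (V : l2 R -> l2 R) : adjoints V (U alpha a) ->
  forall i n, V (l2e R i) n = ip m (reval (chi n)) (fun z => z^* * reval (chi i) z).
Proof.
move=> ad i n.
have adm := admissible_reval_chi.
have admz : admissible (fun z => z^* * reval (chi i) z).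
  by apply: admissibleM => //; exact/admissibleJ/admissible_id.
have wl2 : in_l2 (fun n => ip m (reval (chi n)) (fun z => z^* * reval (chi i) z)).
  exact: in_l2P (bessel adm chi_orthonormal admz).
rewrite (_ : V (l2e R i) = mkl2 wl2)//.
apply/(adjoint_U_char alpha_r r1 a1 _ _ ad) => k /=.
pose F n z := (reval (chi n) z)^*.
have hpa (c d : nat -> R[i]) f (w : nat -> R[i]) g : admissible g ->
    admissible (fun z => paircoord c d f (fun n => w n * F n z) k * g z).
  move=> hg; apply: admissibleM => //; apply: admissibleD;
    do !(apply: admissibleM; first exact: admissible_cst);
    exact: admissibleJ.
have hpair c d f (w : nat -> R[i]) g : admissible g ->
    cintegral m (@circle R) (fun z => paircoord c d f (fun n => w n * F n z) k * g z) =
    paircoord c d f (fun n => w n * ip m (reval (chi n)) g) k.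
  move=> hg; have hF l : admissible (fun z => F l z * g z) by exact: admissible_ip.
  have hc e l : admissible (fun z => e * (F l z * g z)).
    by apply: admissibleM => //; exact: admissible_cst.
  transitivity (cintegral m (@circle R) (fun z => (c k * w k) * (F k z * g z) +
      (d k * w (f k)) * (F (f k) z * g z))).
    by apply: eq_cint => z _; rewrite /paircoord; ring.
  by rewrite cintD// !cintZ// /paircoord !mulrA.
(* Each equation is a finite linear combination of the entries, so integration against g passes
   through it. *)
have hrec g : admissible g ->
    (cintegral m (@circle R) (fun z => rec0 alpha a (F^~ z) k * g z) =
     rec0 alpha a (fun n => ip m (reval (chi n)) g) k) /\
    (cintegral m (@circle R) (fun z => rec1 alpha a (F^~ z) k * g z) =
     rec1 alpha a (fun n => ip m (reval (chi n)) g) k).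
  move=> hg.
  have key (c d c' d' : nat -> R[i]) (f f' : nat -> nat) (w w' : nat -> R[i]) :
    cintegral m (@circle R) (fun z => (paircoord c d f (fun n => w n * F n z) k +
      paircoord c' d' f' (fun n => w' n * F n z) k) * g z) =
    paircoord c d f (fun n => w n * ip m (reval (chi n)) g) k +
    paircoord c' d' f' (fun n => w' n * ip m (reval (chi n)) g) k.
    rewrite -!hpair// -cintD.
    - by apply: eq_cint => z _; rewrite mulrDl.
    - exact: hpa.
    - exact: hpa.
  have E (be u : nat -> R[i]) : (fun n => be n * (((defect alpha n)^-1%:C)%C * u n)) =
      (fun n => (be n * ((defect alpha n)^-1%:C)%C) * u n).
    by apply/funext => l; rewrite mulrA.
  split; rewrite /rec0 /rec1 /normalize E -key;
    by apply: eq_cint => z _; rewrite E.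
have [h0 _] := hrec _ (adm i); have [_ h1] := hrec _ admz.
transitivity (rec0 alpha a (fun n => ip m (reval (chi n)) (reval (chi i))) k).
  congr (rec0 _ _ _ _); apply/funext => l; by rewrite chi_orthonormal.
rewrite -h0 -h1; apply: eq_cint => z z1.
rewrite (chi_recurrence alpha_r r1 a1 phi_0 phi_rec phi_rec_star).
  by rewrite -mulrA mulrCA.
by move=> l; exact: chi_no_pole.
Qed.

End Orthonormality.

(** * Support, spectrum and mass points *)

Section Indicators.
Variable R : realType.
Variable m : {finite_measure set (borelC R) -> \bar R}.
Notation cint := (cintegral m (@circle R)).

Definition cindic (A : set R[i]) (z : R[i]) : R[i] := ((\1_A z)%:C)%C.

Lemma cmeasurable_cindic (A : set (borelC R)) : measurable A ->
  cmeasurable (cindic A).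
Proof. by move=> mA; apply: cmeasurable_real; exact: measurable_indic. Qed.

Lemma cabs_cindic A z : cabs (cindic A z) <= 1.
Proof.
by rewrite /cindic cabs_real indicE; case: (z \in A); rewrite ?normr1 ?normr0.
Qed.

Lemma admissible_cindic (A : set (borelC R)) : measurable A ->
  admissible (cindic A).
Proof.
move=> mA; split; first exact: cmeasurable_cindic.
by exists 1 => z _; exact: cabs_cindic.
Qed.

Lemma cint_cindic (A : set (borelC R)) : measurable A ->
  complex.Re (cint (cindic A)) = fine (m (A `&` @circle R)).
Proof.
move=> mA; rewrite Re_cint /=.
have mc : measurable (@circle R : set (borelC R)) by exact: measurable_circle.
have h := @integral_indic _ _ _ m _ mc _ mA.
exact: (congr1 fine h).
Qed.

Lemma measurable_set1C (z : R[i]) : measurable ([set z] : set (borelC R)).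
Proof.
rewrite -[X in measurable X]setCK; apply: measurableC; apply: open_measurableC.
apply/openC_P => w /= wz; exists (cabs (w - z)).
  by rewrite cabs_gt0 subr_eq0; apply/eqP.
by move=> v h vz; move: h; rewrite vz ltxx.
Qed.

Lemma measurable_finite (A : set (borelC R)) : measurable A ->
  ((fine (m A))%:E = m A)%E.
Proof. by move=> mA; rewrite fineK// fin_num_measure. Qed.

Lemma measureI_circle (A : set (borelC R)) :
  m (~` @circle R) = 0%E -> measurable A -> m (A `&` @circle R) = m A.
Proof.
move=> m0 mA; have mc : measurable (@circle R : set (borelC R)) by exact: measurable_circle.
rewrite [RHS](measureDI m mA mc); set x := (X in _ = (X + _)%E).
suff -> : x = 0%E by rewrite add0e.
apply/eqP; rewrite eq_le measure_ge0 andbT -m0; apply: le_measure; rewrite ?inE.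
- exact: measurableD.
- exact: measurableC.
- by move=> z [].
Qed.

End Indicators.

Section SpectrumAndMasses.
Variables (R : realType) (mu : probability (borelC R) R).
Hypothesis mu_circle : mu (@circle R) = 1%E.
Notation cint := (cintegral mu (@circle R)).
Notation ip := (ip mu).
Notation nsq := (nsq mu).

Lemma mu_off_circle (A : set (borelC R)) : measurable A ->
  (forall z, A z -> cabs z <> 1) -> mu A = 0%E.
Proof.
move=> mA h; apply/eqP; rewrite eq_le measure_ge0 andbT.
have -> : 0%E = mu (~` @circle R).
  rewrite probability_setC; last exact: measurable_circle.
  by rewrite mu_circle subee.
apply: le_measure; rewrite ?inE//.
  by apply: measurableC; exact: measurable_circle.
by move=> z /h h1 /circleP.
Qed.

Lemma cint_cindic_mu (A : set (borelC R)) : measurable A ->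
  complex.Re (cint (cindic A)) = fine (mu A).
Proof.
move=> mA; apply: etrans (cint_cindic mu mA) _; congr fine.
apply: measureI_circle => //; apply: mu_off_circle.
  by apply: measurableC; exact: measurable_circle.
by move=> z zc /circleP.
Qed.

Lemma mass_point_circle z : mass_point mu z -> cabs z = 1.
Proof.
rewrite /mass_point => z0; apply: contrapT => z1; move: z0.
rewrite mu_off_circle ?ltxx//; first exact: measurable_set1C.
by move=> w ->.
Qed.

Lemma open_off_circle : open [set z : R[i] | cabs z <> 1].
Proof.
apply/openC_P => z /= /eqP z1; exists `|cabs z - 1|.
  by rewrite normr_gt0 subr_eq0.
move=> w zw w1; move: zw; rewrite -w1 ltNge => /negP; apply.
have := cabsD (z - w) w; have := cabsD (w - z) z; rewrite !subrK cabsB.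
by rewrite ler_norml => h1 h2; apply/andP; split; lra.
Qed.

Lemma support_circle z : msupport mu z -> cabs z = 1.
Proof.
move=> h; apply: contrapT => z1.
have := h _ open_off_circle z1; rewrite mu_off_circle ?ltxx//.
by apply: open_measurableC; exact: open_off_circle.
Qed.

Variable chi : nat -> R[i] -> R[i].
Hypothesis chi_adm : forall n, admissible (chi n).
Hypothesis chi_on : forall i j, ip (chi i) (chi j) = (i == j)%:R.
Hypothesis chi_0 : forall z, chi 0%N z = 1.
Variables (U V : l2 R -> l2 R).
Hypothesis bU : bounded_op U.
Hypothesis bV : bounded_op V.
Hypothesis U_iso : forall x, l2norm (U x) = l2norm x.
Hypothesis UV : forall x, U (V x) = x.
Hypothesis VU : forall x, V (U x) = x.
Hypothesis VU_adj : adjoints V U.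
Hypothesis V_chi : forall i n, V (l2e R i) n = ip (chi n) (fun z => z^* * chi i z).

Notation represents := (represents mu chi).

Lemma represents_polyfac s :
  represents (polyfac s) (opfac U s (l2e R 0)).
Proof.
have := represents_fac chi_adm chi_on U_iso UV VU_adj V_chi s
  (represents_chi chi_adm chi_on 0).
by congr represents; apply/funext => z; rewrite chi_0 mulr1.
Qed.

Lemma V_iso x : l2norm (V x) = l2norm x.
Proof. by rewrite -U_iso UV. Qed.

(** Only the equation for V = U^dag is a recurrence, so the eigenvalue equation of U is transferred
    to it. *)
Lemma eigen_UV z x : cabs z = 1 -> U x = z *: x <-> V x = z^* *: x.
Proof.
move=> z1; split=> e.
  have h : x = z *: V x by rewrite -(bopZ bV.1) -e VU.
  by rewrite [in RHS]h scalerA conjM_cabs z1 expr1n rmorph1 scale1r.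
have h : x = z^* *: U x by rewrite -(bopZ bU.1) -e UV.
by rewrite [in RHS]h scalerA mulC_conj z1 expr1n rmorph1 scale1r.
Qed.

Lemma eigenvalue_circle z x : x != 0 -> U x = z *: x -> cabs z = 1.
Proof.
move=> x0 e; have := U_iso x; rewrite e l2normZ -[RHS]mul1r.
by apply: mulIf; rewrite l2norm_eq0.
Qed.

Lemma inner_opfac z x s y : V x = z^* *: x ->
  l2inner x (opfac U s y) = polyfac s z * l2inner x y.
Proof.
move=> e; elim: s => [|c s IH]; first by rewrite /polyfac big_nil mul1r.
rewrite /= l2innerBr l2innerZr -VU_adj e l2innerZl conjCK IH /polyfac big_cons.
by ring.
Qed.

Lemma polyfac_nseq N (z w : R[i]) : polyfac (nseq N z) w = (w - z) ^+ N.
Proof.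
elim: N => [|N IH]; first by rewrite /polyfac big_nil expr0.
by rewrite /polyfac big_cons -/(polyfac _ _) IH exprS.
Qed.

Lemma circle_parallelogram (z w : R[i]) : cabs z = 1 -> cabs w = 1 ->
  cabs (w + z) ^+ 2 / 4 = 1 - cabs (w - z) ^+ 2 / 4.
Proof.
move=> z1 w1; have := cabs2E z; have := cabs2E w; rewrite z1 w1 !expr1n.
by rewrite !cabs2E !ReD !ImD ReN ImN; lra.
Qed.

Definition peak z N w : R := (cabs (w + z) ^+ 2 / 4) ^+ N.

Lemma cmeasurable_peak z N : cmeasurable (fun w => ((peak z N w)%:C)%C).
Proof.
apply: cmeasurable_real; apply: measurable_funX; apply: measurable_funM => //.
apply: measurable_cabs2; apply: cmeasurableD; first exact: cmeasurable_id.
exact: cmeasurable_cst.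
Qed.

Lemma peak_bound z N w : cabs z = 1 -> cabs w = 1 -> 0 <= peak z N w <= 1.
Proof.
move=> z1 w1; rewrite /peak exprn_ge0 ?divr_ge0 ?sqr_ge0//=.
rewrite exprn_ile1 ?divr_ge0 ?sqr_ge0// circle_parallelogram//.
by rewrite lerBlDr lerDl divr_ge0 ?sqr_ge0.
Qed.

Lemma admissible_peak z N : cabs z = 1 -> admissible (fun w => ((peak z N w)%:C)%C).
Proof.
move=> z1; split; first exact: cmeasurable_peak.
exists 1 => w w1; rewrite cabs_real; have /andP[h1 h2] := peak_bound N z1 w1.
by rewrite ger0_norm.
Qed.

(** [polyfac] is monic: N roots at -z give (w + z)^N, which is 2^N times the polynomial equal to 1
    in modulus at z. *)
Lemma nsq_peak z N : cabs z = 1 -> nsq (polyfac (nseq N (- z))) =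
  4 ^+ N * complex.Re (cint (fun w => ((peak z N w)%:C)%C)).
Proof.
move=> z1; transitivity (complex.Re (cint (fun w => ((4 ^+ N)%:C)%C * ((peak z N w)%:C)%C))).
  rewrite nsqE; congr complex.Re; apply: eq_cint => w _; rewrite -rmorphM /=.
  rewrite polyfac_nseq opprK cabsX /peak expr_div_n mulrCA divff ?mulr1 ?expf_neq0//.
  by rewrite exprAC.
by rewrite cintZ; [rewrite ReM mul0r subr0|exact: admissible_peak].
Qed.

(* Cauchy-Schwarz for x and p(U) e_0, with p a power of w + z: the inner product
   is p(z), and ||p(U) e_0||^2 / |p(z)|^2 tends to the mass at z. *)
Lemma mass_lower z (x : l2 R) : cabs z = 1 -> (forall n, x n = (chi n z)^*) ->
  V x = z^* *: x -> 1 <= l2norm x ^+ 2 * fine (mu [set z]).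
Proof.
move=> z1 xE e; pose I N := complex.Re (cint (fun w => ((peak z N w)%:C)%C)).
have h N : 1 <= l2norm x ^+ 2 * I N.
  pose s := nseq N (- z).
  have [_ _ n1] := represents_polyfac s.
  have cs : cabs (polyfac s z) ^+ 2 <= (l2norm x * l2norm (opfac U s (l2e R 0))) ^+ 2.
    rewrite ler_pXn2r ?nnegrE ?cabs_ge0 ?mulr_ge0 ?l2norm_ge0//.
    have := cauchy_schwarz x (opfac U s (l2e R 0)).
    by rewrite (inner_opfac _ _ e) l2inner_er xE conjCK chi_0 mulr1.
  move: cs; rewrite exprMn -n1 nsq_peak// polyfac_nseq opprK cabsX.
  have -> : cabs (z + z) = 2.
    rewrite (_ : z + z = (2%:C)%C * z).
      by rewrite cabsM z1 mulr1 cabs_real ger0_norm.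
    by apply: complex_ext; rewrite ?(ReM, ImM, ReD, ImD) /=; ring.
  rewrite exprAC (_ : 2 ^+ 2 = 4); last by rewrite expr2 -natrM.
  by rewrite mulrCA -[X in X <= _]mulr1 ler_pM2l// exprn_gt0.
have cv : I N @[N --> \oo] --> complex.Re (cint (cindic [set z])).
  apply: (proj1 ((cvg_ReImP _ _).1 _)).
  apply: (@cvg_cint _ mu (fun N w => ((peak z N w)%:C)%C)
    (cindic [set z]) 1).
  - by move=> N; exact: cmeasurable_peak.
  - by apply: cmeasurable_cindic; exact: measurable_set1C.
  - move=> N w w1; rewrite cabs_real.
    by have /andP[h1 h2] := peak_bound N z1 w1; rewrite ger0_norm.
  - move=> w w1; apply/cvg_ReImP; split => /=; last exact: cvg_cst.
    rewrite /peak circle_parallelogram// indicE.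
    have [->|wz] := eqVneq w z.
      rewrite mem_set// subrr cabs0 expr0n mul0r subr0.
      by under eq_fun do rewrite expr1n; exact: cvg_cst.
    rewrite memNset; last by move=> /= /eqP; rewrite (negbTE wz).
    apply: cvg_expr; rewrite -circle_parallelogram// ger0_norm ?divr_ge0 ?sqr_ge0//.
    rewrite circle_parallelogram// gtrBl divr_gt0// exprn_gt0// cabs_gt0.
    by rewrite subr_eq0.
have -> : fine (mu [set z]) = complex.Re (cint (cindic [set z])).
  by rewrite cint_cindic_mu//; exact: measurable_set1C.
have cv2 : l2norm x ^+ 2 * I N @[N --> \oo] -->
    l2norm x ^+ 2 * complex.Re (cint (cindic [set z])).
  by apply: cvgM => //; exact: cvg_cst.
rewrite -(cvg_lim (@Rhausdorff R) cv2); apply: limr_ge.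
  by apply/cvg_ex; eexists; exact: cv2.
exact: nearW.
Qed.

(* Bessel's inequality for the indicator function of {z}. *)
Lemma mass_upper z : cabs z = 1 -> mass_point mu z -> forall N,
  \sum_(k < N) cabs (chi k z) ^+ 2 <= (fine (mu [set z]))^-1.
Proof.
move=> z1 mz N; have mz1 := @measurable_set1C R z.
have M0 : 0 < fine (mu [set z]).
  by rewrite -lte_fin measurable_finite.
have hi := admissible_cindic mz1.
have ci : cint (cindic [set z]) = ((fine (mu [set z]))%:C)%C.
  apply: complex_ext; last first.
    rewrite Im_cint /=; apply: etrans (Rintegral_cst _ _ _) _.
      exact: measurable_circle.
    by rewrite mul0r.
  by rewrite cint_cindic_mu.
have e1 k : ip (chi k) (cindic [set z]) = (chi k z)^* * ((fine (mu [set z]))%:C)%C.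
  rewrite -ci -cintZ//; apply: eq_cint => w _; rewrite /cindic indicE.
  have [->//|wz] := eqVneq w z.
  rewrite memNset ?mulr0//.
  by move=> /= /eqP; rewrite (negbTE wz).
have e2 : nsq (cindic [set z]) = fine (mu [set z]).
  transitivity (complex.Re (cint (cindic [set z]))); last by rewrite ci.
  rewrite nsqE; congr complex.Re; apply: eq_cint => w _; rewrite /cindic indicE.
  by case: (w \in _); rewrite cabs_real ?normr1 ?normr0 ?expr1n ?expr0n.
have := bessel chi_adm chi_on hi N; rewrite e2.
under eq_bigr do rewrite e1 cabsM cabsJ cabs_real (gtr0_norm M0) exprMn.
rewrite -mulr_suml => h; rewrite -[X in _ <= X]mulr1 ler_pdivlMl//.
by rewrite -(ler_pM2r M0) mul1r mulrC mulrA -expr2 mulrC.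
Qed.

Definition resolvent_op z : l2 R -> l2 R := U \- *:%R z.

Lemma bounded_resolvent_op z : bounded_op (resolvent_op z).
Proof. by apply: bounded_sub => //; exact: bounded_scale. Qed.

Lemma bounded_resolvent_adj z : bounded_op (V \- *:%R z^* ).
Proof. by apply: bounded_sub => //; exact: bounded_scale. Qed.

Lemma resolvent_adj z : adjoints (V \- *:%R z^* ) (resolvent_op z).
Proof.
by move=> x y; rewrite /= l2innerBl l2innerBr l2innerZl l2innerZr conjCK VU_adj.
Qed.

Lemma resolvent_norm z x : l2norm (resolvent_op z x) ^+ 2 =
  l2norm x ^+ 2 + cabs z ^+ 2 * l2norm x ^+ 2
    - 2 * complex.Re (z * l2inner (U x) x).
Proof. by rewrite l2norm_subZ_sqr U_iso. Qed.

Lemma resolvent_adj_norm z x :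
  l2norm ((V \- *:%R z^* ) x) = l2norm (resolvent_op z x).
Proof.
apply: l2norm_sqr_inj; apply: etrans (esym (resolvent_norm z x)).
apply: etrans (l2norm_subZ_sqr z^* (V x) x) _.
rewrite (V_iso x) (cabsJ z); congr (_ - 2 * _).
rewrite (VU_adj x x) (l2innerC (U x) x) -(rmorphM (@Num.conj R[i])).
exact: ReJ.
Qed.

(** U - z is normal, so its adjoint satisfies the same lower bound and [coercive_inverse]
    applies. *)
Lemma off_spectrum z (d : R) : 0 < d ->
  (forall x, d * l2norm x <= l2norm (resolvent_op z x)) -> ~ spectrum U z.
Proof.
move=> d0 hd; apply.
apply: (coercive_inverse (bounded_resolvent_op z) (bounded_resolvent_adj z)
  (resolvent_adj z) d0 hd) => x.
by rewrite resolvent_adj_norm.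
Qed.

(* The peak functions decay at most like any power (1 - d)^N on the support,
   but they would decay geometrically off the spectrum. *)
Lemma support_spectrum z : msupport mu z -> spectrum U z.
Proof.
move=> zs [S [bS SU _]]; have z1 := support_circle zs.
have [K0 K0_gt0 hK0] := bounded_opM bS.
(* K >= 1 makes A = 4 K^2 exceed 1, so that the decay rate 1 - 1/A lies strictly between 0 and 1. *)
pose K := K0 + 1.
have K1 : 1 <= K by rewrite lerDr ltW.
have hK x : l2norm x <= K * l2norm (resolvent_op z x).
  have /(congr1 (fun T => T x)) /= e := SU; rewrite -[in X in X <= _]e.
  apply: (le_trans (hK0 _)); rewrite ler_wpM2r ?l2norm_ge0//.
  by rewrite lerDl.
pose I N := complex.Re (cint (fun w => ((peak z N w)%:C)%C)).
pose A := 4 * K ^+ 2.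
have A1 : 1 < A by rewrite /A; nra.
have step N : I N.+1 <= (1 - A^-1) * I N.
  (* The bound by K is applied to p(U) e_0 with p = (w + z)^N. On the circle |w - z|^2 = 4 (1 - |w +
     z|^2 / 4), which turns the extra factor into a difference of consecutive I. *)
  have key : I N <= A * (I N - I N.+1).
    pose s := nseq N (- z).
    have [_ _ n1] := represents_polyfac s.
    have [_ _ n2] := represents_polyfac (z :: s).
    have h : nsq (polyfac s) <= K ^+ 2 * nsq (polyfac (z :: s)).
      have K_ge0 : 0 <= K by apply: le_trans K1.
      rewrite n1 n2 -exprMn ler_pXn2r ?nnegrE ?(mulr_ge0 K_ge0) ?l2norm_ge0//.
    have e2 : nsq (polyfac (z :: s)) = 4 ^+ N * (4 * (I N - I N.+1)).
      have -> : I N - I N.+1 = complex.Re (cint (fun w =>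
          ((peak z N w)%:C)%C - ((peak z N.+1 w)%:C)%C)).
        by rewrite cintB ?ReD ?ReN//; exact: admissible_peak.
      rewrite mulrA -exprSr.
      have adm : admissible (fun w => ((peak z N w)%:C)%C - ((peak z N.+1 w)%:C)%C).
        by apply: admissibleB; exact: admissible_peak.
      transitivity (complex.Re (((4 ^+ N.+1)%:C)%C * cint (fun w =>
          ((peak z N w)%:C)%C - ((peak z N.+1 w)%:C)%C))); last first.
        by rewrite ReM mul0r subr0.
      rewrite -cintZ// nsqE; congr complex.Re; apply: eq_cint => w w1.
      rewrite -rmorphB -rmorphM; congr ((_)%:C)%C.
      rewrite /polyfac big_cons -/(polyfac _ _) polyfac_nseq opprK cabsM cabsX.
      have e1 : peak z N.+1 w = (1 - cabs (w - z) ^+ 2 / 4) * peak z N w.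
        by rewrite -circle_parallelogram// -exprS.
      have e2 : (cabs (w + z) ^+ N) ^+ 2 = 4 ^+ N * peak z N w.
        by rewrite /peak expr_div_n mulrCA divff ?mulr1 ?expf_neq0// exprAC.
      rewrite exprMn e2 e1 (exprS 4 N); move: (4 ^+ N) (peak z N w) => F p; field; done.
    have F0 : 0 < (4 : R) ^+ N by rewrite exprn_gt0.
    rewrite -(ler_pM2l F0) (_ : 4 ^+ N * (A * (I N - I N.+1)) =
      K ^+ 2 * (4 ^+ N * (4 * (I N - I N.+1)))); last first.
      by rewrite /A; move: (4 ^+ N) (I N) (I N.+1) => F u v; ring.
    by rewrite -e2 /I -nsq_peak.
  have A0 : 0 < A by apply: lt_trans A1.
  have : A^-1 * I N <= I N - I N.+1.
    by rewrite -(ler_pM2l A0) mulrA divff ?gt_eqF// mul1r.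
  by rewrite mulrBl mul1r; lra.
pose q := 1 - A^-1.
have A0 : 0 < A by apply: lt_trans A1.
have q0 : 0 < q by rewrite subr_gt0 invf_lt1.
have I_le N : I N <= q ^+ N.
  elim: N => [|N IH].
    rewrite expr0 /I; have -> : (fun w => ((peak z 0 w)%:C)%C) = (fun=> (1%:C)%C).
      by apply/funext => w; rewrite /peak expr0.
    by rewrite cint_cst.
  by apply: le_trans (step N) _; rewrite exprS ler_pM2l.
(* Half of the rate 1/A: near z the peak function is at least (1 - d)^N, and 1 - d still exceeds q =
   1 - 1/A. *)
pose d := A^-1 / 2.
have d0 : 0 < d by rewrite divr_gt0 ?invr_gt0.
pose D : set R[i] := [set w | cabs (w - z) ^+ 2 / 4 < d].
have oD : open D.
  pose e := Num.sqrt (4 * d).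
  have eE w : (cabs (w - z) ^+ 2 / 4 < d) = (cabs (w - z) < e).
    rewrite ltr_pdivrMr// mulrC -[4 * d]sqr_sqrtr ?(mulr_ge0 _ (ltW d0))//.
    by rewrite ltr_pXn2r ?nnegrE ?cabs_ge0 ?sqrtr_ge0.
  apply/openC_P => w; rewrite /D /= eE => we; exists (e - cabs (w - z)).
    by rewrite subr_gt0.
  move=> v wv; rewrite eE; have := cabsD (v - w) (w - z).
  by rewrite addrA subrK [cabs (v - w)]cabsB; lra.
have Dz : D z by rewrite /D /= subrr cabs0 expr0n mul0r.
have mD : measurable (D : set (borelC R)) by exact: open_measurableC.
pose M := complex.Re (cint (cindic D)).
have M0 : 0 < M.
  rewrite /M cint_cindic_mu// -lte_fin measurable_finite//.
  exact: zs.
have d1 : d < 1.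
  have Ai1 : A^-1 < 1 by rewrite invf_lt1.
  by rewrite /d; lra.
have le_I N : (1 - d) ^+ N * M <= I N.
  have adm := admissible_cindic mD.
  have -> : (1 - d) ^+ N * M =
      complex.Re (cint (fun w => (((1 - d) ^+ N)%:C)%C * cindic D w)).
    by rewrite cintZ// ReM mul0r subr0.
  apply: cint_le.
  - by apply: admissibleM => //; exact: admissible_cst.
  - exact: admissible_peak.
  move=> w w1; rewrite /cindic -rmorphM /= indicE.
  case: (boolP (w \in D)) => [|_]; last first.
    by rewrite mulr0; have /andP[] := peak_bound N z1 w1.
  rewrite inE /D /= => wD; rewrite mulr1 /peak circle_parallelogram//.
  by apply: lerXn2r; rewrite ?nnegrE; lra.
have qd0 : 0 <= q / (1 - d) by rewrite divr_ge0 ?ltW// subr_gt0.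
have qd1 : `|q / (1 - d)| < 1.
  rewrite ger0_norm// ltr_pdivrMr ?subr_gt0// mul1r /q /d.
  by have : A^-1 > 0; [rewrite invr_gt0|lra].
have := cvg_expr qd1 => cv.
suff : M <= 0 by rewrite leNgt M0.
rewrite -(cvg_lim (@Rhausdorff R) cv); apply: limr_ge.
  by apply/cvg_ex; eexists; exact: cv.
apply: nearW => N /=; rewrite expr_div_n ler_pdivlMr ?exprn_gt0 ?subr_gt0//.
by rewrite mulrC (le_trans (le_I N)).
Qed.

Lemma represents0 : represents (fun=> 0) 0.
Proof.
split; first exact: admissible_cst.
  move=> n; transitivity (cint (fun=> 0)); last exact: (cint0 mu).
  by apply: eq_cint => z _; rewrite mulr0.
transitivity (complex.Re (cint (fun=> 0))); last by rewrite cint0 l2norm0 expr0n.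
by congr complex.Re; apply: eq_cint => z _; rewrite mulr0.
Qed.

Lemma represents_trunc (x : l2 R) N :
  represents (fun z => \sum_(k < N) x k * chi k z) (trunc x N).
Proof.
elim: N => [|N IH].
  rewrite (_ : (fun z => _) = (fun=> 0)); last by apply/funext => z; rewrite big_ord0.
  by rewrite /trunc big_ord0; exact: represents0.
have := represents_add chi_adm chi_on (x N) IH (represents_chi chi_adm chi_on N).
rewrite /trunc big_ord_recr; congr represents.
by apply/funext => z; rewrite big_ord_recr.
Qed.

Lemma represents_resolvent z g v : represents g v ->
  represents (fun w => (w - z) * g w) (resolvent_op z v).
Proof.
move=> rg; have := represents_fac chi_adm chi_on U_iso UV VU_adj V_chi [:: z] rg.
by congr represents; apply/funext => w; rewrite /polyfac big_seq1.
Qed.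

(** With M a bound of |f| on the circle, adding (e M)^2 times the indicator of W makes the
    inequality of integrands valid at every point of the circle, at the cost of a term of integral
    0. *)
Lemma nsq_null (W : set (borelC R)) z (e : R) f : measurable W -> mu W = 0%E ->
  (forall w, ~ W w -> e <= cabs (w - z)) -> 0 <= e -> admissible f ->
  e ^+ 2 * nsq f <= nsq (fun w => (w - z) * f w).
Proof.
move=> mW W0 hW e0 hf; have [_ [M hM]] := hf.
pose h w := ((cabs (f w) ^+ 2)%:C)%C.
have ah : admissible h by exact: admissible_cabs2.
have aW := admissible_cindic mW.
pose c := (((e * M) ^+ 2)%:C)%C.
have aT : admissible (fun w => ((cabs ((w - z) * f w) ^+ 2)%:C)%C).
  apply: admissible_cabs2; apply: admissibleM => //; apply: admissibleB.
    exact: admissible_id.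
  exact: admissible_cst.
have aS : admissible (fun w => ((cabs ((w - z) * f w) ^+ 2)%:C)%C + c * cindic W w).
  by apply: admissibleD => //; apply: admissibleM => //; exact: admissible_cst.
have le : complex.Re (cint (fun w => ((e ^+ 2)%:C)%C * h w)) <=
    complex.Re (cint (fun w => ((cabs ((w - z) * f w) ^+ 2)%:C)%C + c * cindic W w)).
  apply: cint_le => //.
    by apply: admissibleM => //; exact: admissible_cst.
  move=> w w1; rewrite /c /cindic -!rmorphM -rmorphD /= indicE cabsM exprMn.
  case: (boolP (w \in W)) => [_|/negP].
    rewrite mulr1 exprMn -[X in X <= _]add0r.
    rewrite lerD ?(mulr_ge0 (sqr_ge0 _) (sqr_ge0 _))//.
    rewrite ler_wpM2l ?sqr_ge0// lerXn2r ?nnegrE ?cabs_ge0 ?hM//.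
    exact: le_trans (cabs_ge0 _) (hM w w1).
  rewrite inE mulr0 addr0 => /hW ew; rewrite ler_wpM2r ?sqr_ge0//.
  by rewrite lerXn2r ?nnegrE ?cabs_ge0.
rewrite cintZ// ReM mul0r subr0 -nsqE in le.
rewrite cintD// in le; last first.
  by apply: admissibleM => //; exact: admissible_cst.
have e3 : complex.Re (cint (fun w => c * cindic W w)) = 0.
  rewrite cintZ// ReM mul0r subr0.
  have -> : complex.Re (cint (cindic W)) = 0.
    by rewrite cint_cindic_mu// W0.
  by rewrite mulr0.
by rewrite ReD e3 addr0 -nsqE in le.
Qed.

(** A truncation represents a finite sum of the chi_k, for which the lower bound on U - z is an
    inequality of integrals. Density of the truncations extends it to all of l^2. *)
Lemma spectrum_support z : spectrum U z -> msupport mu z.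
Proof.
move=> sz W oW Wz; rewrite lt0e measure_ge0 andbT; apply/eqP => W0; move: sz.
have [e e0 he] := (openC_P W).1 oW z Wz.
have mW : measurable (W : set (borelC R)) by exact: open_measurableC.
have hT N x : e * l2norm (trunc x N) <= l2norm (resolvent_op z (trunc x N)).
  have rt := represents_trunc x N; have [at_ _ n1] := rt.
  have [_ _ n2] := represents_resolvent z rt.
  rewrite -(@ler_pXn2r _ 2) ?nnegrE ?l2norm_ge0 ?(mulr_ge0 (ltW e0)) ?l2norm_ge0//.
  rewrite exprMn -n1 -n2; apply: (nsq_null mW) => //; last exact: ltW.
  move=> w Ww; rewrite leNgt; apply/negP => h; apply: Ww; apply: he.
  by rewrite cabsB.
apply: (off_spectrum e0) => x.
have bR := bounded_resolvent_op z; have [K K0 hK] := bounded_opM bR.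
have key N : e * l2norm x - (e + K) * l2norm (x - trunc x N) <= l2norm (resolvent_op z x).
  have h1 := ler_l2normD (x - trunc x N) (trunc x N); rewrite subrK in h1.
  have h2 := ler_l2normD (resolvent_op z x) (- resolvent_op z (x - trunc x N)).
  rewrite -(bopB bR.1) subKr l2normN in h2.
  have h3 := hK (x - trunc x N); have h4 := hT N x.
  have h5 : e * l2norm x <= e * (l2norm (x - trunc x N) + l2norm (trunc x N)).
    by rewrite ler_pM2l.
  by lra.
have cv : e * l2norm x - (e + K) * l2norm (x - trunc x N) @[N --> \oo] -->
    e * l2norm x - (e + K) * 0.
  apply: cvgB; first exact: cvg_cst.
  by apply: cvgM; [exact: cvg_cst|exact: cvg_trunc].
rewrite mulr0 subr0 in cv.
rewrite -(cvg_lim (@Rhausdorff R) cv); apply: limr_le.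
  by apply/cvg_ex; eexists; exact: cv.
exact: nearW.
Qed.

End SpectrumAndMasses.

Lemma sqsum_cabs (R : realType) (u v : nat -> R[i]) :
  (forall n, cabs (u n) = cabs (v n)) -> sqsum u = sqsum v.
Proof. by move=> h; apply: eq_eseriesr => n _; rewrite h. Qed.

(** * Eigenvectors and mass points *)

Section EigenvectorsAndMasses.
Variables (R : realType) (alpha a : nat -> R[i]) (phi : nat -> ratfun R) (r : R).
Variable mu : probability (borelC R) R.
Hypothesis alpha_r : forall n, cabs (alpha n) <= r.
Hypothesis r1 : r < 1.
Hypothesis mu_circle : mu (@circle R) = 1%E.
Hypothesis phi_ORF : is_ORF alpha mu phi a.

Local Notation chi := (chi_of alpha phi).
Local Notation U := (U alpha a).

Let a1 := orf_disk phi_ORF.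
Let phi_0 := orf_0 phi_ORF.
Let phi_rec := orf_rec phi_ORF.
Let phi_rec_star := orf_rec_star phi_ORF.
Let phi_on : forall i j, ip mu (reval (phi i)) (reval (phi j)) = (i == j)%:R :=
  orf_orthonormal phi_ORF.

Definition chi_val z n := (reval (chi n) z)^*.

Lemma rec0_add (u v : nat -> R[i]) c k :
  rec0 alpha a (fun n => u n + c * v n) k = rec0 alpha a u k + c * rec0 alpha a v k.
Proof. by rewrite /rec0 /paircoord /normalize; ring. Qed.

Lemma rec1_add (u v : nat -> R[i]) c k :
  rec1 alpha a (fun n => u n + c * v n) k = rec1 alpha a u k + c * rec1 alpha a v k.
Proof. by rewrite /rec1 /paircoord /normalize; ring. Qed.

Lemma recZ (u : nat -> R[i]) c k :
  rec0 alpha a (fun n => c * u n) k = c * rec0 alpha a u k /\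
  rec1 alpha a (fun n => c * u n) k = c * rec1 alpha a u k.
Proof. by rewrite /rec0 /rec1 /paircoord /normalize; split; ring. Qed.

Lemma chi_val0 z : chi_val z 0 = 1.
Proof. by rewrite /chi_val (reval_chi0 alpha phi_0) conjC1. Qed.

Lemma chi_val_rec z : (forall n, ~ is_pole (chi n) z) -> forall k,
  rec0 alpha a (chi_val z) k = z^* * rec1 alpha a (chi_val z) k.
Proof.
move=> np k; exact: (chi_recurrence alpha_r r1 a1 phi_0 phi_rec phi_rec_star np k).
Qed.

Lemma circle_no_pole z : cabs z = 1 -> forall n, ~ is_pole (chi n) z.
Proof. by move=> z1 n; exact: (chi_no_pole alpha_r r1 phi_0 phi_rec phi_rec_star z1). Qed.

Lemma adjoint_eigen V z (x : l2 R) : adjoints V U ->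
  V x = z^* *: x <-> forall k, rec0 alpha a x k = z^* * rec1 alpha a x k.
Proof.
move=> ad; rewrite (adjoint_U_char alpha_r r1 a1 _ _ ad).
by split=> h k; have [_ e] := recZ x z^* k; [rewrite -e; exact: h|apply: etrans (h k) (esym e)].
Qed.

Section WithInverse.
Variable V : l2 R -> l2 R.
Hypothesis bV : bounded_op V.
Hypothesis VU : forall x, V (U x) = x.
Hypothesis UV : forall x, U (V x) = x.
Hypothesis ad : adjoints V U.

Let bU : bounded_op U. Proof. exact: (bounded_U alpha_r r1 a1). Qed.
Let U_iso x : l2norm (U x) = l2norm x. Proof. exact: (U_isometry alpha_r r1 a1). Qed.
Let chi_adm n : admissible (reval (chi n)). 
Proof. exact: (admissible_reval_chi alpha_r r1 a1 phi_0 phi_rec phi_rec_star n). Qed.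
Let chi_on i j : ip mu (reval (chi i)) (reval (chi j)) = (i == j)%:R.
Proof. exact: (chi_orthonormal alpha_r r1 a1 phi_0 phi_rec phi_rec_star phi_on). Qed.
Let chi_0 z : reval (chi 0%N) z = 1. Proof. exact: (reval_chi0 alpha phi_0). Qed.
Let V_chi i n : V (l2e R i) n = ip mu (reval (chi n)) (fun z => z^* * reval (chi i) z).
Proof. exact: (V_entries alpha_r r1 a1 phi_0 phi_rec phi_rec_star phi_on ad). Qed.

Lemma eigen_chi z (x : l2 R) : cabs z = 1 ->
  U x = z *: x <-> exists c, forall n, x n = c * chi_val z n.
Proof.
move=> z1; rewrite (eigen_UV bU bV UV VU x z1) adjoint_eigen//.
have cr := chi_val_rec (circle_no_pole z1).
split=> [h|[c h] k].
  (* The difference solves the recurrence and starts with 0. It is handled as a plain sequence, as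
     conj(chi_n(z)) is not yet known to be square summable. *)
  exists (x 0%N) => n; apply/eqP; rewrite -subr_eq0 -mulNr; apply/eqP.
  apply: (rec_unique alpha_r r1 a1 (z := z^* )
    (u := fun n => x n + - x 0%N * chi_val z n)).
  - by rewrite cabsJ.
  - by rewrite chi_val0 mulr1 subrr.
  - by move=> k; rewrite rec0_add rec1_add h cr; ring.
have -> : (x : nat -> R[i]) = fun n => c * chi_val z n by apply/funext.
by have [-> ->] := recZ (chi_val z) c k; rewrite cr mulrCA.
Qed.

Lemma chi_mass z (x : l2 R) : (forall n, ~ is_pole (chi n) z) ->
  (forall n, x n = chi_val z n) -> cabs z = 1 /\ mass_point mu z.
Proof.
move=> np xE.
have e : V x = z^* *: x.
  apply/adjoint_eigen => // k; have -> : (x : nat -> R[i]) = chi_val z by apply/funext.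
  exact: chi_val_rec.
have x0 : x != 0.
  apply/eqP => x0; have := xE 0%N; rewrite x0 chi_val0 => /esym/eqP.
  by rewrite oner_eq0.
(* V preserves norms, so a nonzero square summable solution forces z onto the circle. *)
have z1 : cabs z = 1.
  have := V_iso U_iso UV x; rewrite e l2normZ cabsJ -[RHS]mul1r.
  by apply: mulIf; rewrite l2norm_eq0.
split => //.
have h := mass_lower mu_circle chi_adm chi_on chi_0 U_iso UV ad V_chi z1 xE e.
rewrite /mass_point lt0e measure_ge0 andbT; apply/eqP => h0; move: h.
by rewrite h0 mulr0 ler10.
Qed.

(** [mass_upper] makes conj(chi_n(z)) square summable, hence an eigenvector; [mass_lower] then
    applies and gives the reverse inequality. *)
Lemma mass_chi z : mass_point mu z ->
  [/\ cabs z = 1, in_l2 (fun n => reval (chi n) z) &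
     mu [set z] = ((sqsum (fun n => reval (chi n) z))^-1)%E].
Proof.
move=> mz; have z1 := mass_point_circle mu_circle mz.
have up := mass_upper mu_circle chi_adm chi_on z1 mz.
have i2 : in_l2 (chi_val z).
  by apply: (in_l2P (M := (fine (mu [set z]))^-1)) => N;
    under eq_bigr do rewrite cabsJ; exact: up.
have sE : sqsum (fun n => reval (chi n) z) = sqsum (chi_val z).
  by apply: sqsum_cabs => n; rewrite cabsJ.
split => //; first by rewrite /in_l2 sE.
have xE n : mkl2 i2 n = chi_val z n by [].
have e : V (mkl2 i2) = z^* *: mkl2 i2.
  apply/adjoint_eigen => // k; exact: (chi_val_rec (circle_no_pole z1)).
have h := mass_lower mu_circle chi_adm chi_on chi_0 U_iso UV ad V_chi z1 xE e.
have M0 : 0 < fine (mu [set z]).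
  by rewrite -lte_fin measurable_finite//; exact: measurable_set1C.
rewrite sE -[chi_val z]/(mkl2 i2 : nat -> R[i]) sqsum_fin.
have : (sqsum (mkl2 i2) <= ((fine (mu [set z]))^-1)%:E)%E.
  by apply: in_l2_bound => N; under eq_bigr do rewrite cabsJ; exact: up.
rewrite sqsum_fin lee_fin.
move: (l2norm _ ^+ 2) h => s h k.
have s0 : 0 < s by rewrite -(pmulr_lgt0 _ M0); exact: lt_le_trans h.
rewrite -[LHS]measurable_finite; last exact: measurable_set1C.
rewrite inver gt_eqF//; congr EFin; apply/eqP; rewrite -(inj_eq invr_inj) invrK.
rewrite eq_le k andbT -[leLHS]mul1r ler_pdivrMr//.
Qed.

Lemma msupport_spectrum : msupport mu = spectrum U.
Proof.
apply/seteqP; split => z.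
  exact: (support_spectrum mu_circle chi_adm chi_on chi_0 U_iso UV ad V_chi).
exact: (spectrum_support mu_circle chi_adm chi_on bU bV U_iso UV ad V_chi).
Qed.

Lemma chi_val_l2_mass z : (forall n, ~ is_pole (chi n) z) ->
  in_l2 (fun n => reval (chi n) z) -> mass_point mu z.
Proof.
move=> np h; have i2 : in_l2 (chi_val z).
  by rewrite /in_l2 (sqsum_cabs (v := fun n => reval (chi n) z))// => n; rewrite cabsJ.
by have [] := @chi_mass z (mkl2 i2) np.
Qed.

Lemma mass_eigenvalue z : mass_point mu z <-> is_eigenvalue U z.
Proof.
split=> [mz|[x x0 e]].
  have [z1 i1 _] := mass_chi mz.
  have i2 : in_l2 (chi_val z).
    by rewrite /in_l2 (sqsum_cabs (v := fun n => reval (chi n) z))// => n; rewrite cabsJ.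
  exists (mkl2 i2).
    apply/eqP => h; have : mkl2 i2 0%N = 0 by rewrite h.
    by move/eqP; rewrite -[mkl2 i2 0%N]/(chi_val z 0) chi_val0 oner_eq0.
  by apply/eigen_chi => //; exists 1 => n; rewrite mul1r.
have z1 := eigenvalue_circle U_iso x0 e.
have [c h] := (eigen_chi x z1).1 e.
have c0 : c != 0.
  apply: contraNneq x0 => c0; apply/eqP; apply: l2P => n; by rewrite h c0 mul0r.
have [] // := @chi_mass z (c^-1 *: x) (circle_no_pole z1).
by move=> n; rewrite l2Z h mulKf.
Qed.

Lemma eigenvalue_simple z : is_eigenvalue U z -> geometrically_simple U z.
Proof.
move=> ez; have [x x0 e] := ez; have z1 := eigenvalue_circle U_iso x0 e.
exists x => // y; split=> [ey|[c ->]]; last first.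
  by rewrite (bopZ bU.1) e !scalerA mulrC.
have [c h] := (eigen_chi x z1).1 e; have [d k] := (eigen_chi y z1).1 ey.
have c0 : c != 0.
  apply: contraNneq x0 => c0; apply/eqP; apply: l2P => n; by rewrite h c0 mul0r.
by exists (d / c); apply: l2P => n; rewrite l2Z k h mulrA divfK.
Qed.

End WithInverse.
End EigenvectorsAndMasses.

(** * Measures on the circle determined by squared moduli of polynomials *)

Section IntegralFacts.
Variable R : realType.
Import HBNNSimple.

(** In [is_spectral_measure] one integrates against a bare set function. The integral is built from
    simple functions and so sees only values on measurable sets. *)
Lemma eq_integral_setfun (m1 m2 : set (borelC R) -> \bar R) D (f : borelC R -> \bar R) :
  (forall A, measurable A -> m1 A = m2 A) ->
  (\int[m1]_(x in D) f x = \int[m2]_(x in D) f x)%E.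
Proof.
move=> h; rewrite /integral; congr (_ - _)%E; congr ereal_sup;
  apply/seteqP; split => _ [k kg <-]; exists k => //;
  rewrite /sintegral; apply: eq_fsbigr => r _; congr (_ * _)%E;
  by rewrite h//; exact: measurable_sfunP.
Qed.

(** m1 is dominated by m2, and its Radon-Nikodym derivative equals g almost everywhere, as both have
    the same integral over each measurable set. *)
Lemma integral_density (m1 m2 : {finite_measure set (borelC R) -> \bar R})
    (g : borelC R -> \bar R) :
  (forall z, 0 <= g z)%E -> m2.-integrable setT g ->
  (forall A, measurable A -> m1 A = \int[m2]_(z in A) g z)%E ->
  forall D (f : borelC R -> \bar R), measurable D -> measurable_fun D f ->
  (forall z, 0 <= f z)%E ->
  (\int[m1]_(z in D) f z = \int[m2]_(z in D) (f z * g z))%E.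
Proof.
move=> g0 ig h D f mD mf f0.
have dom : m1 `<< m2.
  apply/null_content_dominatesP => A mA A0; rewrite h//.
  by apply: null_set_integral => //; apply: measurable_funTS; exact: measurable_int ig.
rewrite -(Radon_Nikodym_SigmaFinite.change_of_variables dom f0 mD mf).
have iRN := Radon_Nikodym_SigmaFinite.f_integrable dom.
have mRN := measurable_int m2 iRN; have mg := measurable_int m2 ig.
apply: ae_eq_integral => //.
- by apply: emeasurable_funM => //; exact: measurable_funTS.
- by apply: emeasurable_funM => //; exact: measurable_funTS.
apply: ae_eqe_mul2l; apply: integral_ae_eq => //.
- exact: integrableS iRN.
- exact: measurable_funTS.
by move=> B BD mB; rewrite -h// -Radon_Nikodym_SigmaFinite.f_integral.
Qed.

Lemma bernoulli_ge (x : R) n : -1 <= x -> 1 + n%:R * x <= (1 + x) ^+ n.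
Proof.
move=> x1; elim: n => [|n IH]; first by rewrite mul0r addr0 expr0.
rewrite exprS -natr1.
have : (1 + x) * (1 + n%:R * x) <= (1 + x) * (1 + x) ^+ n.
  by rewrite ler_wpM2l//; lra.
apply: le_trans; have : 0 <= n%:R * (x * x) by rewrite mulr_ge0// -expr2 sqr_ge0.
by move: (n%:R) => m; nra.
Qed.

Lemma cvg_natX (q : R) : 0 <= q -> q < 1 -> n%:R * q ^+ n @[n --> \oo] --> (0 : R).
Proof.
move=> q0 q1; have [->|qn0] := eqVneq q 0.
  apply: cvg_near_cst; exists 1%N => // n /= n1.
  by rewrite expr0n gtn_eqF// mulr0.
(* One factor s^n compensates n, since s^-n >= n h by Bernoulli with h = 1/s - 1; the other tends to
   0. *)
pose s := Num.sqrt q; have s0 : 0 < s by rewrite sqrtr_gt0 lt_def qn0.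
have sq : q = s * s by rewrite -expr2 sqr_sqrtr.
have s1 : s < 1 by move: q1; rewrite sq; nra.
pose h := s^-1 - 1; have h0 : 0 < h by rewrite subr_gt0 invf_gt1.
have key n : n%:R * s ^+ n <= h^-1.
  have hb : 1 + n%:R * h <= s^-1 ^+ n.
    rewrite -[X in X ^+ n](subrKC 1); apply: bernoulli_ge.
    by rewrite -/h; lra.
  rewrite -(ler_pM2r h0) mulVf ?gt_eqF// mulrAC -ler_pdivlMr ?exprn_gt0// mul1r -exprVn.
  by apply: le_trans hb; rewrite lerDr.
have cv : h^-1 * s ^+ n @[n --> \oo] --> (0 : R).
  rewrite -(mulr0 h^-1); apply: cvgM; first exact: cvg_cst.
  by apply: cvg_expr; rewrite ger0_norm// ltW.
apply: (squeeze_cvgr _ (cvg_cst (0 : R)) cv); apply: nearW => n.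
rewrite mulr_ge0 ?exprn_ge0//= sq exprMn mulrA ler_wpM2r ?exprn_ge0 ?(ltW s0)//.
Qed.

(** Put x = u^n and m = n 2^n, so that m x = n (2u)^n. If u < 1/2 then (1 - x)^m >= 1 - m x, which
    tends to 1. If u >= 1/2 then (1 - x)^m <= (1 + x)^-m <= 1 / (1 + m x) <= 1 / (n + 1); the factor
    n in m takes care of u = 1/2. *)
Lemma cvg_soft_cut (u : R) : 0 <= u <= 1 ->
  (1 - u ^+ n) ^+ (n * 2 ^ n) @[n --> \oo] --> ((u < 1 / 2)%R%:R : R).
Proof.
move=> /andP[u0 u1].
have x01 n : 0 <= u ^+ n <= 1 by rewrite exprn_ge0//= exprn_ile1.
have mE n : (n * 2 ^ n)%:R * u ^+ n = n%:R * (2 * u) ^+ n :> R.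
  by rewrite natrM natrX -mulrA exprMn.
case: ltP => u2.
  have cv : 1 - n%:R * (2 * u) ^+ n @[n --> \oo] --> (1 : R).
    rewrite -[X in _ --> X]subr0; apply: cvgB; first exact: cvg_cst.
    by apply: cvg_natX; lra.
  apply: (squeeze_cvgr _ cv (cvg_cst (1 : R))); apply: nearW => n.
  have /andP[h1 h2] := x01 n; rewrite -mE -mulrN; apply/andP; split.
    by apply: bernoulli_ge; lra.
  by rewrite exprn_ile1; lra.
have cv := @cvg_harmonic R.
apply: (squeeze_cvgr _ (cvg_cst (0 : R)) cv); apply: nearW => n.
have /andP[h1 h2] := x01 n; rewrite exprn_ge0 ?subr_ge0//= /harmonic /=.
have : (1 - u ^+ n) ^+ (n * 2 ^ n) * (1 + u ^+ n) ^+ (n * 2 ^ n) <= 1.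
  by rewrite -exprMn exprn_ile1//; nra.
rewrite -ler_pdivlMr ?exprn_gt0//; last lra.
move=> /le_trans; apply; rewrite mul1r lef_pV2 ?posrE ?exprn_gt0//; last lra.
apply: le_trans (bernoulli_ge _ _); last lra.
rewrite mE -natr1 addrC lerD2l ler_peMr//.
by rewrite -[leLHS](expr1n _ n) lerXn2r ?nnegrE//; lra.
Qed.

(* [u = cut_pos a t] is affine in t, with values in [0, 1] when |t| <= 1, and
   u < 1/2 iff t < a; by Bernoulli's inequality (1 - u^n)^(n 2^n) tends to the
   indicator function of u < 1/2. *)
Definition cut_pos (a t : R) := 1 / 2 + (t - a) / (2 * (1 + `|a|)).
Definition cut a n t := (1 - cut_pos a t ^+ n) ^+ (n * 2 ^ n).

Lemma cut_posP a t : `|t| <= 1 -> 0 <= cut_pos a t <= 1.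
Proof.
move=> t1; have d0 : 0 < 2 * (1 + `|a|) by have := normr_ge0 a; lra.
have : `|(t - a) / (2 * (1 + `|a|))| <= 1 / 2.
  rewrite normrM normfV (gtr0_norm d0) ler_pdivrMr//.
  by have := ler_normB t a; lra.
by rewrite ler_norml /cut_pos => /andP[h1 h2]; apply/andP; split; lra.
Qed.

Lemma cut_bound a n t : `|t| <= 1 -> 0 <= cut a n t <= 1.
Proof.
move=> /(cut_posP a)/andP[h1 h2].
have : 0 <= cut_pos a t ^+ n <= 1 by rewrite exprn_ge0//= exprn_ile1.
rewrite /cut; move: (cut_pos a t ^+ n) => u /andP[u0 u1].
by rewrite exprn_ge0 ?subr_ge0//= exprn_ile1//; lra.
Qed.

Lemma cvg_cut a t : `|t| <= 1 -> cut a n t @[n --> \oo] --> ((t < a)%R%:R : R).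
Proof.
move=> t1; have d0 : 0 < 2 * (1 + `|a|) by have := normr_ge0 a; lra.
have -> : (t < a) = (cut_pos a t < 1 / 2).
  by rewrite /cut_pos gtrDl pmulr_llt0 ?invr_gt0// subr_lt0.
exact: cvg_soft_cut (cut_posP a t1).
Qed.

Definition trig_poly (h : R[i] -> R[i]) := exists K (p : {poly R[i]}),
  forall z, cabs z = 1 -> z ^+ K * h z = p.[z].

(* On the circle |f| = |p| for a polynomial p. *)
Definition rtrig (f : R[i] -> R) := trig_poly (fun z => ((f z)%:C)%C).

Lemma rtrig_cst c : rtrig (fun=> c).
Proof. by exists 0%N, ((c%:C)%C)%:P => z _; rewrite hornerC expr0 mul1r. Qed.

Lemma rtrigM f g : rtrig f -> rtrig g -> rtrig (fun z => f z * g z).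
Proof.
move=> [K [p hp]] [L [q hq]]; exists (K + L)%N, (p * q) => z z1.
by rewrite hornerM -hp// -hq// exprD rmorphM /= mulrACA.
Qed.

Lemma rtrigD f g : rtrig f -> rtrig g -> rtrig (fun z => f z + g z).
Proof.
move=> [K [p hp]] [L [q hq]]; exists (K + L)%N, ('X^L * p + 'X^K * q) => z z1.
rewrite hornerD !hornerM !hornerXn -hp// -hq// exprD rmorphD mulrDr.
by congr (_ + _); rewrite !mulrA // [z ^+ L * _]mulrC.
Qed.

Lemma rtrigX f n : rtrig f -> rtrig (fun z => f z ^+ n).
Proof.
move=> tf; elim: n => [|n IH]; first exact: rtrig_cst.
by under eq_fun do rewrite exprS; exact: rtrigM.
Qed.

Lemma rtrig_Re : rtrig (@complex.Re R).
Proof.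
exists 1%N, (((1 / 2)%:C)%C *: ('X^2 + 1)) => z z1.
rewrite expr1 hornerZ hornerD hornerXn hornerC.
have := cabs2E z; rewrite z1 expr1n => h.
by apply: complex_ext; case: z h {z1} => x y /= h; rewrite ?expr2 /=; nra.
Qed.

Lemma rtrig_Im : rtrig (@complex.Im R).
Proof.
exists 1%N, ((Complex 0 (- (1 / 2))) *: ('X^2 - 1)) => z z1.
rewrite expr1 hornerZ hornerD hornerN hornerXn hornerC.
have := cabs2E z; rewrite z1 expr1n => h.
by apply: complex_ext; case: z h {z1} => x y /= h; rewrite ?expr2 /=; nra.
Qed.

Lemma rtrig_cut a n f : rtrig f -> rtrig (fun z => cut a n (f z)).
Proof.
have cst := rtrig_cst.
move=> tf; apply: (@rtrigX (fun z => 1 - cut_pos a (f z) ^+ n)).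
under eq_fun do rewrite -mulN1r.
apply: (@rtrigD (fun=> 1)) => //; apply: (@rtrigM (fun=> -1)) => //.
apply: (@rtrigX (fun z => cut_pos a (f z))).
apply: (@rtrigD (fun=> 1 / 2)) => //; apply: rtrigM => //.
exact: (@rtrigD f (fun=> - a)).
Qed.

End IntegralFacts.

(** * Quadrants as a generating family stable under intersection *)

Section MeasureDetermination.
Variable R : realType.

Definition quad (a b : R) : set R[i] :=
  [set z | complex.Re z < a /\ complex.Im z < b].

Definition quads : set (set R[i]) := [set A | exists a b, A = quad a b].

Lemma setI_quads : setI_closed quads.
Proof.
move=> _ _ [a [b ->]] [c [d ->]]; exists (Num.min a c), (Num.min b d).
apply/seteqP; split => z; rewrite /quad /= !lt_min.
  by move=> [[-> ->] [-> ->]].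
by move=> [/andP[-> ->] /andP[-> ->]].
Qed.

Lemma measurable_quad a b : measurable (quad a b : set (borelC R)).
Proof.
have -> : quad a b = ((@complex.Re R) @^-1` `]-oo, a[%classic) `&`
    ((@complex.Im R) @^-1` `]-oo, b[%classic).
  by apply/seteqP; split => z; rewrite /quad /= !in_itv.
apply: (@measurableI _ (borelC R)); rewrite -[X in measurable X]setTI.
  exact: measurable_Re.
exact: measurable_Im.
Qed.

(** A half-open grid square of side 1/(n+1), written with quadrants so that it lies in the
    sigma-algebra they generate. *)
Definition cell (t : nat * (int * int)) : set R[i] :=
  quad ((t.2.1 + 1)%:~R / t.1.+1%:R) ((t.2.2 + 1)%:~R / t.1.+1%:R)
  `\` quad (t.2.1%:~R / t.1.+1%:R) ((t.2.2 + 1)%:~R / t.1.+1%:R)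
  `\` quad ((t.2.1 + 1)%:~R / t.1.+1%:R) (t.2.2%:~R / t.1.+1%:R).

Lemma cellP t z : cell t z <->
  (t.2.1%:~R / t.1.+1%:R <= complex.Re z < (t.2.1 + 1)%:~R / t.1.+1%:R) /\
  (t.2.2%:~R / t.1.+1%:R <= complex.Im z < (t.2.2 + 1)%:~R / t.1.+1%:R).
Proof.
rewrite /cell /quad /=; set a := _ / _; set b := _ / _; set c := _ / _; set d := _ / _.
split.
  move=> [[[h1 h2] h3] h4]; rewrite h1 h2 !andbT !leNgt.
  by split; apply/negP => h; [apply: h3|apply: h4].
by move=> [/andP[h1 h2] /andP[h3 h4]]; split; [split|] => //= -[];
  rewrite ltNge ?h1// ltNge h3.
Qed.

(** An open set is the union of the grid squares, over all mesh sizes, that it contains. These are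
    countably many, and the distance between two points of a square is less than twice its side. *)
Lemma measurable_quads : (measurable : set (set (borelC R))) = <<s quads >>.
Proof.
apply/seteqP; split; last first.
  apply: smallest_sub; first exact: (@sigma_algebra_measurable _ (borelC R)).
  by move=> _ [a [b ->]]; exact: measurable_quad.
apply: smallest_sub; first exact: smallest_sigma_algebra.
move=> O oO; pose T := g_sigma_algebraType quads.
pose F k : set T := if @unpickle (nat * (int * int))%type k is Some t
  then if `[< cell t `<=` O >] then cell t else set0 else set0.
have -> : O = \bigcup_k F k.
  apply/seteqP; split => z.
    move=> Oz; have [e e0 he] := (openC_P O).1 oO z Oz.
    pose n := Num.truncn (2 / e); pose N : R := n.+1%:R.
    have N0 : 0 < N by rewrite ltr0n.
    have Ne : 2 / N < e.
      by rewrite ltr_pdivrMr// mulrC -ltr_pdivrMr//; exact: truncnS_gt.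
    pose t := (n, (Num.floor (complex.Re z * N), Num.floor (complex.Im z * N))).
    have hf (x : R) : (Num.floor (x * N))%:~R / N <= x < (Num.floor (x * N) + 1)%:~R / N.
      by rewrite ler_pdivrMr// ltr_pdivlMr//; exact: floor_itv.
    have tz : cell t z by apply/cellP; split; exact: hf.
    have tO : cell t `<=` O.
      move=> w /cellP[]; rewrite -/N /= => hR hI; apply: he.
      apply: le_lt_trans Ne; apply: le_trans (ler_cabs_ReIm _) _.
      rewrite (_ : 2 / N = N^-1 + N^-1); last by ring.
      move: hR hI (hf (complex.Re z)) (hf (complex.Im z)).
      rewrite !intrD !mulrDl mul1r ReD ImD ReN ImN.
      move: ((Num.floor (complex.Re z * N))%:~R / N)
        ((Num.floor (complex.Im z * N))%:~R / N) (N^-1) => p q h.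
      move=> /andP[a1 a2] /andP[a3 a4] /andP[a5 a6] /andP[a7 a8].
      by apply: lerD; rewrite ler_norml; apply/andP; split; lra.
    exists (pickle t) => //; rewrite /F pickleK.
    by case: ifPn => // /asboolPn.
  move=> [k _]; rewrite /F; case: unpickle => [t|//].
  by case: ifPn => [/asboolP|//]; exact.
apply: (@bigcupT_measurable _ T) => k; rewrite /F; case: unpickle => [t|//].
case: ifPn => // _; have mq a b : measurable (quad a b : set T).
  by apply: sub_sigma_algebra; exists a, b.
by apply: (@measurableD _ T) => //; exact: (@measurableD _ T).
Qed.

Lemma bigcup_quads : \bigcup_k quad k%:R k%:R = setT.
Proof.
apply/seteqP; split => // z _.
pose M := Num.max (complex.Re z) (complex.Im z).
exists (Num.truncn `|M|).+1 => //.
have h := truncnS_gt `|M|.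
by split; apply: le_lt_trans h; apply: le_trans (ler_norm _);
  rewrite le_max lexx ?orbT.
Qed.

Lemma measurable_cut a n (f : borelC R -> R) : measurable_fun setT f ->
  measurable_fun setT (fun z => cut a n (f z)).
Proof.
move=> mf; apply: measurable_funX; apply: measurable_funB => //.
apply: measurable_funX; apply: measurable_funD => //.
by apply: measurable_funM => //; exact: measurable_funB.
Qed.

(** The indicator of a quadrant is its own square, so the squared products of cuts still converge to
    it, boundedly on the circle. *)
Lemma fine_quad (m : {finite_measure set (borelC R) -> \bar R}) a b :
  m (~` @circle R) = 0%E ->
  nsq m (fun z => ((cut a n (complex.Re z) * cut b n (complex.Im z))%:C)%C)
    @[n --> \oo] --> fine (m (quad a b)).
Proof.
move=> m0; have mq := measurable_quad a b.
rewrite -(measureI_circle m0 mq) -cint_cindic//.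
under eq_fun do rewrite nsqE.
apply: (proj1 ((cvg_ReImP _ _).1 _)); apply: (@cvg_cint _ m _ _ 1).
- move=> n; apply: cmeasurable_real; apply: measurable_cabs2.
  apply: cmeasurable_real; apply: measurable_funM; apply: measurable_cut.
    exact: measurable_Re.
  exact: measurable_Im.
- exact: cmeasurable_cindic.
- move=> n z z1; rewrite !cabs_real.
  have := ler_Re_cabs z; have := ler_Im_cabs z; rewrite z1.
  move=> /(cut_bound b n)/andP[b1 b2] /(cut_bound a n)/andP[a1 a2].
  by rewrite normrX normr_id normrM !ger0_norm// exprn_ile1 ?mulr_ge0 ?mulr_ile1.
- move=> z z1; apply/cvg_ReImP; split; last exact: cvg_cst.
  have := ler_Re_cabs z; have := ler_Im_cabs z; rewrite z1.
  move=> /(@cvg_cut _ b _) hb /(@cvg_cut _ a _) ha.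
  rewrite /= indicE.
  have hab : cut a n (complex.Re z) * cut b n (complex.Im z) @[n --> \oo] -->
      ((complex.Re z < a)%R%:R * (complex.Im z < b)%R%:R : R) by exact: cvgM.
  have : (cut a n (complex.Re z) * cut b n (complex.Im z)) ^+ 2 @[n --> \oo] -->
      (((complex.Re z < a)%R%:R * (complex.Im z < b)%R%:R) ^+ 2 : R) by exact: cvgM.
  have -> : (((complex.Re z < a)%R%:R * (complex.Im z < b)%R%:R) ^+ 2 : R) =
      (z \in quad a b)%:R.
    rewrite -natrM -natrX mulnb; congr (_%:R).
    have -> : (z \in quad a b) = (complex.Re z < a) && (complex.Im z < b).
      by apply/idP/idP => [|/andP[h1 h2]]; rewrite inE /quad //= => -[-> ->].
    by case: (_ && _).
  apply: cvg_trans; apply: near_eq_cvg; apply: nearW => n /=.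
  by rewrite expr0n addr0 sqr_sqrtr ?sqr_ge0.
Qed.

Lemma measure_trig_unique (m1 m2 : {finite_measure set (borelC R) -> \bar R}) :
  m1 (~` @circle R) = 0%E -> m2 (~` @circle R) = 0%E ->
  (forall p : {poly R[i]}, nsq m1 (fun z => p.[z]) = nsq m2 (fun z => p.[z])) ->
  forall A, measurable A -> m1 A = m2 A.
Proof.
move=> m10 m20 hp A mA.
have htrig f : rtrig f -> nsq m1 (fun z => ((f z)%:C)%C) = nsq m2 (fun z => ((f z)%:C)%C).
  move=> [K [p h]].
  have e z : cabs z = 1 -> cabs (((f z)%:C)%C) = cabs p.[z].
    by move=> z1; rewrite -h// cabsM cabsX z1 expr1n mul1r.
  by rewrite (nsq_unimodular m1 e) hp (nsq_unimodular m2 e).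
have hq a b : m1 (quad a b) = m2 (quad a b).
  have mq := measurable_quad a b.
  rewrite -measurable_finite// -[RHS]measurable_finite//; congr EFin.
  have ht n : rtrig (fun z => cut a n (complex.Re z) * cut b n (complex.Im z)).
    by apply: rtrigM; apply: rtrig_cut; [exact: rtrig_Re|exact: rtrig_Im].
  have c1 := @fine_quad m1 a b m10; have c2 := @fine_quad m2 a b m20.
  rewrite -(cvg_lim (@Rhausdorff R) c1) -(cvg_lim (@Rhausdorff R) c2).
  by under eq_fun do rewrite (htrig _ (ht _)).
apply: (@measure_unique _ R (borelC R) quads (fun k => quad k%:R k%:R)
  _ _ _ _ m1 m2 _ _ A mA).
- exact: measurable_quads.
- exact: setI_quads.
- by move=> k; exists k%:R, k%:R.
- exact: bigcup_quads.
- by move=> _ [a [b ->]]; exact: hq.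
- by move=> k; rewrite ltey_eq fin_num_measure//; exact: measurable_quad.
Qed.

End MeasureDetermination.

(** * Spectral measures *)

Section SpectralMeasures.
Variables (R : realType) (U : l2 R -> l2 R) (E : set (borelC R) -> l2 R -> l2 R).
Hypothesis bU : bounded_op U.
Hypothesis U_iso : forall x, l2norm (U x) = l2norm x.
Hypothesis hE : is_spectral_measure U E.
Implicit Types (A B D : set (borelC R)) (x y : l2 R).

Lemma spm_linear D : measurable D -> linear (E D).
Proof. by move=> mD; have [] := spm_bounded hE mD. Qed.

Lemma spm_idemE D x : measurable D -> E D (E D x) = E D x.
Proof. by move=> mD; have := congr1 (@^~ x) (spm_idem hE mD). Qed.

Lemma spm_inner D x : measurable D ->
  l2inner x (E D x) = ((l2norm (E D x) ^+ 2)%:C)%C.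
Proof. by move=> mD; rewrite -l2inner_self (spm_selfadj hE mD) spm_idemE. Qed.

Lemma l2_double_eq0 x : x + x = 0 -> x = 0.
Proof.
move=> h; apply: l2P => n; have := congr1 (fun y : l2 R => y n) h.
by rewrite l2D -mulr2n => /eqP; rewrite mulrn_eq0 => /eqP.
Qed.

(** For the constant family of empty sets the error in sigma-additivity has norm (n - 1) |E(set0) x|
    for n >= 1, and it must tend to 0. *)
Lemma spm_set0 x : E set0 x = 0.
Proof.
have := spm_sigma_additive hE (fun=> @measurable0 _ (borelC R)) _ x.
move=> /(_ (@trivIset_set0 _ _ _)); rewrite bigcup0// => h.
apply/eqP; rewrite -l2norm_eq0 eq_le l2norm_ge0 andbT.
rewrite -(cvg_lim (@Rhausdorff R) h); apply: limr_ge.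
  by apply/cvg_ex; eexists; exact: h.
exists 2%N => // n /= n2; rewrite sumr_const card_ord -scaler_nat.
rewrite -[X in l2norm (X - _)]scale1r -scalerBl l2normZ.
rewrite (_ : 1 - n%:R = ((1 - n%:R)%:C)%C); last by rewrite rmorphB rmorph1 rmorph_nat.
rewrite cabs_real ler_peMl ?l2norm_ge0// distrC ger0_norm ?subr_ge0 ?ler1n 1?ltnW//.
by rewrite lerBrDr -(natrD _ 1 1) ler_nat.
Qed.

Lemma spmU A B x : measurable A -> measurable B -> A `&` B = set0 ->
  E (A `|` B) x = E A x + E B x.
Proof.
move=> mA mB AB.
have mF n : measurable (bigcup2 A B n : set (borelC R)).
  by case: n => [|[|n]] //=; exact: measurable0.
have tF : trivIset setT (bigcup2 A B) by rewrite -trivIset_bigcup2.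
have := spm_sigma_additive hE mF tF x; rewrite bigcup2E => h.
apply/eqP; rewrite -subr_eq0 -l2norm_eq0; apply/eqP.
apply: (cvg_unique _ _ h); first exact: Rhausdorff.
apply: cvg_near_cst; exists 2%N => // -[|[|n]]// _.
rewrite 2!big_ord_recl /= big1 ?addr0// => i _; exact: spm_set0.
Qed.

Let mC : measurable (@circle R : set (borelC R)).
Proof. exact: measurable_circle. Qed.
Let mCc : measurable (~` @circle R : set (borelC R)).
Proof. exact: measurableC. Qed.

Lemma spmT_split x : E setT x = x + E (~` @circle R) x.
Proof.
rewrite -(setUv (@circle R)) spmU// ?setICr//.
by have -> : E (@circle R) x = x by have := congr1 (@^~ x) (spm_circle hE).
Qed.

(** With P this projection, E of the whole plane is 1 + P; idempotence of both P and 1 + P gives 2 P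
    = 0. *)
Lemma spm_off x : E (~` @circle R) x = 0.
Proof.
have h := spm_idemE x (@measurableT _ (borelC R)).
apply: l2_double_eq0; move: h; rewrite [E setT (E _ _)]spmT_split spmT_split.
rewrite (bopD (spm_linear mCc)) (spm_idemE x mCc) => /eqP.
by rewrite -subr_eq0 addrAC subrr add0r => /eqP.
Qed.

Lemma spmT x : E setT x = x.
Proof. by rewrite spmT_split spm_off addr0. Qed.

(** Two idempotents whose sum is idempotent annihilate each other: on y = E(B) x one gets E(A) y +
    E(B) E(A) y = 0, and applying E(B) gives 2 E(B) E(A) y = 0. *)
Lemma spm_disjoint A B x : measurable A -> measurable B -> A `&` B = set0 ->
  E A (E B x) = 0.
Proof.
move=> mA mB AB; have lA := spm_linear mA; have lB := spm_linear mB.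
set y := E B x; have By : E B y = y by exact: spm_idemE.
have h := spm_idemE y (measurableU _ _ mA mB).
rewrite !spmU// By (bopD lA) (bopD lB) By (spm_idemE y mA) in h.
have k : E A y + E B (E A y) = 0.
  move/eqP: h; rewrite -subr_eq0 => /eqP <-.
  by apply: l2P => n; rewrite !(l2D, l2N, l2B); ring.
have k2 : E B (E A y) = 0.
  apply: l2_double_eq0; have := congr1 (E B) k.
  by rewrite (bopD lB) (bop0 lB) (spm_idemE _ mB).
by rewrite k2 addr0 in k.
Qed.

Lemma spmI A B x : measurable A -> measurable B -> E A (E B x) = E (A `&` B) x.
Proof.
move=> mA mB; have mI := measurableI _ _ mA mB.
have eA : E A (E (A `&` B) x) = E (A `&` B) x.
  rewrite -[in E A](setUIDK A B) spmU//; last 2 first.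
  - exact: measurableD.
  - by apply/seteqP; split => z // [[? ?] []].
  rewrite (spm_idemE x mI) [X in _ + X]spm_disjoint ?addr0//.
    exact: measurableD.
  by apply/seteqP; split => z // [[? ?] []].
have eB : E B x = E (A `&` B) x + E (B `\` A) x.
  rewrite -spmU//.
  - by rewrite setIC setUIDK.
  - exact: measurableD.
  - by apply/seteqP; split => z // [[? ?] []].
rewrite eB (bopD (spm_linear mA)) eA [X in _ + X]spm_disjoint ?addr0//.
  exact: measurableD.
by apply/seteqP; split => z // [? []].
Qed.

(** The set function <x, E(D) x> of [spm_integral], in a form that is visibly nonnegative. *)
Definition spm_at x D : \bar R := (l2norm (E D x) ^+ 2)%:E.

Let spm_at0 x : spm_at x set0 = 0%E.
Proof. by rewrite /spm_at spm_set0 l2norm0 expr0n. Qed.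

Let spm_at_ge0 x A : (0 <= spm_at x A)%E.
Proof. by rewrite lee_fin sqr_ge0. Qed.

Let spm_at_sigma x : semi_sigma_additive (spm_at x).
Proof.
move=> F mF tF mUF.
have e A : measurable A -> l2norm (E A x) ^+ 2 = complex.Re (l2inner x (E A x)).
  by move=> mA; rewrite spm_inner.
rewrite /spm_at e//.
rewrite (_ : (fun n => _) = (fun n =>
    (complex.Re (l2inner x (\sum_(k < n) E (F k) x)))%:E)); last first.
  apply/funext => n; rewrite (big_morph (l2inner x) (l2innerDr x) (l2inner0r x)).
  rewrite ReSum -sumEFin big_mkord; apply: eq_bigr => k _; by rewrite e.
apply: cvg_EFin; first exact: nearW.
have cv : l2norm x * l2norm (E (\bigcup_n F n) x - \sum_(k < n) E (F k) x)
    @[n --> \oo] --> (0 : R).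
  rewrite -(mulr0 (l2norm x)); apply: cvgM; first exact: cvg_cst.
  exact: (spm_sigma_additive hE mF tF x).
apply/cvgrPdist_le => e0 e0_gt0; move/cvgrPdist_le : cv => /(_ _ e0_gt0).
apply: filterS => n; rewrite sub0r normrN ger0_norm ?mulr_ge0 ?l2norm_ge0//.
move=> h; rewrite -ReN -ReD -l2innerBr; apply: le_trans (ler_Re_cabs _) _.
exact: le_trans (cauchy_schwarz _ _) h.
Qed.

HB.instance Definition _ x := isMeasure.Build _ _ _ (spm_at x)
  (spm_at0 x) (spm_at_ge0 x) (@spm_at_sigma x).

Let spm_at_fin x : fin_num_fun (spm_at x).
Proof. by []. Qed.

HB.instance Definition _ x := @Measure_isFinite.Build _ _ _ (spm_at x)
  (@spm_at_fin x).

Notation nu := spm_at.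

Lemma spm_int x : l2inner x (U x) = cintegral (nu x) (@circle R) id.
Proof.
rewrite (spm_integral hE) /cintegral; congr Complex; congr fine;
  by apply: eq_integral_setfun => A mA; rewrite spm_inner.
Qed.

Lemma cint_add_measure (m m1 m2 : {finite_measure set (borelC R) -> \bar R}) f :
  admissible f -> (forall A, measurable A -> m A = m1 A + m2 A)%E ->
  cintegral m (@circle R) f = cintegral m1 (@circle R) f + cintegral m2 (@circle R) f.
Proof.
move=> hf h.
have key (p : R[i] -> R) : m1.-integrable (@circle R) (EFin \o p) ->
    m2.-integrable (@circle R) (EFin \o p) ->
    fine (\int[m]_(z in @circle R) (p z)%:E) =
    fine (\int[m1]_(z in @circle R) (p z)%:E) +
    fine (\int[m2]_(z in @circle R) (p z)%:E).
  move=> i1 i2; rewrite (@eq_integral_setfun _ m (measure_add m1 m2)); last first.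
    by move=> A mA; rewrite h// measure_addE.
  rewrite integral_measure_add// fineD//; exact: integrable_fin_num.
apply: complex_ext; rewrite ?ReD ?ImD.
  by apply: key; exact: admissible_Re.
by apply: key; exact: admissible_Im.
Qed.

(* The measures of x, y and x + y add up, so the polarization terms vanish. *)
Lemma spm_orthogonal x y :
  (forall A, measurable A -> l2inner (E A x) (E A y) = 0) -> l2inner x (U y) = 0.
Proof.
have key x' y' : (forall A, measurable A -> l2inner (E A x') (E A y') = 0) ->
    l2inner x' (U y') + l2inner y' (U x') = 0.
  move=> h; have := @cint_add_measure (nu (x' + y')) (nu x') (nu y') id (admissible_id _).
  rewrite -!spm_int => /(_ _)/eqP; rewrite (bopD bU.1) !l2innerDr !l2innerDl.
  move=> e; apply/eqP; rewrite -subr_eq0.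
  move: e => /(_ _); rewrite -subr_eq0 => e.
  rewrite (_ : _ - 0 = l2inner x' (U x') + l2inner y' (U x') +
    (l2inner x' (U y') + l2inner y' (U y')) -
    (l2inner x' (U x') + l2inner y' (U y'))); last by ring.
  apply: e => A mA; rewrite /= /nu (bopD (spm_linear mA)) l2normD_sqr h//.
  by rewrite mulr0 addr0.
move=> h; have k1 := key x y h.
(* Replacing y by i y changes the relative sign of the two terms, so each of them vanishes. *)
have k2 : 'i%C * l2inner x (U y) + ('i%C)^* * l2inner y (U x) = 0.
  rewrite -l2innerZr -l2innerZl -(bopZ bU.1); apply: key => A mA.
  by rewrite (bopZ (spm_linear mA)) l2innerZr h// mulr0.
move: k1 k2; move: (l2inner x (U y)) (l2inner y (U x)) => [s1 s2] [t1 t2].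
move=> /eqP; rewrite eq_complex /= => /andP[/eqP h1 /eqP h2].
move=> /eqP; rewrite eq_complex /= => /andP[/eqP h3 /eqP h4].
by apply: complex_ext => /=; lra.
Qed.

(** By [spm_orthogonal], U maps the range of E(B) into the kernel of E(A) for disjoint A and B;
    applied to D and its complement, this is commutation. *)
Lemma spm_comm D x : measurable D -> U (E D x) = E D (U x).
Proof.
move=> mD; have lD := spm_linear mD.
have cross A B y : measurable A -> measurable B -> A `&` B = set0 ->
    E A (U (E B y)) = 0.
  move=> mA mB AB; apply: l2inner_inj => w.
  rewrite (spm_selfadj hE mA) l2inner0l l2innerC.
  rewrite spm_orthogonal ?conjC0// => F mF.
  rewrite (spm_selfadj hE mF) (spmI _ mF mF) setIid.
  rewrite (spm_selfadj hE mA) !spmI//.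
    by rewrite setIAC AB set0I spm_set0 l2inner0r.
  exact: measurableI.
have mDc : measurable (~` D) by exact: measurableC.
have split y : y = E D y + E (~` D) y.
  by rewrite -spmU ?setUv ?spmT ?setICr.
rewrite [RHS](_ : _ = E D (U (E D x))); last first.
  rewrite [in LHS](split x) (bopD bU.1) (bopD lD) [X in _ + X]cross ?addr0//.
  exact: setICr.
by rewrite [LHS]split [X in _ + X]cross ?addr0// setICl.
Qed.

Lemma integral_indicr (m : {measure set (borelC R) -> \bar R}) D A (f : borelC R -> \bar R) :
  (\int[m]_(z in D) (f z * (\1_A z)%:E) = \int[m]_(z in D `&` A) f z)%E.
Proof.
rewrite integral_mkcondr; apply: eq_integral => z _; rewrite patchE indicE.
by case: ifP => _; rewrite ?mule1 ?mule0.
Qed.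

(** On the circle |z - c|^2 expands into constants and a first moment, which is all that
    [spm_integral] provides. *)
Lemma nsq_resolvent y c :
  l2norm (U y - c *: y) ^+ 2 = nsq (nu y) (fun z => z - c).
Proof.
rewrite l2norm_subZ_sqr U_iso.
have e : (fun z : R[i] => z - c) = (fun z => z + (- c) * 1).
  by apply/funext => z; rewrite mulr1.
have a1 : admissible (fun=> 1 : R[i]) by exact: admissible_cst.
have ai := admissible_id R.
rewrite e nsq_add//.
have n1 : nsq (nu y) (fun=> 1) = l2norm y ^+ 2.
  rewrite nsqE Re_cint cabs1 expr1n Rintegral_cst// mul1r /=.
  by have -> : E (@circle R) y = y by have := congr1 (@^~ y) (spm_circle hE).
have -> : nsq (nu y) id = nsq (nu y) (fun=> 1).
  by apply: nsq_unimodular => z z1; rewrite z1 cabs1.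
rewrite n1 cabsN; have -> : ip (nu y) id (fun=> 1) = l2inner (U y) y.
  rewrite l2innerC spm_int -cintJ//; apply: eq_cint => z _.
  by rewrite mulr1.
by rewrite mulNr ReN; ring.
Qed.

(** The cut to the circle makes this density bounded, hence integrable over the plane. *)
Definition res_weight c (z : R[i]) : R := \1_(@circle R) z * cabs (z - c) ^+ 2.

Lemma measurable_res_weight c : measurable_fun setT (res_weight c : borelC R -> R).
Proof.
apply: measurable_funM; first exact: measurable_indic.
apply: measurable_cabs2; apply: cmeasurableD; first exact: cmeasurable_id.
exact: cmeasurable_cst.
Qed.

Lemma res_weight_ge0 c z : 0 <= res_weight c z.
Proof. by rewrite mulr_ge0 ?sqr_ge0// indicE. Qed.

Lemma res_weight_le c z : res_weight c z <= (1 + cabs c) ^+ 2.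
Proof.
rewrite /res_weight indicE; case: (boolP (z \in _)) => [|_]; last first.
  by rewrite mul0r sqr_ge0.
rewrite inE => /circleP z1; rewrite mul1r lerXn2r ?nnegrE ?cabs_ge0//.
  by rewrite addr_ge0 ?cabs_ge0.
by apply: le_trans (cabsD _ _) _; rewrite z1 cabsN.
Qed.

Lemma integrable_res_weight (m : {finite_measure set (borelC R) -> \bar R}) c :
  m.-integrable setT (EFin \o res_weight c).
Proof.
apply: measurable_bounded_integrable => //.
- by rewrite ltey_eq fin_num_measure.
- exact: measurable_res_weight.
exists ((1 + cabs c) ^+ 2); split; first exact: num_real.
move=> N MN z _ /=; rewrite ger0_norm ?res_weight_ge0//.
exact: le_trans (res_weight_le c z) (ltW MN).
Qed.

(** By commutation the left side is |(U - c) y|^2 with y = E(A) x. Then [nsq_resolvent] applies to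
    y, whose measure is that of x restricted to A. *)
Lemma spm_resolvent x c A : measurable A ->
  nu (U x - c *: x) A = (\int[nu x]_(z in A) (res_weight c z)%:E)%E.
Proof.
move=> mA; have lA := spm_linear mA; set y := E A x.
have yE : E A (U x - c *: x) = U y - c *: y.
  by rewrite (bopB lA) (bopZ lA) spm_comm.
have nuy B : measurable B -> nu y B = (\int[nu x]_(z in B) (\1_A z)%:E)%E.
  move=> mB; rewrite integral_indic// /nu /= /spm_at /y spmI//.
  by rewrite setIC.
pose f (z : borelC R) := (cabs (z - c) ^+ 2)%:E.
have mf : measurable_fun setT f.
  apply/measurable_EFinP; apply: measurable_cabs2; apply: cmeasurableD.
    exact: cmeasurable_id.
  exact: cmeasurable_cst.
have f0 z : (0 <= f z)%E by rewrite lee_fin sqr_ge0.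
have i1 : (nu x).-integrable setT (fun z => (\1_A z)%:E).
  by apply: integrable_indic => //; rewrite setTI ltry.
have d := @integral_density _ (nu y) (nu x) (fun z => (\1_A z)%:E) _ i1 nuy
  _ f mC (measurable_funTS mf) f0.
have : (\int[nu y]_(z in @circle R) f z = \int[nu x]_(z in A) (res_weight c z)%:E)%E.
  rewrite d; last by move=> z; rewrite lee_fin indicE.
  rewrite integral_indicr setIC -integral_indicr; apply: eq_integral => z _.
  by rewrite /f /res_weight mulrC EFinM.
rewrite {1}/nu /= /spm_at yE nsq_resolvent nsqE Re_cint => <-.
rewrite fineK//; apply: integrable_fin_num => //.
apply: (@integrable_circle _ _ _ ((1 + cabs c) ^+ 2)).
  exact/measurable_EFinP.
move=> z z1; have := res_weight_le c z; rewrite /res_weight indicE mem_set//=.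
  by rewrite mul1r ger0_norm ?sqr_ge0.
exact/circleP.
Qed.

Lemma opfac_resolvent s x c :
  opfac U s (U x - c *: x) = U (opfac U s x) - c *: opfac U s x.
Proof.
elim: s => [//|b s IH] /=; rewrite IH !(bopB bU.1) !(bopZ bU.1) !scalerBr !scalerA.
by rewrite [b * c]mulrC subrACA.
Qed.

Lemma admissible_polyfac s : admissible (polyfac s : R[i] -> R[i]).
Proof.
elim: s => [|c s IH].
  rewrite (_ : polyfac [::] = fun=> 1); first exact: admissible_cst.
  by apply/funext => z; rewrite /polyfac big_nil.
rewrite (_ : polyfac (c :: s) = fun z => (z - c) * polyfac s z).
  apply: admissibleM => //; apply: admissibleB; first exact: admissible_id.
  exact: admissible_cst.
by apply/funext => z; rewrite /polyfac big_cons.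
Qed.

(** The induction is over all x: the factor z - c is moved into the vector, replacing x by (U - c)
    x, whose measure has density |z - c|^2 with respect to that of x. *)
Lemma nsq_opfac s x : nsq (nu x) (polyfac s) = l2norm (opfac U s x) ^+ 2.
Proof.
elim: s x => [|c s IH] x.
  rewrite nsqE Re_cint; under eq_Rintegral do rewrite /polyfac big_nil cabs1 expr1n.
  rewrite Rintegral_cst// mul1r /=.
  by have -> : E (@circle R) x = x by have := congr1 (@^~ x) (spm_circle hE).
rewrite /= -opfac_resolvent -IH !nsqE !Re_cint; congr fine.
have [mp _] := admissible_polyfac s.
rewrite (@integral_density _ (nu (U x - c *: x)) (nu x) (EFin \o res_weight c)) //.
- apply: eq_integral => z; rewrite inE => Cz.
  rewrite /res_weight /= indicE mem_set//= mul1r -EFinM /polyfac big_cons cabsM exprMn.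
  by rewrite mulrC.
- by move=> z; rewrite lee_fin res_weight_ge0.
- exact: integrable_res_weight.
- by move=> A mA; exact: spm_resolvent.
- by apply/measurable_EFinP; apply: measurable_funTS; exact: measurable_cabs2.
- by move=> z; rewrite lee_fin sqr_ge0.
Qed.

Lemma nsqZ (m : {finite_measure set (borelC R) -> \bar R}) c f : admissible f ->
  nsq m (fun z => c * f z) = cabs c ^+ 2 * nsq m f.
Proof.
move=> hf; rewrite !nsqE.
have ha : admissible (fun z => ((cabs (f z) ^+ 2)%:C)%C) by exact: admissible_cabs2.
transitivity (complex.Re (((cabs c ^+ 2)%:C)%C *
    cintegral m (@circle R) (fun z => ((cabs (f z) ^+ 2)%:C)%C))).
  rewrite -cintZ//; congr complex.Re; apply: eq_cint => z _.
  by rewrite cabsM exprMn rmorphM.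
by rewrite ReM mul0r subr0.
Qed.

Lemma spectral_measure_entry (m : {finite_measure set (borelC R) -> \bar R}) :
  m (~` @circle R) = 0%E ->
  (forall s, nsq m (polyfac s) = l2norm (opfac U s (l2e R 0)) ^+ 2) ->
  forall D, measurable D -> ((fine (m D))%:C)%C = mxentry (E D) 0 0.
Proof.
move=> m0 hm D mD.
rewrite (@measure_trig_unique _ m (nu (l2e R 0)) m0)//.
- by rewrite /mxentry -l2inner_e spm_inner.
- by rewrite /= /spm_at spm_off l2norm0 expr0n.
(* Splitting into linear factors reduces p to a root list; for p = 0 the leading coefficient is
   0. *)
move=> p; have [s ps] := closed_field_poly_normal p.
have e : horner p = (fun z => lead_coef p * polyfac s z).
  apply/funext => z; rewrite {1}ps hornerZ horner_prod; congr (_ * _).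
  by apply: eq_bigr => c _; rewrite hornerXsubC.
by rewrite e !nsqZ ?hm ?nsq_opfac//; exact: admissible_polyfac.
Qed.

End SpectralMeasures.

(** * The spectral data of U in terms of mu *)

Theorem theorem5p4 (R : realType) (alpha : nat -> R[i])
    (mu : probability (borelC R) R) (phi : nat -> ratfun R) (a : nat -> R[i])
    (alpha_0 : alpha 0%N = 0)
    (alpha_disk : forall n, cabs (alpha n) < 1)
    (alpha_compact : sup (range (fun n => cabs (alpha n))) < 1)
    (mu_circle : measure_on_circle mu)
    (phi_ORF : is_ORF alpha mu phi a) :
  let chi := chi_of alpha phi in
  let U := opmoebius (Aop alpha) (Cop a) in
  [/\ forall E : set (borelC R) -> l2 R -> l2 R,
        is_spectral_measure U E ->
        forall D : set (borelC R), measurable D ->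
          ((fine (mu D))%:C)%C = mxentry (E D) 0 0,
      msupport mu = spectrum U,
      (forall z, mass_point mu z <-> is_eigenvalue U z) /\
      (forall z, is_eigenvalue U z -> geometrically_simple U z),
      forall z, (forall n, ~ is_pole (chi n) z) ->
        (mass_point mu z <-> in_l2 (fun n => reval (chi n) z))
    & forall z, mass_point mu z ->
        [/\ forall x : l2 R, U x = z *: x <->
              exists c : R[i], forall n, x n = c * (reval (chi n) z)^*,
            mu [set z] = ((sqsum (fun n => reval (chi n) z))^-1)%E
          & mu [set z] = ((sqsum (fun n => reval (phi n) z))^-1)%E]].
Proof.
move=> chi U.
pose r := sup (range (fun n => cabs (alpha n))).
have alpha_r n : cabs (alpha n) <= r.
  apply: sup_upper_bound; last by exists n.
  split; first by exists (cabs (alpha 0%N)), 0%N.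
  by exists 1 => _ [k _ <-]; exact: ltW.
have mu1 := mu_circle.1.
have a1 := orf_disk phi_ORF; have phi_0 := orf_0 phi_ORF.
have phi_rec := orf_rec phi_ORF; have phi_rec_star := orf_rec_star phi_ORF.
have [V [bV VU' UV' ad]] := U_inverse alpha_r alpha_compact a1.
have VU x : V (U x) = x by have := congr1 (@^~ x) VU'.
have UV x : U (V x) = x by have := congr1 (@^~ x) UV'.
have bU := bounded_U alpha_r alpha_compact a1.
have U_iso := U_isometry alpha_r alpha_compact a1.
have massP := mass_chi alpha_r alpha_compact mu1 phi_ORF UV ad.
split.
- move=> E hE; apply: (spectral_measure_entry bU U_iso hE (m := mu)).
    apply: (mu_off_circle mu1); first by apply: measurableC; exact: measurable_circle.
    by move=> z zc /circleP.
  have adm := admissible_reval_chi alpha_r alpha_compact a1 phi_0 phi_rec phi_rec_star.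
  have phi_on : forall i j, ip mu (reval (phi i)) (reval (phi j)) = (i == j)%:R :=
    orf_orthonormal phi_ORF.
  have chi_on := chi_orthonormal alpha_r alpha_compact a1 phi_0 phi_rec phi_rec_star phi_on.
  have V_chi := V_entries alpha_r alpha_compact a1 phi_0 phi_rec phi_rec_star phi_on ad.
  move=> s; have [//] := represents_polyfac adm chi_on (reval_chi0 alpha phi_0)
    U_iso UV ad V_chi s.
- exact: (msupport_spectrum alpha_r alpha_compact mu1 phi_ORF bV UV ad).
- split=> z.
    exact: (mass_eigenvalue alpha_r alpha_compact mu1 phi_ORF bV VU UV ad).
  exact: (eigenvalue_simple alpha_r alpha_compact phi_ORF bV VU UV ad).
- move=> z np; split; first by move=> /massP[].
  exact: (chi_val_l2_mass alpha_r alpha_compact mu1 phi_ORF UV ad).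
- move=> z mz; have [z1 _ e] := massP z mz; split => //.
    by move=> x; exact: (eigen_chi alpha_r alpha_compact phi_ORF bV VU UV ad x z1).
  rewrite e; congr (_^-1)%E; apply: sqsum_cabs => n.
  exact: (cabs_reval_chi alpha_r alpha_compact a1 phi_0 phi_rec phi_rec_star n z1).
Qed.
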